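(* Let $k\geq 1$ be an integer, let $u_0\in\mathcal{E}$ satisfy $\langle z\rangle^k u_0\in L^2(\mathbb{C})$, and let $u\in\mathcal{C}^\infty(\mathbb{R},\mathcal{E})$ be the unique solution of $i\partial_t u=\Pi(|u|^2u)$ with $u(0)=u_0$. Then there is a constant $C_k$ (independent of $t$, but allowed to depend on $u_0$) such that, for all $t\in\mathbb{R}$, $$\Vert \langle z\rangle ^ku(t)\Vert _{L^2(\mathbb{C})}\leq C_k(1+|t|)^{\frac{k-1}{2}}.$$
   Context: $dL$ is Lebesgue measure on $\mathbb{C}$ and $\langle z\rangle=(1+|z|^2)^{1/2}$. The Bargmann–Fock space is $$\mathcal{E}=\{u(z)=e^{-|z|^2/2}f(z): f \text{ entire holomorphic}\}\cap L^2(\mathbb{C}),$$ equipped with the $L^2(\mathbb{C})$ norm. The orthogonal projection $\Pi$ onto $\mathcal{E}$ is given by $[\Pi u](z)=\frac1\pi e^{-|z|^2/2}\int_{\mathbb{C}} e^{\overline{w}z-|w|^2/2}u(w)\,dL(w)$. For every $u_0\in\mathcal{E}$ the Cauchy problem $i\partial_t u=\Pi(|u|^2u)$, $u(0)=u_0$ has a unique solution in $\mathcal{C}^\infty(\mathbb{R},\mathcal{E})$. *)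

(* Defs.v *)
From HB Require Import structures.
From mathcomp Require Import all_boot all_order all_algebra.
From mathcomp Require Import complex.
From mathcomp Require Import all_classical all_reals all_analysis.

Set Implicit Arguments.
Unset Strict Implicit.
Unset Printing Implicit Defensive.

Import Order.TTheory GRing.Theory Num.Theory.
Import numFieldNormedType.Exports.

Local Open Scope classical_set_scope.
Local Open Scope ring_scope.
Local Open Scope complex_scope.

Section BargmannFock.
Context {R : realType}.
Local Notation C := R[i].
Local Notation plane := (measurableTypeR R * measurableTypeR R)%type.

(* C is identified with the plane: dL is the product Lebesgue measure on R * R,
   and a function u on C is integrated through (x, y) |-> u (x +i* y). *)
Definition dL : {measure set plane -> \bar R} :=
  (@lebesgue_measure R \x @lebesgue_measure R)%E.

Definition on_plane (T : Type) (u : C -> T) : plane -> T :=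
  fun p => u ((p.1 : R) +i* (p.2 : R)).

(* The library norm `|z| on R[i] takes values in R[i]; its imaginary part is 0. *)
Definition modulus (z : C) : R := complex.Re `|z|.

Definition bracket (z : C) : R := Num.sqrt (1 + modulus z ^+ 2).

Definition cexp (z : C) : C :=
  (expR (complex.Re z))%:C * (cos (complex.Im z) +i* sin (complex.Im z)).

Definition Cintegral (u : C -> C) : C :=
  Rintegral dL setT (on_plane (fun z => complex.Re (u z)))
  +i* Rintegral dL setT (on_plane (fun z => complex.Im (u z))).

Definition L2norm (u : C -> C) : \bar R :=
  ('N[dL]_(2%:E)[on_plane (fun z => (modulus (u z))%:E)])%E.

Definition in_L2 (u : C -> C) : Prop :=
  [/\ measurable_fun setT (on_plane (fun z => complex.Re (u z))),
      measurable_fun setT (on_plane (fun z => complex.Im (u z))) &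
      (L2norm u < +oo)%E].

(* The regular module C^o makes this the derivative in the complex sense. *)
Definition entire (f : C -> C) : Prop :=
  forall z : C, derivable (f : C^o -> C^o) z 1.

Definition gauss (z : C) : C := (expR (- (modulus z ^+ 2 / 2)))%:C.

(* Elements of the space are genuine functions rather than classes: each class
   has exactly one representative of the form e^(-|z|^2/2) f(z), f entire. *)
Definition bargmann_fock (u : C -> C) : Prop :=
  (exists2 f : C -> C, entire f & forall z, u z = gauss z * f z) /\ in_L2 u.

Definition fock_proj (u : C -> C) (z : C) : C :=
  (pi^-1)%:C * gauss z *
  Cintegral (fun w => cexp (conjc w * z - (modulus w ^+ 2 / 2)%:C) * u w).

Definition fock_derive (u : R -> C -> C) (t : R) (v : C -> C) : Prop :=
  L2norm (fun z => (h^-1)%:C * (u (t + h) z - u t z) - v z)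
    @[h --> (0 : R)^'] --> 0%E.

(* d n is the n-th derivative of u, as a curve in the space with its L2 norm. *)
Definition fock_smooth (u : R -> C -> C) : Prop :=
  exists d : nat -> R -> C -> C,
    [/\ d 0%N = u,
        forall n t, bargmann_fock (d n t) &
        forall n t, fock_derive (d n) t (d n.+1 t)].

Definition fock_solution (u0 : C -> C) (u : R -> C -> C) : Prop :=
  [/\ fock_smooth u,
      forall t, exists v : C -> C,
        [/\ bargmann_fock v, fock_derive u t v &
            forall z, 'i%C * v z =
              fock_proj (fun w => (modulus (u t w) ^+ 2)%:C * u t w) z] &
      u 0 = u0].

End BargmannFock.

(* Main.v *)
Require Import Defs.
From HB Require Import structures.
From mathcomp Require Import all_boot all_order all_algebra.
From mathcomp Require Import complex.
From mathcomp Require Import all_classical all_reals all_analysis.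
From mathcomp Require Import measurable_realfun.
From mathcomp Require Import ring lra.

(** In the orthonormal basis phi_n = z^n e^(-|z|^2/2) / sqrt (pi n!) of the
    space, write u(t) = sum_n c_n(t) phi_n. The weight |z|^(2k) keeps the phi_n
    orthogonal and multiplies their squared norms by (n + k)! / n!, which is of
    the order of n^k ([psum_moment], [rising_ge], [rising_le]). So the theorem
    says that the moment E_k = sum_n n^k |c_n|^2 is O((1 + |t|)^(k-1)).

    With the binomial weights B(S, i) = C(S, i) / 2^S, the equation reads
      i c_n' = (1 / (2 pi)) sum_(S >= n) A_S sqrt (B(S, n)) conj (c_(S-n)),
      A_S = sum_(i <= S) sqrt (B(S, i)) c_i c_(S-i)
    ([cubic_projection], [cubic_rate]): modes interact only through pairs of
    equal total degree S. For weights w_n this gives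
      d/dt sum_n w_n |c_n|^2 = (1 / pi) sum_S Im (A_S conj (A_S^w)),
      A_S^w = sum_(i <= S) sqrt (B(S, i)) w_i c_i c_(S-i).
    By symmetry w_i may be replaced by (w_i + w_(S-i)) / 2 in A_S^w, and a real
    multiple of A_S may be subtracted from A_S^w, since |A_S|^2 is real.
    By Cauchy-Schwarz, the size of what is left is the standard deviation of
    w_i + w_(S-i) for the binomial law B(S, i) ([Im_amp_le]). This law
    concentrates around S / 2 at the scale sqrt S, and the linear term of w
    about S / 2 cancels between i and S - i. For w_n = n^k the deviation is
    therefore of order S^(k-2) S = S^(k-1), one power better than w itself, and
      |E_k'| <= C M E_(k-1),  M = sum_n |c_n|^2.
    The mass M is conserved, E_1 stays bounded because w_i + w_(S-i) = S is then
    constant, and induction on k gives the exponent k - 1 ([moment_growth]).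
    Since the moments are not known to be finite beforehand, n is first
    replaced by the bounded weight N n / (N + n), and N tends to infinity at the
    end. For k = 1 the truncated moment is no longer conserved, but its
    variation over a given time interval is O(1 / N) ([first_moment]).

    To reach coefficients from entire functions known only to be complex
    differentiable, bisection proves the Cauchy theorem on rectangles
    ([goursat_rectangle]); in a logarithmic coordinate it yields the mean value
    property on circles about 0 ([circle_mean]). Averaging over all rotations
    evaluates the Gaussian mean of an entire function ([gaussian_mean]), and
    recentring it gives the reproducing formula ([reproducing]). Expanding the
    exponential kernel turns it into a power series whose coefficients are the
    scalar products with the phi_n ([fock_expansion]). The Bessel inequality
    ([bessel]) then transfers to coefficients both the time derivative
    ([coef_derivative]) and the decay of u0 ([initial_moment]), and the lemma of
    Fatou transfers the moment bounds back to functions ([bracket_upper]). *)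

Set Implicit Arguments.
Unset Strict Implicit.
Unset Printing Implicit Defensive.

Import Order.TTheory GRing.Theory Num.Theory.
Import numFieldNormedType.Exports.

Local Open Scope classical_set_scope.
Local Open Scope ring_scope.
Local Open Scope complex_scope.

Local Notation "z ^*" := (conjc z) : ring_scope.

(** * Sums over a triangle and binomial moments *)

Section FiniteSums.
Context {R : realType}.
Local Notation C := R[i].

Lemma eq_ler (x y : R) : x = y -> x <= y.
Proof. by move=> ->. Qed.

Lemma complex_eq (z w : C) : complex.Re z = complex.Re w -> complex.Im z = complex.Im w -> z = w.
Proof. by case: z w => a b [c d] /= -> ->. Qed.

Definition abs2 (z : C) : R := complex.Re z ^+ 2 + complex.Im z ^+ 2.

Lemma abs2_ge0 z : 0 <= abs2 z.
Proof. by rewrite addr_ge0// sqr_ge0. Qed.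

Lemma abs2M z w : abs2 (z * w) = abs2 z * abs2 w.
Proof. by case: z w => a b [c d]; rewrite /abs2 /=; ring. Qed.

Lemma abs2_real (r : R) : abs2 r%:C = r ^+ 2.
Proof. by rewrite /abs2 /= expr0n addr0. Qed.

Lemma abs2J z : abs2 z^* = abs2 z.
Proof. by case: z => a b; rewrite /abs2 /= sqrrN. Qed.

Lemma ReZ (r : R) z : complex.Re (r%:C * z) = r * complex.Re z.
Proof. by case: z => x y /=; rewrite mul0r subr0. Qed.

Lemma ImZ (r : R) z : complex.Im (r%:C * z) = r * complex.Im z.
Proof. by case: z => x y /=; rewrite mul0r addr0. Qed.

Lemma sum_pascal (S : nat) (g : nat -> R) :
  \sum_(i < S.+2) 'C(S.+1, i)%:R * g i =
  \sum_(i < S.+1) 'C(S, i)%:R * (g i + g i.+1).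
Proof.
under [RHS]eq_bigr do rewrite mulrDr.
rewrite big_split/= big_ord_recl/= bin0 mul1r.
under eq_bigr do rewrite /bump/= add1n binS natrD mulrDl.
rewrite big_split/= big_ord_recr/= bin_small// mul0r addr0.
rewrite addrA; congr (_ + _).
by rewrite [RHS]big_ord_recl/= bin0 mul1r.
Qed.

Lemma sum_binomial_sqr (S : nat) :
  \sum_(i < S.+1) 'C(S, i)%:R * (i%:R *+ 2 - S%:R) ^+ 2 = 2 ^+ S * S%:R :> R.
Proof.
elim: S => [|S IH]; first by rewrite big_ord1/= mul0rn subrr expr0n/= !mulr0.
rewrite (sum_pascal S (fun i => (i%:R *+ 2 - S.+1%:R) ^+ 2)).
have -> : \sum_(i < S.+1) 'C(S, i)%:R *
    ((i%:R *+ 2 - S.+1%:R) ^+ 2 + (i.+1%:R *+ 2 - S.+1%:R) ^+ 2) =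
  2 * (\sum_(i < S.+1) 'C(S, i)%:R * (i%:R *+ 2 - S%:R) ^+ 2) +
  2 * (\sum_(i < S.+1) 'C(S, i)%:R * 1 ^+ (S - i) * 1 ^+ i) :> R.
  rewrite !mulr_sumr -big_split/=; apply: eq_bigr => i _.
  by rewrite !expr1n -!natr1; ring.
rewrite IH; under [X in _ + 2 * X]eq_bigr do
  rewrite -mulrA [_%:R * _]mulrC mulr_natr.
by rewrite -exprDn -[S.+1%:R]natr1 [2 ^+ S.+1]exprS; ring.
Qed.

(** The steps of a simple random walk give
    E (X + e)^4 = E X^4 + 6 E X^2 + 1, which sums to 3 S^2 - 2 S. *)
Lemma sum_binomial_quartic (S : nat) :
  \sum_(i < S.+1) 'C(S, i)%:R * (i%:R *+ 2 - S%:R) ^+ 4 =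
  2 ^+ S * (3 * S%:R ^+ 2 - 2 * S%:R) :> R.
Proof.
elim: S => [|S IH]; first by rewrite big_ord1/= mul0rn subrr !expr0n/= !mulr0 subrr mulr0.
rewrite (sum_pascal S (fun i => (i%:R *+ 2 - S.+1%:R) ^+ 4)).
have -> : \sum_(i < S.+1) 'C(S, i)%:R *
    ((i%:R *+ 2 - S.+1%:R) ^+ 4 + (i.+1%:R *+ 2 - S.+1%:R) ^+ 4) =
  2 * (\sum_(i < S.+1) 'C(S, i)%:R * (i%:R *+ 2 - S%:R) ^+ 4) +
  12 * (\sum_(i < S.+1) 'C(S, i)%:R * (i%:R *+ 2 - S%:R) ^+ 2) +
  2 * (\sum_(i < S.+1) 'C(S, i)%:R * 1 ^+ (S - i) * 1 ^+ i) :> R.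
  rewrite !mulr_sumr -!big_split/=; apply: eq_bigr => i _.
  by rewrite !expr1n -!natr1; ring.
rewrite IH sum_binomial_sqr; under [X in _ + 2 * X]eq_bigr do
  rewrite -mulrA [_%:R * _]mulrC mulr_natr.
by rewrite -exprDn -[S.+1%:R]natr1 [2 ^+ S.+1]exprS; ring.
Qed.

Lemma sum_cauchy_schwarz (n : nat) (a b : nat -> R) :
  (\sum_(i < n) a i * b i) ^+ 2 <=
  (\sum_(i < n) a i ^+ 2) * (\sum_(i < n) b i ^+ 2).
Proof.
have : 0 <= \sum_(i < n) \sum_(j < n) (a i * b j - a j * b i) ^+ 2.
  by apply: sumr_ge0 => i _; apply: sumr_ge0 => j _; exact: sqr_ge0.
have -> : \sum_(i < n) \sum_(j < n) (a i * b j - a j * b i) ^+ 2 =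
  2 * ((\sum_(i < n) a i ^+ 2) * (\sum_(i < n) b i ^+ 2)) -
  2 * (\sum_(i < n) a i * b i) ^+ 2.
  transitivity (\sum_(i < n) \sum_(j < n) (a i ^+ 2 * b j ^+ 2) +
    \sum_(i < n) \sum_(j < n) (b i ^+ 2 * a j ^+ 2) -
    2 * \sum_(i < n) \sum_(j < n) (a i * b i) * (a j * b j)).
    rewrite mulr_sumr -sumrN -!big_split/=; apply: eq_bigr => i _.
    rewrite mulr_sumr -sumrN -!big_split/=; apply: eq_bigr => j _; ring.
  under eq_bigr do rewrite -mulr_sumr.
  under [X in _ + X - _]eq_bigr do rewrite -mulr_sumr.
  under [X in _ - _ * X]eq_bigr do rewrite -mulr_sumr.
  by rewrite -!mulr_suml; ring.
by lra.
Qed.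

Lemma abs2_sum_le (n : nat) (r : nat -> R) (z : nat -> C) :
  abs2 (\sum_(i < n) (r i)%:C * z i) <=
  (\sum_(i < n) r i ^+ 2) * (\sum_(i < n) abs2 (z i)).
Proof.
rewrite {1}/abs2 !raddf_sum/=.
under eq_bigr do rewrite ReZ.
under [X in _ + X ^+ 2 <= _]eq_bigr do rewrite ImZ.
rewrite big_split/= mulrDr; apply: lerD.
- exact: (sum_cauchy_schwarz n r (fun i => complex.Re (z i))).
- exact: (sum_cauchy_schwarz n r (fun i => complex.Im (z i))).
Qed.

(** The triangle i + j < L lies in the square i, j < L. *)
Lemma sum_triangle_le (p q : nat -> R) (L : nat) :
  (forall i, 0 <= p i) -> (forall i, 0 <= q i) ->
  \sum_(S < L) \sum_(i < S.+1) p i * q (S - i)%N <=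
  (\sum_(i < L) p i) * (\sum_(i < L) q i).
Proof.
move=> p0 q0; elim: L => [|L IH]; first by rewrite !big_ord0 mul0r.
have -> : \sum_(S < L.+1) \sum_(i < S.+1) p i * q (S - i)%N =
   \sum_(i < L.+1) p i * \sum_(j < L.+1 - i) q j.
  elim: L.+1 => [|m IHm]; first by rewrite !big_ord0.
  rewrite big_ord_recr/= IHm [RHS]big_ord_recr/= big_ord_recr/= addrA.
  rewrite -big_split/= subSnn big_ord1 subnn; congr (_ + _).
  apply: eq_bigr => i _; rewrite -mulrDr subSn; last exact/ltnW.
  by rewrite big_ord_recr.
rewrite mulr_suml; apply: ler_sum => i _; apply: ler_wpM2l => //.
rewrite -!(big_mkord xpredT q) [leRHS](big_cat_nat _ (n := (L.+1 - i)%N))//=.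
  by rewrite lerDl sumr_ge0.
by rewrite leq_subr.
Qed.

End FiniteSums.

(** * Binomial weights and the saturated variable *)

Section Weights.
Context {R : realType}.
Implicit Types (N x y : R) (k S : nat).

Definition binw S i : R := 'C(S, i)%:R / 2 ^+ S.

Lemma binw_ge0 S i : 0 <= binw S i.
Proof. by rewrite divr_ge0// exprn_ge0. Qed.

Lemma sum_binw S : \sum_(i < S.+1) binw S i = 1.
Proof.
rewrite -mulr_suml; under eq_bigr do rewrite -[_%:R]mulr1.
have := exprDn (1 : R) 1 S; under [X in _ = X]eq_bigr do
  rewrite !expr1n mulr1 -[1 *+ _]mulr1.
by move=> <-; rewrite divff// expf_neq0.
Qed.

Lemma sum_binw_quartic S :
  \sum_(i < S.+1) binw S i * (i%:R *+ 2 - S%:R) ^+ 4 <= 3 * S%:R ^+ 2.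
Proof.
rewrite (_ : \sum_(i < S.+1) _ = 3 * S%:R ^+ 2 - 2 * S%:R).
  by rewrite gerBl mulr_ge0.
under eq_bigr do rewrite /binw mulrAC.
by rewrite -mulr_suml sum_binomial_quartic mulrAC divff ?mul1r// expf_neq0.
Qed.

(** A smooth bounded truncation of x: the truncation has to keep the second
    differences of its k-th power of size x^(k-2) D uniformly in N, which a
    corner such as that of min(x, N) would spoil. *)
Definition satur N x : R := N * x / (N + x).

Lemma satur_ge0 N x : 0 < N -> 0 <= x -> 0 <= satur N x.
Proof. by move=> N0 x0; rewrite divr_ge0 ?mulr_ge0 ?addr_ge0// ltW. Qed.

Lemma satur_le N x : 0 < N -> 0 <= x -> satur N x <= x.
Proof.
move=> N0 x0; rewrite ler_pdivrMr; last by rewrite ltr_wpDr.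
by rewrite mulrC ler_wpM2l// lerDl.
Qed.

Lemma satur_leN N x : 0 < N -> 0 <= x -> satur N x <= N.
Proof.
move=> N0 x0; rewrite ler_pdivrMr; last by rewrite ltr_wpDr.
by rewrite ler_wpM2l ?lerDr// ltW.
Qed.

Lemma satur_half N x : 0 < N -> 0 <= x -> x <= N -> x <= 2 * satur N x.
Proof.
move=> N0 x0 xN; rewrite mulrA ler_pdivlMr; last by rewrite ltr_wpDr.
by nra.
Qed.

Lemma satur_sum N x y : 0 < N -> 0 <= x -> 0 <= y ->
  `|satur N x + satur N y - 2 * satur N ((x + y) / 2)| * (N + (x + y)) <=
  (x - y) ^+ 2 / 2.
Proof.
move=> N0 x0 y0.
have Nx : 0 < N + x by lra.
have Ny : 0 < N + y by lra.
have Nxy : 0 < 2 * N + (x + y) by lra.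
have -> : satur N x + satur N y - 2 * satur N ((x + y) / 2) =
   - (N ^+ 2 * (x - y) ^+ 2 / ((N + x) * (N + y) * (2 * N + (x + y)))).
  by rewrite /satur; field; do ?[apply/andP; split]; apply: lt0r_neq0; lra.
have D0 : 0 < (N + x) * (N + y) * (2 * N + (x + y)) by rewrite !mulr_gt0.
rewrite normrN ger0_norm; last first.
  by apply: divr_ge0; [rewrite mulr_ge0 ?sqr_ge0|exact: ltW].
rewrite mulrAC ler_pdivrMr//.
have h1 : N * (N + (x + y)) <= (N + x) * (N + y) by nra.
have h2 : N ^+ 2 * (N + (x + y)) * 2 <= (N + x) * (N + y) * (2 * N + (x + y)).
  apply: (@le_trans _ _ (N * (N + (x + y)) * (2 * N + (x + y)))).
    by rewrite -subr_ge0; nra.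
  by rewrite ler_wpM2r// ltW.
rewrite -[_ * (x - y) ^+ 2 * _]mulrAC [leRHS]mulrAC -mulrA [leRHS]mulrC.
have := ler_wpM2r (sqr_ge0 (x - y)) h2.
lra.
Qed.

Lemma satur_prod N x y : 0 < N -> 0 <= x -> 0 <= y ->
  `|satur N x * satur N y - satur N ((x + y) / 2) ^+ 2| <= (x - y) ^+ 2.
Proof.
move=> N0 x0 y0.
have Nx : 0 < N + x by lra.
have Ny : 0 < N + y by lra.
have Nxy : 0 < 2 * N + (x + y) by lra.
have -> : satur N x * satur N y - satur N ((x + y) / 2) ^+ 2 =
   - ((x - y) ^+ 2 * (N ^+ 2 * (N * (N + (x + y))) /
       ((N + x) * (N + y) * (2 * N + (x + y)) ^+ 2))).
  by rewrite /satur; field; do ?[apply/andP; split]; apply: lt0r_neq0; lra.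
have D0 : 0 < (N + x) * (N + y) * (2 * N + (x + y)) ^+ 2.
  by rewrite !mulr_gt0// exprn_gt0.
have S0 : 0 <= N * (N + (x + y)) by nra.
rewrite normrN normrM ger0_norm ?sqr_ge0// ger0_norm; last first.
  by rewrite divr_ge0 ?mulr_ge0 ?sqr_ge0//; nra.
rewrite -[leRHS]mulr1 ler_wpM2l ?sqr_ge0// ler_pdivrMr// mul1r.
rewrite mulrC; apply: ler_pM; rewrite ?sqr_ge0//; nra.
Qed.

(** The power sums of two numbers obey the recurrence
    p_(k+2) = (a + b) p_(k+1) - a b p_k, so a change of a + b and of a b
    propagates to every power. *)
Lemma satur_power_sum k : exists2 K : R, 0 <= K & forall N x y,
  0 < N -> 0 <= x -> 0 <= y ->
  `|satur N x ^+ k + satur N y ^+ k - 2 * satur N ((x + y) / 2) ^+ k|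
    * (x + y) ^+ 2 <= K * (x + y) ^+ k * (x - y) ^+ 2.
Proof.
suff [] : (exists2 K : R, 0 <= K & forall N x y, 0 < N -> 0 <= x -> 0 <= y ->
  `|satur N x ^+ k + satur N y ^+ k - 2 * satur N ((x + y) / 2) ^+ k|
    * (x + y) ^+ 2 <= K * (x + y) ^+ k * (x - y) ^+ 2) /\
 (exists2 K : R, 0 <= K & forall N x y, 0 < N -> 0 <= x -> 0 <= y ->
  `|satur N x ^+ k.+1 + satur N y ^+ k.+1 - 2 * satur N ((x + y) / 2) ^+ k.+1|
    * (x + y) ^+ 2 <= K * (x + y) ^+ k.+1 * (x - y) ^+ 2) by [].
elim: k => [|k [[K K0 HK] [K' K'0 HK']]].
  split; exists 1 => // N x y N0 x0 y0.
    by rewrite !expr0 mulr1 (_ : 1 + 1 - 2 = 0) ?normr0 ?mul0r ?mul1r ?sqr_ge0//; lra.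
  have h := satur_sum N0 x0 y0; rewrite !expr1 mul1r.
  set d := `|_| in h *; have d0 : 0 <= d by exact: normr_ge0.
  have : d * (x + y) <= (x - y) ^+ 2.
    have : 0 <= (x - y) ^+ 2 by exact: sqr_ge0.
    by nra.
  have xy0 : 0 <= x + y by lra.
  by move=> /(ler_wpM2r xy0); rewrite -mulrA -expr2 [_ ^+ 2 * (x + y)]mulrC.
split; first by exists K'.
exists (2 + K' + 2 + K) => [|N x y N0 x0 y0]; first by lra.
have xy0 : 0 <= x + y by lra.
have hx0 : 0 <= (x + y) / 2 by lra.
have a0 := satur_ge0 N0 x0; have b0 := satur_ge0 N0 y0.
have t0 := satur_ge0 N0 hx0.
have ha := satur_le N0 x0; have hb := satur_le N0 y0.
have ht := satur_le N0 hx0.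
have := HK N x y N0 x0 y0; have := HK' N x y N0 x0 y0.
have := satur_prod N0 x0 y0; have := satur_sum N0 x0 y0.
move: a0 b0 t0 ha hb ht.
set a := satur N x; set b := satur N y; set t := satur N _.
move=> a0 b0 t0 ha hb ht h1 h2 hk1 hk.
set s := x + y in xy0 h1 hk1 hk *.
set D := (x - y) ^+ 2 in h1 h2 hk1 hk *.
have D0 : 0 <= D by exact: sqr_ge0.
have pow (j : nat) : 0 <= a ^+ j + b ^+ j <= 2 * s ^+ j.
  rewrite addr_ge0 ?exprn_ge0//= mulr2n mulrDl mul1r; apply: lerD.
    by rewrite lerXn2r ?nnegrE//; rewrite /s; lra.
  by rewrite lerXn2r ?nnegrE//; rewrite /s; lra.
(* The recurrence for (a, b) minus the one for (t, t). *)
have -> : a ^+ k.+2 + b ^+ k.+2 - 2 * t ^+ k.+2 =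
  (a + b - 2 * t) * (a ^+ k.+1 + b ^+ k.+1)
  + 2 * t * (a ^+ k.+1 + b ^+ k.+1 - 2 * t ^+ k.+1)
  - (a * b - t ^+ 2) * (a ^+ k + b ^+ k)
  - t ^+ 2 * (a ^+ k + b ^+ k - 2 * t ^+ k).
  by rewrite !exprS; ring.
have h1s : `|a + b - 2 * t| * s <= D / 2.
  apply: le_trans h1; rewrite ler_wpM2l// lerDr ltW//.
have e1 : `|(a + b - 2 * t) * (a ^+ k.+1 + b ^+ k.+1)| * s ^+ 2 <=
    2 * (s ^+ k.+2 * D).
  have /andP[p0 p1] := pow k.+1.
  rewrite normrM (ger0_norm p0).
  have -> : `|a + b - 2 * t| * (a ^+ k.+1 + b ^+ k.+1) * s ^+ 2 =
    (`|a + b - 2 * t| * s) * ((a ^+ k.+1 + b ^+ k.+1) * s) by ring.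
  have -> : 2 * (s ^+ k.+2 * D) = D * (2 * s ^+ k.+1 * s) by rewrite !exprS; ring.
  apply: ler_pM; rewrite ?mulr_ge0//; first by lra.
  by rewrite ler_wpM2r.
have hts : t <= s by rewrite /s; lra.
have t2 : 0 <= 2 * t by lra.
have tt : 0 <= t ^+ 2 by exact: sqr_ge0.
have e2 : `|2 * t * (a ^+ k.+1 + b ^+ k.+1 - 2 * t ^+ k.+1)| * s ^+ 2 <=
    K' * (s ^+ k.+2 * D).
  rewrite normrM (ger0_norm t2) -mulrA.
  have -> : K' * (s ^+ k.+2 * D) = s * (K' * s ^+ k.+1 * D) by rewrite !exprS; ring.
  apply: ler_pM => //; rewrite ?mulr_ge0// ?exprn_ge0//.
  by rewrite /s; lra.
have e3 : `|(a * b - t ^+ 2) * (a ^+ k + b ^+ k)| * s ^+ 2 <=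
    2 * (s ^+ k.+2 * D).
  have /andP[p0 p1] := pow k.
  rewrite normrM (ger0_norm p0).
  have -> : 2 * (s ^+ k.+2 * D) = D * (2 * s ^+ k) * s ^+ 2 by rewrite !exprS; ring.
  by rewrite ler_wpM2r ?exprn_ge0//; apply: ler_pM.
have e4 : `|t ^+ 2 * (a ^+ k + b ^+ k - 2 * t ^+ k)| * s ^+ 2 <=
    K * (s ^+ k.+2 * D).
  rewrite normrM (ger0_norm tt) -mulrA.
  have -> : K * (s ^+ k.+2 * D) = s ^+ 2 * (K * s ^+ k * D) by rewrite !exprS; ring.
  apply: ler_pM => //; rewrite ?mulr_ge0// ?exprn_ge0//.
  by rewrite lerXn2r ?nnegrE.
have s2 : 0 <= s ^+ 2 by rewrite exprn_ge0.
have -> : (2 + K' + 2 + K) * s ^+ k.+2 * D = 2 * (s ^+ k.+2 * D) +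
    K' * (s ^+ k.+2 * D) + 2 * (s ^+ k.+2 * D) + K * (s ^+ k.+2 * D) by ring.
apply: le_trans (lerD (lerD (lerD e1 e2) e3) e4).
rewrite -!mulrDl; apply: ler_wpM2r => //.
apply: le_trans (ler_normB _ _) _; apply: lerD => //.
apply: le_trans (ler_normB _ _) _; apply: lerD => //.
exact: ler_normD.
Qed.

End Weights.

(** * Amplitudes of pairs of modes of given total degree *)

Section Amplitudes.
Context {R : realType}.
Local Notation C := R[i].
Implicit Types (w : nat -> R) (x : nat -> C) (S : nat).

(** The deviation is at most K S^j (2 i - S)^2 by the estimate on power sums, and
    the fourth central moment of the binomial law is of order S^2. *)
Lemma satur_variance_high j : exists2 K : R, 0 <= K & forall N S, 0 < N ->
  \sum_(i < S.+1) binw S i *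
    (satur N i%:R ^+ j.+2 + satur N (S - i)%N%:R ^+ j.+2
     - 2 * satur N (S%:R / 2) ^+ j.+2) ^+ 2 <= (K * S%:R ^+ j.+1) ^+ 2.
Proof.
have [K K0 HK] := @satur_power_sum R j.+2.
exists (2 * K) => [|N S N0]; first by rewrite mulr_ge0.
have [->|S0] := posnP S.
  rewrite big_ord1/= !mul0r /satur !mulr0 !mul0r !expr0n/= addr0 mulr0 subrr.
  by rewrite expr0n/= !mulr0 expr0n.
have S0' : 0 < S%:R :> R by rewrite ltr0n.
apply: (@le_trans _ _ (\sum_(i < S.+1) (K * S%:R ^+ j) ^+ 2 *
    (binw S i * (i%:R *+ 2 - S%:R) ^+ 4))).
  apply: ler_sum => i _; rewrite [leRHS]mulrCA ler_wpM2l ?binw_ge0//.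
  have iS : (i <= S)%N by rewrite -ltnS.
  have e1 : i%:R + (S - i)%N%:R = S%:R :> R by rewrite -natrD subnKC.
  have e2 : i%:R - (S - i)%N%:R = i%:R *+ 2 - S%:R :> R by rewrite -e1; ring.
  have /= := HK N i%:R (S - i)%N%:R N0 (ler0n _ _) (ler0n _ _).
  rewrite e1 e2 => h.
  rewrite -[(_ - S%:R) ^+ 4]/((_ - S%:R) ^+ (2 * 2)) exprM -exprMn.
  rewrite -[leLHS]real_normK ?num_real// lerXn2r ?nnegrE//.
    by rewrite mulr_ge0 ?sqr_ge0// mulr_ge0 ?exprn_ge0.
  rewrite -(ler_pM2r (exprn_gt0 2 S0')); apply: le_trans h _.
  by apply: eq_ler; rewrite !exprS; ring.
rewrite -mulr_sumr.
apply: le_trans (ler_wpM2l (sqr_ge0 _) (sum_binw_quartic S)) _.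
set X := K ^+ 2 * ((S%:R ^+ j) ^+ 2 * S%:R ^+ 2).
rewrite [leLHS](_ : _ = 3 * X); last by rewrite /X; ring.
rewrite [leRHS](_ : _ = 4 * X); last by rewrite /X [_ ^+ j.+1]exprSr; ring.
by rewrite ler_wpM2r ?ler_nat// /X !mulr_ge0 ?sqr_ge0.
Qed.

(** For the first power the deviation would vanish without truncation; with it,
    a factor S / (N + S) remains, which is small when S is small against N. *)
Lemma satur_variance_one N S : 0 < N ->
  \sum_(i < S.+1) binw S i *
    (satur N i%:R ^+ 1 + satur N (S - i)%N%:R ^+ 1
     - 2 * satur N (S%:R / 2) ^+ 1) ^+ 2 <= (S%:R / (N + S%:R)) ^+ 2 :> R.
Proof.
move=> N0; have NS : 0 < N + S%:R by rewrite ltr_wpDr.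
apply: (@le_trans _ _ (\sum_(i < S.+1) (N + S%:R) ^- 2 / 4 *
    (binw S i * (i%:R *+ 2 - S%:R) ^+ 4))).
  apply: ler_sum => i _; rewrite [leRHS]mulrCA ler_wpM2l ?binw_ge0//.
  have iS : (i <= S)%N by rewrite -ltnS.
  have e1 : i%:R + (S - i)%N%:R = S%:R :> R by rewrite -natrD subnKC.
  have e2 : i%:R - (S - i)%N%:R = i%:R *+ 2 - S%:R :> R by rewrite -e1; ring.
  have := satur_sum N0 (ler0n R i) (ler0n R (S - i)).
  rewrite e1 e2 -ler_pdivlMr// => h.
  rewrite !expr1 -[leLHS]real_normK ?num_real//.
  apply: (@le_trans _ _ (((i%:R *+ 2 - S%:R) ^+ 2 / 2 / (N + S%:R)) ^+ 2)).
    rewrite lerXn2r ?nnegrE//.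
    by rewrite !divr_ge0 ?sqr_ge0// ltW.
  apply: eq_ler; field.
  exact: lt0r_neq0.
rewrite -mulr_sumr.
apply: le_trans (ler_wpM2l _ (sum_binw_quartic S)) _.
  by rewrite divr_ge0// invr_ge0 exprn_ge0// ltW.
rewrite exprMn exprVn.
have : 0 <= S%:R ^+ 2 / (N + S%:R) ^+ 2.
  by rewrite divr_ge0 ?sqr_ge0.
lra.
Qed.

Definition amp w x S : C :=
  \sum_(i < S.+1) (Num.sqrt (binw S i))%:C * ((w i)%:C * (x i * x (S - i)%N)).

Definition pairmass x S : R := \sum_(i < S.+1) abs2 (x i) * abs2 (x (S - i)%N).

Lemma pairmass_ge0 x S : 0 <= pairmass x S.
Proof. by apply: sumr_ge0 => i _; rewrite mulr_ge0 ?abs2_ge0. Qed.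

Lemma sum_pairmass x L : \sum_(S < L) pairmass x S <= (\sum_(i < L) abs2 (x i)) ^+ 2.
Proof.
rewrite expr2.
exact: (@sum_triangle_le R (abs2 \o x) (abs2 \o x) L
  (fun i => abs2_ge0 _) (fun i => abs2_ge0 _)).
Qed.

Lemma abs2_amp_le w x S :
  abs2 (amp w x S) <=
  \sum_(i < S.+1) (w i) ^+ 2 * abs2 (x i) * abs2 (x (S - i)%N).
Proof.
apply: le_trans (abs2_sum_le _ (fun i => Num.sqrt (binw S i))
   (fun i => (w i)%:C * (x i * x (S - i)%N))) _.
rewrite (eq_bigr (fun i : 'I_S.+1 => binw S i)); last first.
  by move=> i _; rewrite sqr_sqrtr// binw_ge0.
rewrite sum_binw mul1r; apply: ler_sum => i _.
by rewrite !abs2M abs2_real mulrA.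
Qed.

Lemma abs2_amp1_le x S : abs2 (amp (fun=> 1) x S) <= pairmass x S.
Proof.
apply: le_trans (abs2_amp_le _ _ _) _.
by apply: ler_sum => i _; rewrite expr1n mul1r.
Qed.

Lemma binw_sym S i : (i <= S)%N -> binw S (S - i) = binw S i :> R.
Proof. by move=> iS; rewrite /binw bin_sub. Qed.

Lemma amp_symmetrize w x S : amp w x S =
  amp (fun i => (w i + w (S - i)%N) / 2) x S.
Proof.
have half (z : C) : z = (2^-1)%:C * (z + z).
  by case: z => a b; apply: complex_eq => /=; field.
rewrite [LHS]half {2}/amp (reindex_inj rev_ord_inj)/= -big_split/= mulr_sumr.
apply: eq_bigr => i _; have iS : (i <= S)%N by rewrite -ltnS.
rewrite subSS subKn// binw_sym//.
by rewrite !(rmorphM, rmorphD)/=; ring.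
Qed.

(** The weights w and W/2 differ by (w_i + w_(S-i) - W) / 2 after symmetrisation;
    Cauchy-Schwarz separates this variance from the masses. *)
Lemma amp_center w x S W :
  abs2 (amp w x S - (W / 2)%:C * amp (fun=> 1) x S) <=
  (\sum_(i < S.+1) binw S i * (w i + w (S - i)%N - W) ^+ 2) / 4 * pairmass x S.
Proof.
have -> : amp w x S - (W / 2)%:C * amp (fun=> 1) x S =
   \sum_(i < S.+1) (Num.sqrt (binw S i) * ((w i + w (S - i)%N - W) / 2))%:C *
     (x i * x (S - i)%N).
  rewrite amp_symmetrize mulr_sumr -sumrB; apply: eq_bigr => i _.
  rewrite !(rmorphM, rmorphD, rmorphB)/=; ring.
apply: le_trans (abs2_sum_le _ (fun i => Num.sqrt (binw S i) *
   ((w i + w (S - i)%N - W) / 2)) (fun i => x i * x (S - i)%N)) _.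
apply: eq_ler; congr (_ * _).
  rewrite mulr_suml; apply: eq_bigr => i _.
  by rewrite exprMn sqr_sqrtr ?binw_ge0//; field.
by rewrite /pairmass; apply: eq_bigr => i _; rewrite abs2M.
Qed.

Lemma Im_conj_le (z y : C) (a b : R) : 0 <= a -> 0 <= b ->
  abs2 z <= a ^+ 2 -> abs2 y <= b ^+ 2 -> `|complex.Im (z * y^*)| <= a * b.
Proof.
move=> a0 b0 za yb; rewrite -ler_sqr ?nnegrE ?mulr_ge0//.
rewrite real_normK ?num_real//; apply: (@le_trans _ _ (abs2 (z * y^*))).
  by rewrite /abs2 lerDr sqr_ge0.
by rewrite abs2M abs2J exprMn ler_pM ?abs2_ge0.
Qed.

(** Replacing the weight by its centre value costs nothing in the imaginary
    part, since the centred term is a real multiple of an abs2; what is left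
    is the binomial variance of the weight. *)
Lemma Im_amp_le w x S W V : 0 <= V ->
  \sum_(i < S.+1) binw S i * (w i + w (S - i)%N - W) ^+ 2 <= V ^+ 2 ->
  `|complex.Im (amp (fun=> 1) x S * (amp w x S)^*)| <= V / 2 * pairmass x S.
Proof.
move=> V0 hV.
set A := amp (fun=> 1) x S; set D := amp w x S - (W / 2)%:C * A.
have -> : complex.Im (A * (amp w x S)^*) = complex.Im (A * D^*).
  have -> : amp w x S = D + (W / 2)%:C * A by rewrite /D subrK.
  rewrite rmorphD mulrDr raddfD/= -[RHS]addr0; congr (_ + _).
  have real_multiple (z : C) (r : R) : complex.Im (z * (r%:C * z)^*) = 0.
    by case: z => a b /=; ring.
  exact: real_multiple.
have p0 := pairmass_ge0 x S.
have -> : V / 2 * pairmass x S =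
    Num.sqrt (pairmass x S) * (V / 2 * Num.sqrt (pairmass x S)).
  by rewrite mulrCA -expr2 sqr_sqrtr.
apply: Im_conj_le; rewrite ?mulr_ge0 ?sqrtr_ge0 ?divr_ge0//.
  by rewrite sqr_sqrtr//; exact: abs2_amp1_le.
rewrite exprMn sqr_sqrtr//; apply: le_trans (amp_center _ _ _ _) _.
by rewrite ler_wpM2r// exprMn exprVn; lra.
Qed.

End Amplitudes.

(** * Two facts of real analysis *)

Section RealAnalysis.
Context {R : realType}.

(** Connectedness: the set of times up to which the slope bound B + e holds is
    a closed and open part of [0, T]. *)
Lemma lipschitz_of_local (f : R -> R) (B T : R) : 0 <= B -> 0 <= T ->
  (forall t, 0 <= t <= T -> forall e, 0 < e -> exists2 d, 0 < d &
    forall h, `|h| < d -> `|f (t + h) - f t| <= (B + e) * `|h|) ->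
  `|f T - f 0| <= B * T.
Proof.
move=> B0 T0 loc; apply/ler_addgt0Pl => e' e'0.
pose e := e' / (T + 1); have e0 : 0 < e by rewrite divr_gt0// ltr_wpDl.
suff : `|f T - f 0| <= (B + e) * T.
  move=> /le_trans; apply; rewrite mulrDl addrC lerD2r.
  by rewrite /e mulrAC ler_pdivrMr ?ltr_wpDl// ler_wpM2l ?ltW// ltrDl.
pose A := [set s | 0 <= s <= T /\ `|f s - f 0| <= (B + e) * s].
pose G := [set s | 0 <= s <= T /\ forall r, 0 <= r <= s -> A r].
have G0 : G 0.
  split; first by rewrite lexx.
  move=> r /le_anti <-; split; first by rewrite lexx.
  by rewrite subrr normr0 mulr0.
have ubG : ubound G T by move=> s [/andP[]].
have hsG : has_sup G by split; [exists 0|exists T].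
set x := sup G.
have xT : x <= T by apply: ge_sup => //; exists 0.
have x0 : 0 <= x by apply: ub_le_sup => //; exists T.
have x0T : 0 <= x <= T by rewrite x0.
have [d d0 hd] := loc x x0T e e0.
have [s Gs xs] := sup_adherent d0 hsG.
have sx : s <= x by apply: ub_le_sup => //; exists T.
have [/andP[s0 sT] hs] := Gs.
have Ax : `|f x - f 0| <= (B + e) * x.
  have [_ hs0] : A s by apply: hs; rewrite s0 lexx.
  have hsx : `|f s - f x| <= (B + e) * (x - s).
    have := hd (s - x); rewrite subrKC distrC ger0_norm ?subr_ge0//; apply.
    by rewrite ltrBlDl -ltrBlDr.
  have := lerD hsx hs0; rewrite -mulrDr subrK => h.
  apply: le_trans h; rewrite [`|f s - f x|]distrC.
  by apply: le_trans (ler_normD _ _); rewrite addrA subrK.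
have after r : x <= r -> r < x + d -> `|f r - f 0| <= (B + e) * r.
  move=> xr rd; have hrx : `|f r - f x| <= (B + e) * (r - x).
    have := hd (r - x); rewrite subrKC ger0_norm ?subr_ge0//; apply.
    by rewrite ltrBlDl.
  have := lerD hrx Ax; rewrite -mulrDr subrK => h.
  apply: le_trans h; apply: le_trans (ler_normD _ _).
  by rewrite addrA subrK.
have [xeT|xneT] := eqVneq x T; first by rewrite -xeT.
have xltT : x < T by rewrite lt_neqAle xneT.
pose y := Num.min T (x + d / 2).
have xy : x < y by rewrite lt_min xltT ltrDl divr_gt0.
have yd : y < x + d.
  by rewrite gt_min; apply/orP; right; rewrite ltrD2l ltr_pdivrMr// ltr_pMr// ltr1n.
have yT : y <= T by rewrite ge_min lexx.
have Gy : G y.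
  split; first by rewrite yT (le_trans x0)// ltW.
  move=> r /andP[r0 ry]; split; first by rewrite r0 (le_trans ry).
  have [rs|sr] := leP r s.
    by have [] : A r by apply: hs; rewrite r0.
  have [rx|xr] := leP x r; first by apply: after => //; exact: le_lt_trans yd.
  have xr0 : 0 < x - r by rewrite subr_gt0.
  have [s' Gs' rs'] := sup_adherent xr0 hsG.
  have [_ hs'] := Gs'; have [] // : A r.
  by apply: hs'; rewrite r0 ltW//; move: rs'; rewrite -/x subKr.
have : y <= x by apply: ub_le_sup => //; exists T.
by rewrite leNgt xy.
Qed.

Lemma partial_sum_tail (a : nat -> R) (M : R) : (forall n, 0 <= a n) ->
  (forall N, \sum_(n < N) a n <= M) ->
  forall e, 0 < e -> exists J0, forall J L, (J0 <= J)%N ->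
    \sum_(n < L) (if (n < J)%N then 0 else a n) <= e.
Proof.
move=> a0 aM e e0; pose G := range (fun N => \sum_(n < N) a n).
have hsG : has_sup G.
  by split; [exists (\sum_(n < 0) a n); exists 0%N|exists M => _ [N _ <-]].
have [_ [J0 _ <-] hJ] := sup_adherent e0 hsG; exists J0 => J L J0J.
have mono (m n : nat) : (m <= n)%N -> \sum_(i < m) a i <= \sum_(i < n) a i.
  move=> mn; rewrite -!(big_mkord xpredT a) [leRHS](big_cat_nat _ (n := m))//=.
  by rewrite lerDl sumr_ge0.
have [LJ|JL] := leqP L J.
  rewrite big1 ?ltW// => i _; rewrite ifT//; exact: leq_trans LJ.
have : \sum_(n < L) a n <= sup G.
  by have := sup_upper_bound hsG; apply; exists L.
have -> : \sum_(n < L) a n =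
  \sum_(n < J) a n + \sum_(n < L) (if (n < J)%N then 0 else a n).
  rewrite -!(big_mkord xpredT a) -(big_mkord xpredT (fun n => if (n < J)%N then 0 else a n)).
  rewrite [LHS](big_cat_nat _ (n := J)) ?(ltnW JL)//=; congr (_ + _).
  rewrite [RHS](big_cat_nat _ (n := J)) ?(ltnW JL)//= [X in _ = X + _]big_nat.
  rewrite [X in _ = X + _]big1 ?add0r.
    by rewrite [LHS]big_nat [RHS]big_nat; apply: eq_bigr => i /andP[Ji _]; rewrite ltnNge Ji.
  by move=> i /andP[_ ->].
have := mono _ _ J0J; lra.
Qed.

End RealAnalysis.

(** * Growth of the moments of the coefficients *)

Section Moments.
Context {R : realType}.
Local Notation C := R[i].

Definition amp1 (x : nat -> C) S := amp (fun=> 1) x S.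

(** Up to kappa, the contribution to Re (conj c_n c_n') of the pairs of total degree S. *)
Definition rate_term (x : nat -> C) (n S : nat) : R :=
  if (n <= S)%N then
    complex.Im (amp1 x S * ((Num.sqrt (binw S n))%:C * (x n * x (S - n)%N))^*)
  else 0.

Lemma cvg_ord_sum (F : nat -> nat -> R) (l : nat -> R) J :
  (forall n, F n @ \oo --> l n) ->
  (fun L => \sum_(n < J) F n L) @ \oo --> \sum_(n < J) l n.
Proof.
move=> Fl; elim: J => [|J IH].
  by rewrite big_ord0; under eq_fun do rewrite big_ord0; exact: cvg_cst.
rewrite big_ord_recr/=; under eq_fun do rewrite big_ord_recr/=.
by apply: cvgD; [exact: IH|exact: Fl].
Qed.

Lemma Im_conj_young (z y : C) (e : R) : 0 < e ->
  `|complex.Im (z * y^*)| <= e / 2 * abs2 z + e^-1 / 2 * abs2 y.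
Proof.
move=> e0; pose a := Num.sqrt (abs2 z); pose b := Num.sqrt (abs2 y).
apply: (@le_trans _ _ (a * b)).
  by apply: Im_conj_le; rewrite ?sqrtr_ge0// sqr_sqrtr// abs2_ge0.
rewrite -[abs2 z]sqr_sqrtr ?abs2_ge0// -[abs2 y]sqr_sqrtr ?abs2_ge0// -/a -/b.
rewrite -subr_ge0.
have -> : e / 2 * a ^+ 2 + e^-1 / 2 * b ^+ 2 - a * b =
  e / 2 * (a - b / e) ^+ 2 by field; exact: lt0r_neq0.
by rewrite mulr_ge0 ?sqr_ge0// ltW// divr_gt0.
Qed.

Lemma conjZ (r : R) (z : C) : (r%:C * z)^* = r%:C * z^*.
Proof. by case: z => a b; apply: complex_eq => /=; ring. Qed.

(** Exchanging the two sums groups the interactions by the total degree S; only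
    the terms with n < J survive, hence the truncated weight. *)
Lemma sum_rate_term (x : nat -> C) (w : nat -> R) J L :
  \sum_(n < J) w n * (\sum_(S < L) rate_term x n S) =
  \sum_(S < L) complex.Im (amp1 x S *
     (amp (fun n => if (n < J)%N then w n else 0) x S)^*).
Proof.
under eq_bigr do rewrite mulr_sumr.
rewrite exchange_big/=; apply: eq_bigr => S _.
rewrite rmorph_sum/= mulr_sumr raddf_sum/=.
pose F n := w n * rate_term x n S.
pose G n := complex.Im (amp1 x S * ((Num.sqrt (binw S n))%:C *
  ((if (n < J)%N then w n else 0)%:C * (x n * x (S - n)%N)))^*).
rewrite -[LHS]/(\sum_(n < J) F n) -[RHS]/(\sum_(n < S.+1) G n).
pose H n := if (n < J)%N then (if (n < S.+1)%N then F n else 0) else 0.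
transitivity (\sum_(n < maxn J S.+1) H n).
  rewrite -!(big_mkord xpredT) [RHS](big_cat_nat _ (n := J)) ?leq_maxl//=.
  rewrite [X in _ = _ + X]big_nat [X in _ = _ + X]big1 ?addr0; last first.
    by move=> n /andP[Jn _]; rewrite /H ltnNge Jn.
  rewrite big_nat [RHS]big_nat; apply: eq_bigr => n /andP[_ nJ].
  rewrite /H nJ; case: ifPn => //; rewrite -leqNgt => Sn.
  by rewrite /F /rate_term leqNgt Sn/= mulr0.
rewrite -!(big_mkord xpredT) [LHS](big_cat_nat _ (n := S.+1)) ?leq_maxr//=.
rewrite [X in _ + X = _]big_nat [X in _ + X = _]big1 ?addr0; last first.
  by move=> n /andP[Sn _]; rewrite /H [in X in if _ then X else _]ltnNge Sn; case: ifP.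
rewrite big_nat [RHS]big_nat; apply: eq_bigr => n /andP[_ nS].
have nS' : (n <= S)%N by [].
rewrite /H /G nS /F /rate_term nS'; case: ifP => _.
  by rewrite [X in _ = complex.Im (_ * X^*)]mulrCA [in RHS]conjZ [in RHS]mulrCA [RHS]ImZ.
by rewrite mul0r mulr0 rmorph0 mulr0.
Qed.

(** The weights below J reproduce the full weight up to the tail of x, which
    enters through Young's inequality. *)
Lemma sum_rate_le (x : nat -> C) (w : nat -> R) (Winf M Q : R)
    (Wc V : nat -> R) (e : R) :
  (forall N, \sum_(n < N) abs2 (x n) <= M) ->
  (forall n, 0 <= w n <= Winf) ->
  (forall S, 0 <= V S) ->
  (forall S, \sum_(i < S.+1) binw S i * (w i + w (S - i)%N - Wc S) ^+ 2
     <= V S ^+ 2) ->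
  (forall L, \sum_(S < L) V S * pairmass x S <= Q) ->
  0 < e -> exists J0, forall J L, (J0 <= J)%N ->
  `|\sum_(n < J) w n * (\sum_(S < L) rate_term x n S)| <= Q / 2 + e.
Proof.
move=> xM w0 V0 hV hQ e0.
have M0 : 0 <= M by have := xM 0%N; rewrite big_ord0.
have Winf0 : 0 <= Winf by have /andP[] := w0 0%N; exact: le_trans.
(* th weighs the amplitude in Young's inequality, and tau is the tail of x that
   its inverse can then afford. *)
pose th := e / (M ^+ 2 + 1).
have th0 : 0 < th by rewrite divr_gt0// ltr_wpDl// sqr_ge0.
pose tau := th * e / (Winf ^+ 2 * M + 1).
have tau0 : 0 < tau.
  apply: divr_gt0; first exact: mulr_gt0.
  by rewrite ltr_wpDl// mulr_ge0// sqr_ge0.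
have [J0 hJ0] := partial_sum_tail (fun n => abs2_ge0 (x n)) xM tau0.
exists J0 => J L J0J; rewrite sum_rate_term.
pose r n := if (n < J)%N then 0 else w n.
have ampr S : amp (fun n => if (n < J)%N then w n else 0) x S =
    amp w x S - amp r x S.
  rewrite -sumrB; apply: eq_bigr => i _; rewrite -mulrBr -mulrBl; congr (_ * (_ * _)).
  by rewrite /r -rmorphB/=; congr (_%:C); case: ifP => _; lra.
apply: le_trans (ler_norm_sum _ _ _) _.
apply: (@le_trans _ _ (\sum_(S < L) (V S * pairmass x S / 2 +
   (th / 2 * pairmass x S + th^-1 / 2 * abs2 (amp r x S))))).
  apply: ler_sum => S _; rewrite ampr rmorphB mulrBr raddfB/=.
  apply: le_trans (ler_normB _ _) _; apply: lerD.
    by rewrite mulrAC; apply: (Im_amp_le x (V0 S) (hV S)).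
  apply: le_trans (Im_conj_young _ _ th0) _; rewrite lerD2r ler_wpM2l//.
    by rewrite divr_ge0// ltW.
  exact: abs2_amp1_le.
rewrite big_split/= -mulr_suml; apply: lerD; first by rewrite ler_wpM2r ?invr_ge0 ?hQ.
rewrite big_split/= -!mulr_sumr.
have p1 : \sum_(S < L) pairmass x S <= M ^+ 2.
  apply: le_trans (sum_pairmass _ _) _.
  by rewrite lerXn2r ?nnegrE ?sumr_ge0// => i _; exact: abs2_ge0.
have p2 : \sum_(S < L) abs2 (amp r x S) <= Winf ^+ 2 * (tau * M).
  pose p n := if (n < J)%N then 0 else abs2 (x n).
  apply: (@le_trans _ _ (\sum_(S < L) \sum_(i < S.+1)
      Winf ^+ 2 * (p i * abs2 (x (S - i)%N)))).
    apply: ler_sum => S _; apply: le_trans (abs2_amp_le _ _ _) _.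
    apply: ler_sum => i _; rewrite mulrA ler_wpM2r ?abs2_ge0// /r /p.
    case: ifP => _; first by rewrite expr0n/= mul0r mulr0.
    have /andP[wi0 wiW] := w0 i.
    by rewrite ler_wpM2r ?abs2_ge0// lerXn2r ?nnegrE.
  under eq_bigr do rewrite -mulr_sumr.
  rewrite -mulr_sumr ler_wpM2l ?sqr_ge0//.
  have pge i : 0 <= p i by rewrite /p; case: ifP => _; rewrite ?abs2_ge0.
  apply: le_trans (@sum_triangle_le R p (abs2 \o x) L pge (fun i => abs2_ge0 _)) _.
  by apply: ler_pM; rewrite ?sumr_ge0//; [move=> i _; exact: abs2_ge0|exact: hJ0].
have q1 : th / 2 * \sum_(S < L) pairmass x S <= e / 2.
  apply: (@le_trans _ _ (th / 2 * (M ^+ 2 + 1))).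
    apply: ler_wpM2l; first by rewrite divr_ge0 ?ltW.
    by apply: le_trans p1 _; rewrite lerDl.
  by rewrite mulrAC /th divfK// lt0r_neq0// ltr_wpDl// sqr_ge0.
have q2 : th^-1 / 2 * \sum_(S < L) abs2 (amp r x S) <= e / 2.
  apply: (@le_trans _ _ (th^-1 / 2 * (tau * (Winf ^+ 2 * M + 1)))).
    apply: ler_wpM2l; first by rewrite divr_ge0 ?invr_ge0 ?ltW.
    by apply: le_trans p2 _; rewrite mulrDr mulr1 mulrCA lerDl ltW.
  rewrite /tau divfK; last by rewrite lt0r_neq0// ltr_wpDl// mulr_ge0// sqr_ge0.
  by apply: eq_ler; field; exact: lt0r_neq0.
by lra.
Qed.

Variables (c g : R -> nat -> C) (kappa : R).
Hypothesis kappa0 : 0 < kappa.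
Hypothesis massc : forall t, exists M : R, forall N, \sum_(n < N) abs2 (c t n) <= M.
Hypothesis massg : forall t, exists M : R, forall N, \sum_(n < N) abs2 (g t n) <= M.
Hypothesis dc : forall t (e : R), 0 < e -> exists2 d : R, 0 < d &
  forall h : R, 0 < `|h| < d -> forall N,
  \sum_(n < N) abs2 ((h^-1)%:C * (c (t + h) n - c t n) - g t n) <= e.
Hypothesis eqg : forall t n,
  (fun L => kappa * \sum_(S < L) rate_term (c t) n S) @ \oo -->
  complex.Re ((c t n)^* * g t n).

Definition energy (w : nat -> R) t J := \sum_(n < J) w n * abs2 (c t n).
Definition energyoo w t : R := limn (energy w t).

Lemma energy_nd w t : (forall n, 0 <= w n) -> nondecreasing_seq (energy w t).
Proof.
move=> w0; apply/nondecreasing_seqP => n.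
by rewrite /energy big_ord_recr/= lerDl mulr_ge0 ?abs2_ge0.
Qed.

Lemma energy_cvg w t : (forall n, 0 <= w n) ->
  (exists M, forall J, energy w t J <= M) -> energy w t @ \oo --> energyoo w t.
Proof.
move=> w0 [M hM]; apply: nondecreasing_is_cvgn; first exact: energy_nd.
by exists M => _ [n _ <-].
Qed.

Lemma energy_le_oo w t J : (forall n, 0 <= w n) ->
  (exists M, forall J, energy w t J <= M) -> energy w t J <= energyoo w t.
Proof.
move=> w0 hM; apply: nondecreasing_cvgn_le; first exact: energy_nd.
by apply/cvg_ex; exists (energyoo w t); exact: energy_cvg.
Qed.

Lemma energyoo_le w t M : (forall n, 0 <= w n) ->
  (forall J, energy w t J <= M) -> energyoo w t <= M.
Proof.
move=> w0 hM; apply: limr_le; last by near=> n.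
by apply/cvg_ex; exists (energyoo w t); apply: energy_cvg => //; exists M.
Unshelve. all: by end_near. Qed.

Lemma energy_bounded w (Winf : R) t : (forall n, 0 <= w n <= Winf) ->
  exists M, forall J, energy w t J <= M.
Proof.
move=> w0; have [M hM] := massc t; exists (Winf * M) => J.
have Winf0 : 0 <= Winf by have /andP[] := w0 0%N; exact: le_trans.
apply: le_trans (ler_wpM2l Winf0 (hM J)); rewrite mulr_sumr.
by apply: ler_sum => n _; rewrite ler_wpM2r ?abs2_ge0//; have /andP[] := w0 n.
Qed.

(** The estimate on finite sums over S passes to the limit, since each coefficient
    has its own convergent series. *)
Lemma rate_le (w : nat -> R) (Winf Q : R) (Wc V : nat -> R) t e :
  (forall n, 0 <= w n <= Winf) -> (forall S, 0 <= V S) ->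
  (forall S, \sum_(i < S.+1) binw S i * (w i + w (S - i)%N - Wc S) ^+ 2
     <= V S ^+ 2) ->
  (forall L, \sum_(S < L) V S * pairmass (c t) S <= Q) -> 0 < e ->
  exists J0, forall J, (J0 <= J)%N ->
  `|\sum_(n < J) w n * complex.Re ((c t n)^* * g t n)| <= kappa * (Q / 2) + e.
Proof.
move=> w0 V0 hV hQ e0; have [M hM] := massc t.
have ek : 0 < e / kappa by rewrite divr_gt0.
have [J0 hJ0] := @sum_rate_le (c t) w Winf M Q Wc V (e / kappa) hM w0 V0 hV hQ ek.
exists J0 => J J0J.
have cv : (fun L => kappa * \sum_(n < J) w n * (\sum_(S < L) rate_term (c t) n S))
    @ \oo --> \sum_(n < J) w n * complex.Re ((c t n)^* * g t n).
  under eq_fun do rewrite mulr_sumr.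
  pose F n L := kappa * (w n * (\sum_(S < L) rate_term (c t) n S)).
  apply: (@cvg_ord_sum F (fun n => w n * complex.Re ((c t n)^* * g t n)) J) => n.
  rewrite /F; under eq_fun do rewrite mulrCA.
  by apply: cvgMl_tmp; exact: eqg.
have cvn := cvg_norm cv; have {}cvn := cvn ltac:(typeclasses eauto).
rewrite -(cvg_lim _ cvn)//; apply: limr_le; first by apply/cvg_ex; eexists; exact: cvn.
near=> L; rewrite normrM gtr0_norm//.
apply: le_trans (ler_wpM2l (ltW kappa0) (hJ0 J L J0J)) _.
by rewrite mulrDr [kappa * (e / _)]mulrC divfK// lt0r_neq0.
Unshelve. all: by end_near. Qed.

Lemma abs2_step (a b : C) (r : R) :
  abs2 (a + r%:C * b) = abs2 a + 2 * r * complex.Re (a^* * b) + r ^+ 2 * abs2 b.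
Proof. by case: a b => a1 a2 [b1 b2]; rewrite /abs2 /=; ring. Qed.

Lemma Re_conj_young (z y : C) (e : R) : 0 < e ->
  `|2 * complex.Re (z^* * y)| <= e * abs2 z + e^-1 * abs2 y.
Proof.
move=> e0; case: z y => a b [p q]; rewrite /abs2 /=.
have -> : a * p - - b * q = a * p + b * q by ring.
have key (x y : R) : `|2 * (x * y)| <= e * x ^+ 2 + e^-1 * y ^+ 2.
  have e1 : 0 <= e^-1 by rewrite invr_ge0 ltW.
  rewrite ler_norml; apply/andP; split; rewrite -subr_ge0.
    have -> : 2 * (x * y) - - (e * x ^+ 2 + e^-1 * y ^+ 2) =
      e^-1 * (e * x + y) ^+ 2 by field; exact: lt0r_neq0.
    by rewrite mulr_ge0 ?sqr_ge0.
  have -> : e * x ^+ 2 + e^-1 * y ^+ 2 - 2 * (x * y) =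
    e^-1 * (e * x - y) ^+ 2 by field; exact: lt0r_neq0.
  by rewrite mulr_ge0 ?sqr_ge0.
rewrite mulrDr; apply: le_trans (ler_normD _ _) _.
by have := key a p; have := key b q; lra.
Qed.

Lemma abs2D_le (a b : C) : abs2 (a + b) <= 2 * (abs2 a + abs2 b).
Proof.
case: a b => a1 a2 [b1 b2]; rewrite /abs2 /= -subr_ge0.
have -> : 2 * (a1 ^+ 2 + a2 ^+ 2 + (b1 ^+ 2 + b2 ^+ 2)) -
  ((a1 + b1) ^+ 2 + (a2 + b2) ^+ 2) = (a1 - b1) ^+ 2 + (a2 - b2) ^+ 2 by ring.
by rewrite addr_ge0 ?sqr_ge0.
Qed.

(** First order expansion of the weighted mass, uniform in the number J of modes:
    the remainder of the difference quotient is small in l2, so Young's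
    inequality absorbs its product with c. *)
Lemma energy_expansion (w : nat -> R) (Winf : R) t (e : R) :
  (forall n, 0 <= w n <= Winf) -> 0 < e -> exists2 d : R, 0 < d &
  forall h, `|h| < d -> forall J,
  `|energy w (t + h) J - energy w t J
    - 2 * h * \sum_(n < J) w n * complex.Re ((c t n)^* * g t n)| <= e * `|h|.
Proof.
move=> w0 e0; have [M hM] := massc t; have [G hG] := massg t.
have M0 : 0 <= M by have := hM 0%N; rewrite big_ord0.
have G0 : 0 <= G by have := hG 0%N; rewrite big_ord0.
have W0 : 0 <= Winf by have /andP[] := w0 0%N; exact: le_trans.
pose W := Winf + 1; have Wgt0 : 0 < W by rewrite ltr_wpDl.
(* Each of the three error terms is to be at most e / (4 W). *)
pose th := e / (4 * W * (M + 1)).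
have th0 : 0 < th by rewrite divr_gt0// !mulr_gt0// ltr_wpDl.
pose e1 := Num.min 1 (th * (e / (4 * W))).
have e10 : 0 < e1 by rewrite lt_min ltr01 mulr_gt0// divr_gt0// mulr_gt0.
have [d1 d10 hd1] := dc t e10.
pose d := Num.min d1 (e / (8 * W * (G + 1))).
have d0 : 0 < d by rewrite lt_min d10 divr_gt0// !mulr_gt0// ltr_wpDl.
exists d => // h hd J.
have [->|h0] := eqVneq h 0.
  by rewrite addr0 subrr mulr0 mul0r subrr normr0 mulr0.
have hgt0 : 0 < `|h| by rewrite normr_gt0.
have /hd1/(_ J) hx : 0 < `|h| < d1.
  by rewrite hgt0 (lt_le_trans hd)// ge_min lexx.
pose x n := (h^-1)%:C * (c (t + h) n - c t n) - g t n.
have cE n : c (t + h) n = c t n + h%:C * (g t n + x n).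
  rewrite /x subrKC mulrA -rmorphM/= divff// rmorph1 mul1r; ring.
have step (n : 'I_J) :
  `|w n * abs2 (c (t + h) n) - w n * abs2 (c t n)
    - 2 * h * (w n * complex.Re ((c t n)^* * g t n))| <=
  W * (`|h| * (th * abs2 (c t n) + th^-1 * abs2 (x n)) +
    `|h| ^+ 2 * (2 * (abs2 (g t n) + abs2 (x n)))).
  have -> : w n * abs2 (c (t + h) n) - w n * abs2 (c t n)
      - 2 * h * (w n * complex.Re ((c t n)^* * g t n)) =
    w n * (h * (2 * complex.Re ((c t n)^* * x n)) + h ^+ 2 * abs2 (g t n + x n)).
    by rewrite cE abs2_step [(c t n)^* * (_ + _)]mulrDr raddfD/=; ring.
  have /andP[wn0 wnW] := w0 n.
  rewrite normrM (ger0_norm wn0); apply: ler_pM => //.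
    by rewrite (le_trans wnW)// lerDl.
  apply: le_trans (ler_normD _ _) _; rewrite !normrM; apply: lerD.
    rewrite ler_wpM2l// -normrM; exact: Re_conj_young.
  rewrite -expr2 [`|abs2 _|]ger0_norm ?abs2_ge0// ler_wpM2l ?sqr_ge0//.
  exact: abs2D_le.
rewrite /energy mulr_sumr -!sumrB.
apply: le_trans (ler_norm_sum _ _ _) _.
apply: le_trans (ler_sum _ (fun i _ => step i)) _.
rewrite -mulr_sumr big_split/= -!mulr_sumr.
rewrite [\sum_(i < J) (th * _ + _)]big_split [\sum_(i < J) (abs2 (g t i) + _)]big_split/=.
rewrite -!mulr_sumr.
set Sx := \sum_(n < J) abs2 (x n).
have hx1 : Sx <= e1 by exact: hx.
have Sx0 : 0 <= Sx by apply: sumr_ge0 => n _; exact: abs2_ge0.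
have hx2 : Sx <= th * (e / (4 * W)) by rewrite (le_trans hx1)// ge_min lexx orbT.
have hx3 : Sx <= 1 by rewrite (le_trans hx1)// ge_min lexx.
have b1 : th * \sum_(n < J) abs2 (c t n) <= e / (4 * W).
  apply: (@le_trans _ _ (th * (M + 1))).
    by rewrite ler_wpM2l ?(ltW th0)// (le_trans (hM J))// lerDl.
  apply: eq_ler; rewrite /th; field.
  by rewrite !lt0r_neq0// ltr_wpDl.
have b2 : th^-1 * Sx <= e / (4 * W).
  by rewrite ler_pdivrMl.
have b3 : `|h| * (2 * (\sum_(n < J) abs2 (g t n) + Sx)) <= e / (4 * W).
  apply: (@le_trans _ _ (e / (8 * W * (G + 1)) * (2 * (G + 1)))).
    apply: ler_pM => //.
    - by rewrite mulr_ge0// addr_ge0// sumr_ge0// => n _; exact: abs2_ge0.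
    - by rewrite (le_trans (ltW hd))// ge_min lexx orbT.
    - by rewrite ler_wpM2l// lerD// hG.
  apply: eq_ler; field.
  by rewrite !lt0r_neq0// ltr_wpDl.
have -> : W * (`|h| * (th * \sum_(n < J) abs2 (c t n) + th^-1 * Sx) +
    `|h| ^+ 2 * (2 * (\sum_(n < J) abs2 (g t n) + Sx))) =
  `|h| * (W * (th * \sum_(n < J) abs2 (c t n) + th^-1 * Sx +
    `|h| * (2 * (\sum_(n < J) abs2 (g t n) + Sx)))) by rewrite expr2; ring.
rewrite [leRHS]mulrC ler_wpM2l//.
apply: (@le_trans _ _ (W * (e / (4 * W) + e / (4 * W) + e / (4 * W)))).
  by rewrite ler_wpM2l ?(ltW Wgt0)// lerD// lerD.
have -> : W * (e / (4 * W) + e / (4 * W) + e / (4 * W)) = e * (3 / 4).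
  by field; exact: lt0r_neq0.
by lra.
Qed.

(** The rate bound holds on all partial sums up to a vanishing error, so the full
    weighted mass has local slope at most kappa Q although its derivative is
    never computed. *)
Lemma energyoo_lipschitz (w : nat -> R) (Winf Q T : R) (Wc V : nat -> R) :
  (forall n, 0 <= w n <= Winf) -> (forall S, 0 <= V S) ->
  (forall S, \sum_(i < S.+1) binw S i * (w i + w (S - i)%N - Wc S) ^+ 2
     <= V S ^+ 2) ->
  (forall t, `|t| <= `|T| -> forall L, \sum_(S < L) V S * pairmass (c t) S <= Q) ->
  `|energyoo w T - energyoo w 0| <= kappa * Q * `|T|.
Proof.
move=> w0 V0 hV hQ.
have wge0 n : 0 <= w n by have /andP[] := w0 n.
have Q0 : 0 <= kappa * Q.
  by rewrite mulr_ge0 ?(ltW kappa0)//; have := hQ T (lexx _) 0%N; rewrite big_ord0.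
have loc t : `|t| <= `|T| -> forall e, 0 < e -> exists2 d, 0 < d &
    forall h, `|h| < d -> `|energyoo w (t + h) - energyoo w t|
      <= (kappa * Q + e) * `|h|.
  move=> tT e e0; have e2 : 0 < e / 2 by rewrite divr_gt0.
  have e4 : 0 < e / 4 by rewrite divr_gt0.
  have [d d0 hd] := energy_expansion t w0 e2.
  have [J0 hJ0] := rate_le w0 V0 hV (hQ t tT) e4.
  exists d => // h hh.
  have cv : (fun J => `|energy w (t + h) J - energy w t J|) @ \oo -->
      `|energyoo w (t + h) - energyoo w t|.
    by apply: cvg_norm; apply: cvgB; apply: energy_cvg => //;
      exact: energy_bounded w0.
  rewrite -(cvg_lim _ cv)//; apply: limr_le.
    by apply/cvg_ex; eexists; exact: cv.
  near=> J; have J0J : (J0 <= J)%N by near: J; exact: nbhs_infty_ge.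
  have := hd h hh J; have := hJ0 J J0J.
  set q := \sum_(n < J) _; set E := energy w (t + h) J - _ => hq hE.
  have -> : E = (E - 2 * h * q) + 2 * h * q by rewrite subrK.
  apply: le_trans (ler_normD _ _) _.
  have -> : (kappa * Q + e) * `|h| =
    e / 2 * `|h| + 2 * `|h| * (kappa * (Q / 2) + e / 4) by field.
  apply: lerD => //; rewrite !normrM (ger0_norm (ler0n _ 2)).
  by rewrite ler_wpM2l// mulr_ge0.
have [T0|T0] := leP 0 T.
  rewrite [`|T|]ger0_norm//.
  apply: (@lipschitz_of_local R (energyoo w)) => // t /andP[t0 tT] e e0.
  by apply: loc => //; rewrite !ger0_norm.
rewrite [`|T|]ltr0_norm//.
have := @lipschitz_of_local R (fun s => energyoo w (- s)) _ (- T) Q0.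
rewrite /= opprK oppr0; apply; first by rewrite oppr_ge0 ltW.
move=> t /andP[t0 tT] e e0.
have tT' : `|- t| <= `|T| by rewrite normrN ger0_norm// ltr0_norm.
have [d d0 hd] := loc (- t) tT' e e0.
exists d => // h hh; rewrite opprD.
by have := hd (- h); rewrite normrN; apply.
Unshelve. all: by end_near. Qed.

(** The constant weight has no variance. *)
Lemma mass_conserved : exists2 M : R, 0 <= M &
  forall t N, \sum_(n < N) abs2 (c t n) <= M.
Proof.
have w0 (n : nat) : 0 <= (1 : R) <= 1 by rewrite ler01 lexx.
have bd t : exists M, forall J, energy (fun=> 1) t J <= M := energy_bounded t w0.
have cst t : energyoo (fun=> 1) t = energyoo (fun=> 1) 0.
  apply/eqP; rewrite -subr_eq0 -normr_le0.
  have := @energyoo_lipschitz (fun=> 1) 1 0 t (fun=> 2) (fun=> 0) w0.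
  rewrite mulr0 mul0r; apply => // [S|t' _ L].
    by rewrite big1 ?expr0n// => i _; rewrite (_ : 1 + 1 - 2 = 0) ?expr0n/= ?mulr0//; ring.
  by rewrite big1// => S _; rewrite mul0r.
have le t N : \sum_(n < N) abs2 (c t n) <= energyoo (fun=> 1) 0.
  rewrite -(cst t); apply: le_trans (energy_le_oo N _ (bd t)) => //.
  by apply: ler_sum => n _; rewrite mul1r.
by exists (energyoo (fun=> 1) 0) => //; have := le 0 0%N; rewrite big_ord0.
Qed.

(** A subadditive weight of the degree i + j splits between the two modes of the
    pair, leaving the moment of one and the mass of the other. *)
Lemma sum_pairmass_le (x : nat -> C) (V v : nat -> R) (E M : R) L :
  (forall i, 0 <= v i) ->
  (forall S i, (i <= S)%N -> V S <= v i + v (S - i)%N) ->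
  \sum_(n < L) v n * abs2 (x n) <= E -> \sum_(n < L) abs2 (x n) <= M ->
  \sum_(S < L) V S * pairmass x S <= 2 * M * E.
Proof.
move=> v0 hV hE hM.
pose p i := v i * abs2 (x i); pose q i := abs2 (x i).
have p0 i : 0 <= p i by rewrite mulr_ge0 ?abs2_ge0.
have q0 i : 0 <= q i by exact: abs2_ge0.
have sp0 : 0 <= \sum_(i < L) p i by exact: sumr_ge0.
have sq0 : 0 <= \sum_(i < L) q i by exact: sumr_ge0.
apply: (@le_trans _ _ (\sum_(S < L) \sum_(i < S.+1) p i * q (S - i)%N +
   \sum_(S < L) \sum_(i < S.+1) q i * p (S - i)%N)).
  rewrite -big_split/=; apply: ler_sum => S _; rewrite mulr_sumr -big_split/=.
  apply: ler_sum => i _; have iS : (i <= S)%N by rewrite -ltnS.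
  have := ler_wpM2r (mulr_ge0 (q0 i) (q0 (S - i)%N)) (hV S i iS).
  by rewrite /p /q; lra.
have h1 := sum_triangle_le L p0 q0; have h2 := sum_triangle_le L q0 p0.
apply: le_trans (lerD h1 h2) _.
have : (\sum_(i < L) p i) * (\sum_(i < L) q i) <= E * M by exact: ler_pM.
by lra.
Qed.

(** Below N the truncated weight is at least half of the true one. *)
Lemma satur_recover (k J : nat) (N E : R) t : 0 < N -> J%:R <= N ->
  \sum_(n < J) satur N n%:R ^+ k * abs2 (c t n) <= E ->
  \sum_(n < J) n%:R ^+ k * abs2 (c t n) <= 2 ^+ k * E.
Proof.
move=> N0 JN hE; apply: (@le_trans _ _ (2 ^+ k *
  \sum_(n < J) satur N n%:R ^+ k * abs2 (c t n))); last by rewrite ler_wpM2l ?exprn_ge0.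
rewrite mulr_sumr; apply: ler_sum => n _; rewrite mulrA ler_wpM2r ?abs2_ge0//.
have s0 : 0 <= satur N n%:R by exact: satur_ge0.
rewrite -exprMn lerXn2r ?nnegrE//; first by rewrite pmulr_rge0.
by apply: satur_half => //; rewrite (le_trans _ JN)// ler_nat ltnW.
Qed.

Lemma satur_weight (k : nat) (N : R) n : 0 < N ->
  0 <= satur N n%:R ^+ k <= N ^+ k.
Proof.
move=> N0; rewrite exprn_ge0 ?satur_ge0//=.
by rewrite lerXn2r ?nnegrE ?satur_ge0 ?satur_leN// ltW.
Qed.

Lemma energyoo_satur0 (k : nat) (N E : R) t : 0 < N ->
  (forall J, \sum_(n < J) n%:R ^+ k * abs2 (c t n) <= E) ->
  energyoo (fun n => satur N n%:R ^+ k) t <= E.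
Proof.
move=> N0 hE; apply: energyoo_le => [n|J]; first by have /andP[] := satur_weight k n N0.
apply: le_trans (hE J); apply: ler_sum => n _; rewrite ler_wpM2r ?abs2_ge0//.
by rewrite lerXn2r ?nnegrE ?satur_ge0 ?satur_le.
Qed.

(** Two passes: the crude bound V <= 1 shows that the truncated moment stays below
    some B independent of N on [-|T|, |T|]; as V_S is the truncated weight
    divided by N, its variation is then O(B / N), negligible for N large. *)
Lemma first_moment (E0 : R) :
  (forall J, \sum_(n < J) n%:R ^+ 1 * abs2 (c 0 n) <= E0) ->
  exists C1 : R, forall t J, \sum_(n < J) n%:R ^+ 1 * abs2 (c t n) <= C1.
Proof.
move=> h0; have [M M0 hM] := mass_conserved.
exists (2 ^+ 1 * (E0 + 1)) => T J.
have E00 : 0 <= E0 by have := h0 0%N; rewrite big_ord0.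
pose B := E0 + kappa * (2 * M * M) * `|T|.
have k0 := ltW kappa0.
have B0 : 0 <= B by rewrite addr_ge0 ?mulr_ge0.
(* N exceeds J for the recovery and makes the variation of the second pass at
   most 1. *)
pose N := J%:R + kappa * (2 * M * B) * `|T| + 1.
have X0 : 0 <= kappa * (2 * M * B) * `|T| by rewrite !mulr_ge0.
have N0 : 0 < N by rewrite ltr_wpDl// addr_ge0.
pose w n := satur N n%:R ^+ 1.
have w0 n := satur_weight 1 n N0.
have wge0 n : 0 <= w n by have /andP[] := w0 n.
have bd t : exists M, forall J, energy w t J <= M := energy_bounded t w0.
pose v n : R := n%:R / (N + n%:R).
have Nn n : 0 < N + n%:R by rewrite ltr_wpDr.
have v0 n : 0 <= v n by rewrite divr_ge0// ltW.
have V0 S : 0 <= v S by [].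
have hV S i : (i <= S)%N -> v S <= v i + v (S - i)%N.
  move=> iS; have -> : v S = i%:R / (N + S%:R) + (S - i)%N%:R / (N + S%:R).
    by rewrite -mulrDl -natrD subnKC.
  by apply: lerD; rewrite ler_wpM2l// lef_pV2 ?posrE// lerD2l ler_nat// leq_subr.
have varV S := satur_variance_one S N0.
have start : energyoo w 0 <= E0 by exact: energyoo_satur0.
have step1 t : `|t| <= `|T| -> energyoo w t <= B.
  move=> tT; have := @energyoo_lipschitz w (N ^+ 1) (2 * M * M) t _ v w0 V0 varV.
  have hQ t' : `|t'| <= `|t| -> forall L, \sum_(S < L) v S * pairmass (c t') S <= 2 * M * M.
    move=> _ L; apply: (@sum_pairmass_le _ _ v) => //; apply: le_trans (hM t' L).
    apply: ler_sum => n _; rewrite -[leRHS]mul1r ler_wpM2r ?abs2_ge0//.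
    by rewrite ler_pdivrMr// mul1r lerDr ltW.
  move=> /(_ hQ) /(le_trans (ler_norm _)) h; rewrite /B.
  have : kappa * (2 * M * M) * `|t| <= kappa * (2 * M * M) * `|T|.
    by rewrite ler_wpM2l// !mulr_ge0.
  lra.
have step2 : energyoo w T <= E0 + 1.
  have := @energyoo_lipschitz w (N ^+ 1) (2 * M * (B / N)) T _ v w0 V0 varV.
  have hQ t' : `|t'| <= `|T| -> forall L,
      \sum_(S < L) v S * pairmass (c t') S <= 2 * M * (B / N).
    move=> tT L; apply: (@sum_pairmass_le _ _ v) => //.
    have := le_trans (energy_le_oo L wge0 (bd t')) (step1 t' tT).
    move=> hE; rewrite ler_pdivlMr// mulr_suml; apply: le_trans hE.
    apply: ler_sum => n _; rewrite mulrAC ler_wpM2r ?abs2_ge0// /w /v /satur expr1.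
    by rewrite [leLHS]mulrC mulrA.
  move=> /(_ hQ) /(le_trans (ler_norm _)) h.
  have : kappa * (2 * M * (B / N)) * `|T| <= 1.
    have -> : kappa * (2 * M * (B / N)) * `|T| = (kappa * (2 * M * B) * `|T|) / N.
      by rewrite !mulrA; ring.
    rewrite ler_pdivrMr// mul1r /N; have : 0 <= J%:R :> R by []. lra.
  lra.
apply: (@satur_recover 1 J N) => //; first by rewrite /N -addrA lerDl addr_ge0.
exact: le_trans (energy_le_oo J wge0 (bd T)) step2.
Qed.

(** The deviation of the truncated power of exponent k + 2 is O(S^(k+1)), uniformly
    in N, so the moment of exponent k + 1 bounds the slope of the next one. *)
Lemma moment_growth (k : nat) :
  (exists E0 : R, forall J, \sum_(n < J) n%:R ^+ k.+1 * abs2 (c 0 n) <= E0) ->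
  exists2 Ck : R, 0 <= Ck &
  forall t J, \sum_(n < J) n%:R ^+ k.+1 * abs2 (c t n) <= Ck * (1 + `|t|) ^+ k.
Proof.
elim: k => [|k IH] [E0 h0].
  have [C1 hC1] := first_moment h0; exists C1.
    by have := hC1 0 0%N; rewrite big_ord0.
  by move=> t J; rewrite expr0 mulr1.
have E00 : 0 <= E0 by have := h0 0%N; rewrite big_ord0.
have [|Ck Ck0 hCk] := IH.
  exists E0 => J; apply: le_trans (h0 J); apply: ler_sum => n _.
  rewrite ler_wpM2r ?abs2_ge0//; have [->|n0] := posnP n; first by rewrite !expr0n.
  by apply: ler_weXn2l; rewrite ?ler1n.
have [M M0 hM] := mass_conserved.
have [K K0 hK] := @satur_variance_high R k.
pose D := kappa * (2 * M * (K * 2 ^+ k.+1 * Ck)).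
have D0 : 0 <= D by rewrite !mulr_ge0// ?exprn_ge0// ltW.
exists (2 ^+ k.+2 * (E0 + D)) => [|T J].
  by rewrite mulr_ge0 ?exprn_ge0 ?addr_ge0.
have T1 : 1 <= 1 + `|T| by rewrite lerDl.
pose N : R := J%:R + 1; have N0 : 0 < N by rewrite ltr_wpDl.
pose w n := satur N n%:R ^+ k.+2.
have w0 n := satur_weight k.+2 n N0.
have wge0 n : 0 <= w n by have /andP[] := w0 n.
have bd t : exists M, forall J, energy w t J <= M := energy_bounded t w0.
pose V S : R := K * S%:R ^+ k.+1; have V0 S : 0 <= V S by rewrite mulr_ge0 ?exprn_ge0.
pose v n : R := K * 2 ^+ k.+1 * n%:R ^+ k.+1.
have v0 n : 0 <= v n by rewrite !mulr_ge0 ?exprn_ge0.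
have hV S i : (i <= S)%N -> V S <= v i + v (S - i)%N.
  move=> iS; rewrite /v -mulrDr -mulrA ler_wpM2l// mulrDr -!exprMn.
  have [h|h] := leP (S%:R : R) (2 * i%:R).
    apply: (@le_trans _ _ ((2 * i%:R) ^+ k.+1)).
      by rewrite lerXn2r ?nnegrE ?mulr_ge0.
    by rewrite lerDl exprn_ge0 ?mulr_ge0.
  apply: (@le_trans _ _ ((2 * (S - i)%N%:R) ^+ k.+1)).
    by rewrite lerXn2r ?nnegrE ?mulr_ge0// natrB//; lra.
  by rewrite lerDr exprn_ge0 ?mulr_ge0.
have varV S := hK N S N0.
have := @energyoo_lipschitz w (N ^+ k.+2)
  (2 * M * (K * 2 ^+ k.+1 * Ck * (1 + `|T|) ^+ k)) T _ V w0 V0 varV.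
have hQ t' : `|t'| <= `|T| -> forall L, \sum_(S < L) V S * pairmass (c t') S <=
    2 * M * (K * 2 ^+ k.+1 * Ck * (1 + `|T|) ^+ k).
  move=> tT L; apply: (@sum_pairmass_le _ _ v) => //.
  under eq_bigr do rewrite /v -mulrA.
  rewrite -mulr_sumr -[leRHS]mulrA; apply: ler_wpM2l.
    by rewrite mulr_ge0 ?exprn_ge0.
  apply: le_trans (hCk t' L) _; rewrite ler_wpM2l// lerXn2r ?nnegrE ?addr_ge0//.
  by rewrite lerD2l.
move=> /(_ hQ) /(le_trans (ler_norm _)) h.
have start : energyoo w 0 <= E0 by exact: energyoo_satur0.
rewrite -mulrA; apply: (@satur_recover k.+2 J N) => //; first by rewrite lerDl.
apply: le_trans (energy_le_oo J wge0 (bd T)) _.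
apply: (@le_trans _ _ (E0 * (1 + `|T|) ^+ k.+1 + D * (1 + `|T|) ^+ k.+1)); last first.
  by rewrite mulrDl.
have p1 : 1 <= (1 + `|T|) ^+ k.+1 by exact: exprn_ege1.
have q1 : E0 <= E0 * (1 + `|T|) ^+ k.+1 by rewrite ler_peMr.
have q2 : kappa * (2 * M * (K * 2 ^+ k.+1 * Ck * (1 + `|T|) ^+ k)) * `|T| <=
    D * (1 + `|T|) ^+ k.+1.
  have -> : kappa * (2 * M * (K * 2 ^+ k.+1 * Ck * (1 + `|T|) ^+ k)) * `|T| =
    D * ((1 + `|T|) ^+ k * `|T|) by rewrite /D; ring.
  rewrite ler_wpM2l// exprSr ler_wpM2l ?exprn_ge0//; lra.
lra.
Qed.

End Moments.

(** * Modulus, exponential and complex derivative *)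

Section Modulus.
Context {R : realType}.
Local Notation C := R[i].
Implicit Types z w : C.

Lemma modulusE z : modulus z = Num.sqrt (abs2 z).
Proof. by rewrite /modulus normc_def. Qed.

Lemma modulus_sqr z : modulus z ^+ 2 = abs2 z.
Proof. by rewrite modulusE sqr_sqrtr// abs2_ge0. Qed.

Lemma modulus_ge0 z : 0 <= modulus z.
Proof. by rewrite modulusE sqrtr_ge0. Qed.

Lemma normC_modulus z : `|z| = (modulus z)%:C.
Proof. by rewrite /modulus normc_def. Qed.

Lemma modulusM z w : modulus (z * w) = modulus z * modulus w.
Proof. by rewrite !modulusE abs2M sqrtrM// abs2_ge0. Qed.

Lemma modulusX z n : modulus (z ^+ n) = modulus z ^+ n.
Proof.
elim: n => [|n IH]; last by rewrite !exprS modulusM IH.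
by rewrite !expr0 modulusE /abs2 /= expr0n addr0 expr1n sqrtr1.
Qed.

Lemma modulusD z w : modulus (z + w) <= modulus z + modulus w.
Proof. by rewrite -lecR rmorphD/= -!normC_modulus ler_normD. Qed.

Lemma modulusN z : modulus (- z) = modulus z.
Proof. by rewrite /modulus normrN. Qed.

Lemma modulusJ z : modulus z^* = modulus z.
Proof. by rewrite !modulusE abs2J. Qed.

Lemma modulusB z w : modulus (z - w) = modulus (w - z).
Proof. by rewrite -modulusN opprB. Qed.

Lemma modulus0 : modulus (0 : C) = 0.
Proof. by rewrite modulusE /abs2 /= expr0n addr0 sqrtr0. Qed.

Lemma modulus_eq0 z : modulus z = 0 -> z = 0.
Proof. by move=> z0; apply/eqP; rewrite -normr_eq0 normC_modulus z0. Qed.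

Lemma modulus_real (r : R) : modulus r%:C = `|r|.
Proof. by rewrite modulusE abs2_real sqrtr_sqr. Qed.

Lemma Re_le_modulus z : `|complex.Re z| <= modulus z.
Proof.
by rewrite modulusE -sqrtr_sqr ler_wsqrtr// /abs2 lerDl sqr_ge0.
Qed.

Lemma Im_le_modulus z : `|complex.Im z| <= modulus z.
Proof.
by rewrite modulusE -sqrtr_sqr ler_wsqrtr// /abs2 lerDr sqr_ge0.
Qed.

Lemma modulus_le z : modulus z <= `|complex.Re z| + `|complex.Im z|.
Proof.
rewrite -ler_sqr ?nnegrE ?modulus_ge0 ?addr_ge0// modulus_sqr /abs2.
rewrite sqrrD !real_normK ?num_real// addrAC lerDl.
by rewrite mulrn_wge0// mulr_ge0.
Qed.

Lemma modulus_sum n (F : nat -> C) :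
  modulus (\sum_(i < n) F i) <= \sum_(i < n) modulus (F i).
Proof.
elim: n => [|n IH]; first by rewrite !big_ord0 modulus0.
by rewrite !big_ord_recr/=; apply: le_trans (modulusD _ _) _; rewrite lerD2r.
Qed.

End Modulus.

Section Exponential.
Context {R : realType}.
Local Notation C := R[i].
Implicit Types z w : C.

Lemma cexpD z w : cexp (z + w) = cexp z * cexp w.
Proof.
case: z w => a b [c d]; rewrite /cexp /= expRD cosD sinD.
by apply: complex_eq => /=; ring.
Qed.

Lemma modulus_cexp z : modulus (cexp z) = expR (complex.Re z).
Proof.
rewrite /cexp modulusM modulus_real ger0_norm ?expR_ge0// modulusE /abs2 /=.
by rewrite cos2Dsin2 sqrtr1 mulr1.
Qed.

Lemma cexp_real (r : R) : cexp r%:C = (expR r)%:C.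
Proof.
by rewrite /cexp /= cos0 sin0; apply: complex_eq => /=; ring.
Qed.

Lemma monotone_from_zero (f F df dF : R -> R) :
  (forall s : R, is_derive s 1 f (df s)) ->
  (forall s : R, is_derive s 1 F (dF s)) ->
  (forall s, 0 <= s <= 1 -> df s <= dF s) -> f 0 = 0 -> F 0 = 0 ->
  forall s, 0 <= s <= 1 -> f s <= F s.
Proof.
move=> hf hF le f0 F0 s /andP[s0 s1].
have dG (r : R) : is_derive r 1 (fun x => F x - f x) (dF r - df r).
  by apply: is_deriveB.
suff : F 0 - f 0 <= F s - f s by rewrite f0 F0 subrr subr_ge0.
apply: (@ger0_derive1_le_cc _ (fun x => F x - f x) 0 1) => //.
- move=> x; rewrite in_itv/= => /andP[x0 x1].
  by rewrite derive1E; have [_ ->] := dG x; rewrite subr_ge0 le// !ltW.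
- by apply: derivable_within_continuous => x _; apply: ex_derive; exact: dG.
- by rewrite in_itv/= lexx ler01.
- by rewrite in_itv/= s0.
Qed.

Definition exp_sum (N : nat) z : C := \sum_(n < N) (n`!%:R^-1)%:C * z ^+ n.

Lemma is_derive_monomial (K s : R) n :
  is_derive s 1 (fun r : R => K * r ^+ n.+1) (K * (n.+1%:R * s ^+ n)).
Proof.
have h : is_derive s 1 ((@id R) ^+ n.+1) ((n.+1%:R * s ^+ n) *: 1).
  exact: is_deriveX.
have := is_deriveZ K h; rewrite (_ : K *: _ = K * (n.+1%:R * s ^+ n)); last first.
  by rewrite /GRing.scale/= mulr1.
suff -> : K \*: (@id R) ^+ n.+1 = (fun r => K * r ^+ n.+1) by [].
apply/funext => r /=; rewrite /GRing.scale/=; congr (_ * _).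
by elim: n.+1 => [|m IH]; rewrite ?expr0// !exprS -IH.
Qed.

Lemma is_derive_cexp_line (k z : C) (s : R) :
  is_derive s 1 (fun r => complex.Re (k * cexp (r%:C * z)))
    (complex.Re (k * z * cexp (s%:C * z))).
Proof.
case: k z => p q [x y].
have -> : (fun r => complex.Re ((p +i* q) * cexp (r%:C * (x +i* y)))) =
   (fun r => expR (r * x) * (p * cos (r * y) - q * sin (r * y))).
  by apply/funext => r; rewrite /cexp /= !mul0r !(subr0, addr0); ring.
rewrite /cexp /= !mul0r !(subr0, addr0).
apply: is_derive_eq; rewrite /GRing.scale/= !(mulr1, scaler0, addr0, add0r, mulr0, subr0); ring.
Qed.

Lemma is_derive_exp_sum_line (k z : C) (s : R) N :
  is_derive s 1 (fun r => complex.Re (k * exp_sum N.+1 (r%:C * z)))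
    (complex.Re (k * z * exp_sum N (s%:C * z))).
Proof.
have E n r : (n`!%:R^-1)%:C * (r%:C * z) ^+ n =
    (r ^+ n / n`!%:R)%:C * z ^+ n :> C.
  rewrite exprMn mulrA -(rmorphXn (real_complex R)) -(rmorphM (real_complex R))/=.
  by rewrite [_^-1 * _]mulrC.
elim: N => [|N IH].
  have E1 r : exp_sum 1 (r%:C * z) = 1.
    by rewrite /exp_sum big_ord1 expr0 fact0 invr1 mulr1.
  rewrite {2}/exp_sum big_ord0 mulr0.
  by under [X in is_derive _ _ X]eq_fun do rewrite E1; exact: is_derive_cst.
have S r : complex.Re (k * exp_sum N.+2 (r%:C * z)) =
    complex.Re (k * exp_sum N.+1 (r%:C * z)) +
    N.+1`!%:R^-1 * complex.Re (k * z ^+ N.+1) * r ^+ N.+1.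
  rewrite {1}/exp_sum big_ord_recr/= E mulrDr raddfD/=; congr (_ + _).
  by rewrite mulrCA ReZ; ring.
have -> : complex.Re (k * z * exp_sum N.+1 (s%:C * z)) =
    complex.Re (k * z * exp_sum N (s%:C * z)) +
    N.+1`!%:R^-1 * complex.Re (k * z ^+ N.+1) * (N.+1%:R * s ^+ N).
  rewrite {1}/exp_sum big_ord_recr/= E mulrDr raddfD/=; congr (_ + _).
  have N0 : (N.+1%:R : R)^-1 * N.+1%:R = 1 by rewrite mulVf// pnatr_eq0.
  rewrite mulrCA ReZ exprS mulrA factS natrM invfM; move: N0.
  by move: (N.+1%:R : R) => m m1; rewrite -[LHS]mul1r -m1; ring.
under eq_fun do rewrite S; apply: is_deriveD; exact: is_derive_monomial.
Qed.

(** Integrating along a ray from 0 raises the order of the remainder by one;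
    the factor k makes one induction serve both coordinates. *)
Lemma exp_remainder_line (k z : C) N s : 0 <= s <= 1 ->
  `|complex.Re (k * (cexp (s%:C * z) - exp_sum N (s%:C * z)))| <=
  modulus k * (expR (modulus z) * (s * modulus z) ^+ N / N`!%:R).
Proof.
elim: N k s => [|N IH] k s s01.
  apply: le_trans (Re_le_modulus _) _; rewrite modulusM ler_wpM2l ?modulus_ge0//.
  rewrite /exp_sum big_ord0 subr0 expr0 fact0 mulr1 divr1 modulus_cexp ler_expR ReZ.
  move: s01 => /andP[s0 s1]; apply: le_trans (ler_norm _) _.
  rewrite normrM (ger0_norm s0); apply: le_trans (Re_le_modulus _).
  by rewrite ler_piMl.
pose e M j r := complex.Re (j * (cexp (r%:C * z) - exp_sum M (r%:C * z))).
pose K := modulus k * (expR (modulus z) * modulus z ^+ N.+1 / N.+1`!%:R).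
pose dB (r : R) := K * (N.+1%:R * r ^+ N).
have dBP (r : R) : is_derive r 1 (fun t : R => K * t ^+ N.+1) (dB r).
  exact: is_derive_monomial.
have dE j (r : R) : is_derive r 1 (e N.+1 j) (e N (j * z) r).
  rewrite /e mulrBr raddfB/=; under eq_fun do rewrite mulrBr raddfB/=.
  by apply: is_deriveB; [exact: is_derive_cexp_line|exact: is_derive_exp_sum_line].
have e0 j : e N.+1 j 0 = 0.
  rewrite /e mul0r /exp_sum big_ord_recl/= expr0 fact0 invr1 mulr1 big1 ?addr0.
    by rewrite -[0 : C]/(0%:C) cexp_real expR0 subrr mulr0.
  by move=> i _; rewrite expr0n/= mulr0.
have bnd j (r : R) : modulus j = modulus k -> 0 <= r <= 1 -> e N (j * z) r <= dB r.
  move=> jk /(IH (j * z)) /(le_trans (ler_norm _)) /le_trans; apply.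
  rewrite modulusM jk /dB /K exprMn factS natrM invfM exprS.
  have N0 : (N.+1%:R : R)^-1 * N.+1%:R = 1 by rewrite mulVf// pnatr_eq0.
  apply: eq_ler; move: N0; move: (N.+1%:R : R) => m m1; rewrite -[LHS]mul1r -m1; ring.
have B0 : K * 0 ^+ N.+1 = 0 by rewrite expr0n mulr0.
have half j : modulus j = modulus k -> e N.+1 j s <= K * s ^+ N.+1.
  by move=> jk; apply: (monotone_from_zero (dE j) dBP) => // r r01; exact: bnd.
rewrite (_ : modulus k * _ = K * s ^+ N.+1); last by rewrite /K exprMn; ring.
rewrite ler_norml; apply/andP; split; last exact: half.
by rewrite lerNl -raddfN -mulNr; apply: half; exact: modulusN.
Qed.

Lemma exp_remainder z N :
  modulus (cexp z - exp_sum N z) <= 2 * (expR (modulus z) * modulus z ^+ N / N`!%:R).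
Proof.
have h k : modulus k = 1 -> `|complex.Re (k * (cexp z - exp_sum N z))| <=
    expR (modulus z) * modulus z ^+ N / N`!%:R.
  move=> k1; have := @exp_remainder_line k z N 1.
  by rewrite ler01 lexx !mul1r k1 mul1r; apply.
apply: le_trans (modulus_le _) _.
have h1 := h 1; rewrite mul1r in h1.
have hi := h (0 -i* 1); rewrite (_ : complex.Re ((0 -i* 1) * _) =
  complex.Im (cexp z - exp_sum N z)) in hi; last first.
  by case: (cexp z - _) => p q /=; ring.
rewrite mulr2n mulrDl mul1r; apply: lerD; [apply: h1|apply: hi].
  by rewrite modulusE /abs2 /= expr1n expr0n addr0 sqrtr1.
by rewrite modulusE /abs2 /= sqrrN expr1n expr0n add0r sqrtr1.
Qed.

Lemma exp_sum_cvg z : modulus (cexp z - exp_sum N z) @[N --> \oo] --> (0 : R).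
Proof.
apply: (@squeeze_cvgr _ _ _ _ (fun=> 0)
  (fun N => 2 * expR (modulus z) * (modulus z ^+ N / N`!%:R))).
- near=> N; rewrite modulus_ge0/= (le_trans (exp_remainder _ _))//.
  by rewrite -!mulrA.
- exact: cvg_cst.
- rewrite -[X in _ --> X](mulr0 (2 * expR (modulus z))); apply: cvgMl_tmp.
  have /cvg_series_cvg_0 := is_cvg_series_exp_coeff (modulus z).
  exact.
Unshelve. all: by end_near. Qed.

Lemma modulus_exp_sum z N : modulus (exp_sum N z) <= expR (modulus z).
Proof.
apply: le_trans (modulus_sum _ (fun n => (n`!%:R^-1)%:C * z ^+ n)) _.
apply: (@le_trans _ _ (series (exp_coeff (modulus z)) N)).
  rewrite /series/= big_mkord; apply: ler_sum => n _; rewrite /exp_coeff/=.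
  by rewrite modulusM modulus_real modulusX ger0_norm ?invr_ge0// mulrC.
apply: nondecreasing_cvgn_le; last exact: is_cvg_series_exp_coeff.
by apply: nondecreasing_series => n _ _; exact: exp_coeff_ge0 (modulus_ge0 z).
Qed.

End Exponential.

Section ComplexDerivative.
Context {R : realType}.
Local Notation C := R[i].
Implicit Types (z w p : C) (f g h : C -> C).

(** Radii and tolerances are real, whereas the norm of R[i] takes values in
    R[i]. *)
Definition cdiff h p := exists A : C, forall e : R, 0 < e ->
  exists2 d : R, 0 < d & forall z, modulus (z - p) < d ->
    modulus (h z - h p - A * (z - p)) <= e * modulus (z - p).

(** The unit direction suffices because the increments h range over all complex
    numbers. *)
Lemma derivable_cdiff f p : derivable (f : C^o -> C^o) p 1 -> cdiff f p.
Proof.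
move=> /cvg_ex[/= A hA]; exists A => e e0.
have eC : 0 < e%:C by rewrite ltcR.
move: hA => /cvgrPdist_le/(_ _ eC).
move=> /nbhs_ballP[/= dC dC0 hd].
pose d := complex.Re dC.
have dE : dC = d%:C.
  by rewrite /d RRe_real// gtr0_real.
exists d; first by rewrite -ltcR -dE.
move=> z zd; have [->|zp] := eqVneq z p.
  by rewrite !subrr mulr0 subrr modulus0 mulr0.
have zp0 : z - p != 0 by rewrite subr_eq0.
have := hd (z - p); rewrite /= /ball/= sub0r normrN => /(_ _ zp0).
rewrite normC_modulus dE ltcR => /(_ zd).
rewrite -[_ *: 1]/((z - p) * 1) mulr1 subrK -[_ *: _]/(_ * _) normC_modulus lecR => h.
have -> : f z - f p - A * (z - p) =
   - ((A - (z - p)^-1 * (f z - f p)) * (z - p)).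
  by field.
by rewrite modulusN modulusM ler_wpM2r ?modulus_ge0.
Qed.

Lemma cdiff_continuous h p : cdiff h p -> forall e : R, 0 < e ->
  exists2 d : R, 0 < d & forall z, modulus (z - p) < d ->
    modulus (h z - h p) < e.
Proof.
move=> [A hA] e e0; have [d d0 hd] := hA 1 ltr01.
have mA0 := modulus_ge0 A.
have k0 : 0 < 1 + modulus A by rewrite ltr_wpDr.
exists (Num.min d (e / (1 + modulus A))).
  by rewrite lt_min d0 divr_gt0.
move=> z; rewrite lt_min => /andP[zd ze].
have -> : h z - h p = (h z - h p - A * (z - p)) + A * (z - p) by rewrite subrK.
apply: le_lt_trans (modulusD _ _) _; rewrite modulusM.
have := hd z zd; rewrite mul1r => h1.
apply: (@le_lt_trans _ _ ((1 + modulus A) * modulus (z - p))).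
  by rewrite mulrDl mul1r lerD2r.
by rewrite mulrC -ltr_pdivlMr.
Qed.

Lemma cdiff_comp f g p : cdiff g p -> cdiff f (g p) -> cdiff (f \o g) p.
Proof.
move=> dg [A hA]; have gc := cdiff_continuous dg; have [B hB] := dg.
exists (A * B) => e e0.
have mA0 := modulus_ge0 A; have mB0 := modulus_ge0 B.
pose e1 := e / (2 * (1 + modulus B)).
have kB : 0 < 1 + modulus B by rewrite ltr_wpDr.
have kA : 0 < 1 + modulus A by rewrite ltr_wpDr.
have e10 : 0 < e1 by rewrite divr_gt0// mulr_gt0.
pose e2 := Num.min 1 (e / (2 * (1 + modulus A))).
have e20 : 0 < e2 by rewrite lt_min ltr01 divr_gt0// mulr_gt0.
have [d1 d10 h1] := hA e1 e10.
have [d2 d20 h2] := gc d1 d10.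
have [d3 d30 h3] := hB e2 e20.
exists (Num.min d2 d3); first by rewrite lt_min d20.
move=> z; rewrite lt_min => /andP[z2 z3] /=.
have m0 := modulus_ge0 (z - p).
have a1 := h3 z z3; have a2 := h1 (g z) (h2 z z2).
have a3 : modulus (g z - g p) <= (1 + modulus B) * modulus (z - p).
  have -> : g z - g p = (g z - g p - B * (z - p)) + B * (z - p) by rewrite subrK.
  apply: le_trans (modulusD _ _) _; rewrite modulusM mulrDl lerD2r.
  apply: le_trans a1 _; apply: ler_wpM2r => //.
  by rewrite ge_min lexx.
have -> : f (g z) - f (g p) - A * B * (z - p) =
  (f (g z) - f (g p) - A * (g z - g p)) + A * (g z - g p - B * (z - p)) by ring.
apply: le_trans (modulusD _ _) _; rewrite modulusM.
have -> : e * modulus (z - p) = e / 2 * modulus (z - p) + e / 2 * modulus (z - p).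
  by field.
apply: lerD.
  apply: le_trans a2 _; apply: le_trans (ler_wpM2l (ltW e10) a3) _.
  rewrite mulrA ler_wpM2r// /e1; apply: eq_ler; field.
  exact: lt0r_neq0.
apply: le_trans (ler_wpM2l mA0 a1) _; rewrite mulrA ler_wpM2r//.
apply: (@le_trans _ _ ((1 + modulus A) * (e / (2 * (1 + modulus A))))).
  apply: ler_pM => //; [exact: ltW|by rewrite lerDr|by rewrite ge_min lexx orbT].
by apply: eq_ler; field; exact: lt0r_neq0.
Qed.

Lemma cdiff_mul f g p : cdiff f p -> cdiff g p -> cdiff (fun z => f z * g z) p.
Proof.
move=> df dg; have gc := cdiff_continuous dg; have [B hB] := dg; have [A hA] := df.
exists (A * g p + f p * B) => e e0.
set mA := modulus A; set mf := modulus (f p); set mg := modulus (g p).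
have mA0 : 0 <= mA := modulus_ge0 _; have mf0 : 0 <= mf := modulus_ge0 _.
have mg0 : 0 <= mg := modulus_ge0 _.
pose S := 1 + mA + mf + mg; have S0 : 0 < S by rewrite /S; lra.
pose e1 := Num.min 1 (e / (4 * S)).
have e10 : 0 < e1 by rewrite lt_min ltr01 divr_gt0// mulr_gt0.
have [d1 d10 h1] := hA e1 e10.
have [d2 d20 h2] := hB e1 e10.
have [d3 d30 h3] := gc e1 e10.
exists (Num.min d1 (Num.min d2 d3)); first by rewrite !lt_min d10 d20.
move=> z; rewrite !lt_min => /and3P[z1 z2 z3].
have m0 := modulus_ge0 (z - p).
have a1 := h1 z z1; have a2 := h2 z z2; have a3 := ltW (h3 z z3).
have -> : f z * g z - f p * g p - (A * g p + f p * B) * (z - p) =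
  (f z - f p - A * (z - p)) * (g p + (g z - g p))
  + (A * (z - p)) * (g z - g p) + f p * (g z - g p - B * (z - p)) by ring.
have e1S : e1 * (4 * S) <= e.
  by rewrite -ler_pdivlMr ?mulr_gt0// ge_min lexx orbT.
have e11 : e1 <= 1 by rewrite ge_min lexx.
apply: le_trans (modulusD _ _) _; apply: le_trans (lerD (modulusD _ _) (lexx _)) _.
rewrite !modulusM -/mA -/mf.
have b1 : modulus (f z - f p - A * (z - p)) * modulus (g p + (g z - g p)) <=
    e1 * modulus (z - p) * (mg + 1).
  apply: ler_pM; rewrite ?modulus_ge0//; apply: le_trans (modulusD _ _) _.
  by rewrite lerD2l (le_trans a3).
have b2 : mA * modulus (z - p) * modulus (g z - g p) <= mA * modulus (z - p) * e1.
  by rewrite ler_wpM2l ?mulr_ge0.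
have b3 : mf * modulus (g z - g p - B * (z - p)) <= mf * (e1 * modulus (z - p)).
  by rewrite ler_wpM2l.
apply: le_trans (lerD (lerD b1 b2) b3) _.
have -> : e1 * modulus (z - p) * (mg + 1) + mA * modulus (z - p) * e1 +
  mf * (e1 * modulus (z - p)) = (e1 * (mg + 1 + mA + mf)) * modulus (z - p) by ring.
rewrite ler_wpM2r//; apply: le_trans e1S; rewrite ler_pM2l// /S; lra.
Qed.

Lemma cdiff_affine (a b : C) p : cdiff (fun z => a * z + b) p.
Proof.
exists a => e e0; exists 1 => // z _.
rewrite (_ : _ - _ - _ = 0) ?modulus0 ?mulr_ge0 ?modulus_ge0 ?ltW//.
by ring.
Qed.

Lemma cdiff_cexp p : cdiff cexp p.
Proof.
exists (cexp p) => e e0; set m := modulus (cexp p).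
have m0 : 0 <= m := modulus_ge0 _.
pose K := m * (2 * expR 1).
have K0 : 0 <= K by rewrite !mulr_ge0// expR_ge0.
exists (Num.min 1 (e / (K + 1))).
  by rewrite lt_min ltr01 divr_gt0// ltr_wpDl.
move=> z; rewrite lt_min => /andP[z1 ze].
set r := modulus (z - p) in z1 ze *; have r0 : 0 <= r := modulus_ge0 _.
have -> : cexp z - cexp p - cexp p * (z - p) =
  cexp p * (cexp (z - p) - exp_sum 2 (z - p)).
  have -> : cexp z = cexp p * cexp (z - p) by rewrite -cexpD subrKC.
  rewrite /exp_sum 2!big_ord_recr/= big_ord0 -[1`!]/1%N -[0`!]/1%N invr1 rmorph1.
  by rewrite expr0 expr1; ring.
rewrite modulusM -/m.
have h := exp_remainder (z - p) 2; rewrite -/r in h.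
apply: (@le_trans _ _ (K * r * r)).
  rewrite /K; apply: le_trans (ler_wpM2l m0 h) _.
  have er : expR r <= expR 1 by rewrite ler_expR ltW.
  have : expR r * (r * r) <= expR 1 * (r * r) by rewrite ler_wpM2r ?mulr_ge0.
  move=> /(ler_wpM2l m0).
  rewrite (_ : 2`! = 2%N)// expr2; set E := expR r; set E1 := expR 1.
  have : 0 <= m * (E * (r * r)) by rewrite !mulr_ge0// expR_ge0.
  by nra.
rewrite ler_wpM2r//; apply: (@le_trans _ _ ((K + 1) * r)).
  by rewrite ler_wpM2r// lerDl.
by rewrite mulrC -ler_pdivlMr ?ltr_wpDl// ltW.
Qed.

End ComplexDerivative.

(** * Cauchy on rectangles and the mean value over circles *)

Section SegmentIntegral.
Context {R : realType}.
Local Notation mu := (@lebesgue_measure R).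
Implicit Types (f g : R -> R) (a b c d m k : R).

Definition segint g a b : R := \int[mu]_(x in `[a, b]) g x.

Lemma segint_integrable g a b : continuous g ->
  mu.-integrable `[a, b] (EFin \o g).
Proof.
move=> gc; apply: (@continuous_compact_integrable R g); first exact: segment_compact.
exact: continuous_subspaceT.
Qed.

Lemma segint_split g a m b : continuous g -> a <= m -> m <= b ->
  segint g a b = segint g a m + segint g m b.
Proof.
move=> gc am mb; rewrite /segint.
have := @Rintegral_itvB R g (BLeft a) (BRight b) m (segint_integrable a b gc).
rewrite !bnd_simp => /(_ am mb) h.
rewrite -(Rintegral_itv_obnd_cbnd (r := m)) -?h ?subrKC//.
apply: integrableS (segint_integrable a b gc) => //.
by apply: subset_itv; rewrite ?bnd_simp.
Qed.

Lemma segintB f g a b : continuous f -> continuous g ->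
  segint (fun x => f x - g x) a b = segint f a b - segint g a b.
Proof. by move=> fc gc; rewrite /segint RintegralB//; exact: segint_integrable. Qed.

Lemma segint_cst k a b : a <= b -> segint (fun=> k) a b = k * (b - a).
Proof.
move=> ab; rewrite /segint Rintegral_cst//= lebesgue_measure_itv/= lte_fin.
case: ltP => [//|ba] /=; have -> : a = b by apply/le_anti; rewrite ab ba.
by rewrite subrr !mulr0.
Qed.

Lemma segint_le g a b M : continuous g -> a <= b ->
  (forall x, a <= x <= b -> `|g x| <= M) -> `|segint g a b| <= M * (b - a).
Proof.
move=> gc ab gM; rewrite -(segint_cst M ab) /segint.
have ig := segint_integrable a b gc.
apply: le_trans (le_normr_Rintegral _ ig) _ => //.
apply: le_Rintegral => //.
- by have := integrable_norm ig; apply: eq_integrable.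
- by apply: segint_integrable => x; exact: cvg_cst.
Qed.

End SegmentIntegral.

Section Goursat.
Context {R : realType}.
Variables U V : R -> R -> R.
Hypothesis cU : forall x, continuous (U x).
Hypothesis cV : forall y, continuous (V^~ y).
Hypothesis diffUV : forall x0 y0 : R, exists al be : R, forall e : R, 0 < e ->
  exists2 d : R, 0 < d & forall x y, `|x - x0| < d -> `|y - y0| < d ->
  `|U x y - U x0 y0 - (al * (x - x0) - be * (y - y0))|
     <= e * (`|x - x0| + `|y - y0|) /\
  `|V x y - V x0 y0 - (be * (x - x0) + al * (y - y0))|
     <= e * (`|x - x0| + `|y - y0|).

(** The imaginary part of the integral of (U + i V) d z along the boundary of
    the rectangle [a, b] x [c, d]. *)
Definition boundary a b c d : R :=
  segint (fun y => U b y - U a y) c d - segint (fun x => V x d - V x c) a b.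

Lemma boundary_split_x a m b c d : a <= m -> m <= b ->
  boundary a b c d = boundary a m c d + boundary m b c d.
Proof.
move=> am mb; rewrite /boundary !segintB// (segint_split _ am mb)//.
by rewrite (segint_split _ am mb)//; ring.
Qed.

Lemma boundary_split_y a b c m d : c <= m -> m <= d ->
  boundary a b c d = boundary a b c m + boundary a b m d.
Proof.
move=> cm md; rewrite /boundary !segintB// (segint_split _ cm md)//.
by rewrite (segint_split _ cm md)//; ring.
Qed.

Section Bisection.
Variables (a0 b0 c0 d0 : R).
Hypotheses (ab0 : a0 <= b0) (cd0 : c0 <= d0).

Let wd n : R := (b0 - a0) / 2 ^+ n.
Let ht n : R := (d0 - c0) / 2 ^+ n.

Let wd_ge0 n : 0 <= wd n.
Proof. by rewrite divr_ge0 ?subr_ge0 ?exprn_ge0. Qed.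

Let ht_ge0 n : 0 <= ht n.
Proof. by rewrite divr_ge0 ?subr_ge0 ?exprn_ge0. Qed.

Let half (x : R) n : x / 2 ^+ n = x / 2 ^+ n.+1 + x / 2 ^+ n.+1.
Proof. by rewrite exprS; field; rewrite expf_neq0. Qed.

Let J n (p : R * R) := boundary p.1 (p.1 + wd n) p.2 (p.2 + ht n).

Let next n (p : R * R) : R * R :=
  let a' := p.1 + wd n.+1 in let c' := p.2 + ht n.+1 in
  if `|J n p| <= 4 * `|J n.+1 p| then p else
  if `|J n p| <= 4 * `|J n.+1 (a', p.2)| then (a', p.2) else
  if `|J n p| <= 4 * `|J n.+1 (p.1, c')| then (p.1, c') else (a', c').

Let next_large n p : `|J n p| <= 4 * `|J n.+1 (next n p)|.
Proof.
rewrite /next; case: ifPn => //; rewrite -ltNge => h1.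
case: ifPn => //; rewrite -ltNge => h2.
case: ifPn => //; rewrite -ltNge => h3.
set J4 := J n.+1 (_, _).
have : J n p = J n.+1 p + J n.+1 (p.1 + wd n.+1, p.2) +
   J n.+1 (p.1, p.2 + ht n.+1) + J4.
  have wE : wd n = wd n.+1 + wd n.+1 by exact: half.
  have hE : ht n = ht n.+1 + ht n.+1 by exact: half.
  rewrite /J4 /J/= -![_ + wd n.+1 + _]addrA -![_ + ht n.+1 + ht _]addrA -wE -hE.
  have wle : p.1 <= p.1 + wd n.+1 by rewrite lerDl.
  have wle' : p.1 + wd n.+1 <= p.1 + wd n by rewrite lerD2l wE lerDl.
  have hle : p.2 <= p.2 + ht n.+1 by rewrite lerDl.
  have hle' : p.2 + ht n.+1 <= p.2 + ht n by rewrite lerD2l hE lerDl.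
  rewrite (boundary_split_x _ _ wle wle') (boundary_split_y _ _ hle hle').
  by rewrite (boundary_split_y _ _ hle hle'); ring.
move=> JE.
have := ler_normD (J n.+1 p + J n.+1 (p.1 + wd n.+1, p.2) +
   J n.+1 (p.1, p.2 + ht n.+1)) J4; rewrite -JE.
have := ler_normD (J n.+1 p + J n.+1 (p.1 + wd n.+1, p.2))
   (J n.+1 (p.1, p.2 + ht n.+1)).
have := ler_normD (J n.+1 p) (J n.+1 (p.1 + wd n.+1, p.2)).
by lra.
Qed.

Let Fixpoint corner n : R * R := if n is n'.+1 then next n' (corner n') else (a0, c0).

Let corner_step n : [/\ (corner n).1 <= (corner n.+1).1,
   (corner n.+1).1 + wd n.+1 <= (corner n).1 + wd n,
   (corner n).2 <= (corner n.+1).2 &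
   (corner n.+1).2 + ht n.+1 <= (corner n).2 + ht n].
Proof.
rewrite [corner n.+1]/= /next; move: (corner n) => p.
have w1 := wd_ge0 n.+1; have h1 := ht_ge0 n.+1.
have wE : wd n = wd n.+1 + wd n.+1 by exact: half.
have hE : ht n = ht n.+1 + ht n.+1 by exact: half.
by do ?case: ifP => _; split => /=; lra.
Qed.

Let corner_large n : `|J 0 (a0, c0)| <= 4 ^+ n * `|J n (corner n)|.
Proof.
elim: n => [|n IH]; first by rewrite mul1r.
by apply: le_trans IH _; rewrite exprSr -mulrA ler_wpM2l ?exprn_ge0.
Qed.

Let nested (x w : nat -> R) : (forall n, 0 <= w n) ->
  (forall n, x n <= x n.+1) -> (forall n, x n.+1 + w n.+1 <= x n + w n) ->
  exists s, forall n, x n <= s <= x n + w n.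
Proof.
move=> w0 xnd xwni.
have mono m n : (m <= n)%N -> x m <= x n.
  elim: n => [|n IH]; first by rewrite leqn0 => /eqP ->.
  rewrite leq_eqVlt => /predU1P[->//|]; rewrite ltnS => /IH h.
  exact: le_trans h (xnd n).
have anti m n : (m <= n)%N -> x n + w n <= x m + w m.
  elim: n => [|n IH]; first by rewrite leqn0 => /eqP ->.
  rewrite leq_eqVlt => /predU1P[->//|]; rewrite ltnS => /IH.
  by apply: le_trans; exact: xwni.
have ub m n : x m <= x n + w n.
  have [mn|nm] := leqP m n.
    by apply: le_trans (mono _ _ mn) _; rewrite lerDl.
  by apply: le_trans _ (anti _ _ (ltnW nm)); rewrite lerDl.
exists (sup (range x)) => n; apply/andP; split.
  apply: ub_le_sup; last by exists n.
  by exists (x 0%N + w 0%N) => _ [m _ <-].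
by apply: ge_sup; [exists (x 0%N); exists 0%N|move=> _ [m _ <-]].
Qed.

(** Bisection: one of the four quarters carries at least a quarter of the boundary
    integral. At the common point of the nested rectangles the first order part
    integrates to 0, and the remainder is of order e times the squared perimeter. *)
Lemma goursat_rectangle : boundary a0 b0 c0 d0 = 0.
Proof.
have [x0 hx] : exists s, forall n, (corner n).1 <= s <= (corner n).1 + wd n.
  by apply: nested => // n; have [] := corner_step n.
have [y0 hy] : exists s, forall n, (corner n).2 <= s <= (corner n).2 + ht n.
  by apply: nested => // n; have [] := corner_step n.
have [al [be hd]] := diffUV x0 y0.
have JE : J 0 (a0, c0) = boundary a0 b0 c0 d0.
  by rewrite /J /wd /ht/= expr0 !divr1 !subrKC.
rewrite -JE; apply/eqP; rewrite -normr_le0; apply/ler_addgt0Pl => e' e'0.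
rewrite addr0.
set L := (b0 - a0) + (d0 - c0).
have L0 : 0 <= L by rewrite addr_ge0 ?subr_ge0.
pose e := e' / (2 * (L ^+ 2 + 1)).
have e0 : 0 < e by rewrite divr_gt0// mulr_gt0// ltr_wpDl// sqr_ge0.
have [d d0' hde] := hd e e0.
have [n hn] : exists n, L / 2 ^+ n < d.
  exists (Num.bound (L / d)); rewrite ltr_pdivrMr ?exprn_gt0// mulrC.
  rewrite -ltr_pdivrMr//; apply: lt_le_trans (archi_boundP _) _.
    by rewrite divr_ge0 ?(ltW d0').
  by rewrite -natrX ler_nat; exact/ltnW/ltn_expl.
set a := (corner n).1; set c := (corner n).2.
have wn0 := wd_ge0 n; have hn0 := ht_ge0 n.
have whL : wd n + ht n = L / 2 ^+ n by rewrite /wd /ht -mulrDl.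
have /andP[ax xb] := hx n; have /andP[cy yd] := hy n.
rewrite -/a -/c in ax xb cy yd.
have near x y : a <= x <= a + wd n -> c <= y <= c + ht n ->
  `|U x y - U x0 y0 - (al * (x - x0) - be * (y - y0))| <= e * (wd n + ht n) /\
  `|V x y - V x0 y0 - (be * (x - x0) + al * (y - y0))| <= e * (wd n + ht n).
  move=> /andP[x1 x2] /andP[y1 y2].
  have xx : `|x - x0| <= wd n by rewrite ler_norml; lra.
  have yy : `|y - y0| <= ht n by rewrite ler_norml; lra.
  have [] := hde x y; [lra|lra|] => h1 h2.
  have le : e * (`|x - x0| + `|y - y0|) <= e * (wd n + ht n).
    by rewrite ler_wpM2l ?(ltW e0)// lerD.
  by split; [apply: le_trans h1 le|apply: le_trans h2 le].
have aw : a <= a + wd n by rewrite lerDl.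
have ch : c <= c + ht n by rewrite lerDl.
have endp (s w : R) : 0 <= w -> (s <= s <= s + w) && (s <= s + w <= s + w).
  by move=> w0; rewrite !lexx lerDl w0.
have /andP[ia ib] := endp a _ wn0; have /andP[ic id] := endp c _ hn0.
have partU : `|segint (fun y => U (a + wd n) y - U a y) c (c + ht n)
    - al * wd n * ht n| <= 2 * e * (wd n + ht n) * ht n.
  have -> : al * wd n * ht n = segint (fun=> al * wd n) c (c + ht n).
    by rewrite segint_cst// addrC addKr.
  rewrite -segintB; last by move=> y; exact: cvg_cst.
    have -> : 2 * e * (wd n + ht n) * ht n = 2 * e * (wd n + ht n) * (c + ht n - c).
      by congr (_ * _); rewrite addrC addKr.
    apply: segint_le => //.
      move=> y; apply: cvgB; last exact: cvg_cst.
      by apply: cvgB; exact: cU.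
    move=> y hy'; have [h1 _] := near _ _ ib hy'; have [h2 _] := near _ _ ia hy'.
    move: h1 h2; rewrite !ler_norml; lra.
  by move=> y; apply: cvgB; exact: cU.
have partV : `|segint (fun x => V x (c + ht n) - V x c) a (a + wd n)
    - al * wd n * ht n| <= 2 * e * (wd n + ht n) * wd n.
  have -> : al * wd n * ht n = segint (fun=> al * ht n) a (a + wd n).
    by rewrite segint_cst// addrC addKr mulrAC.
  rewrite -segintB; last by move=> y; exact: cvg_cst.
    have -> : 2 * e * (wd n + ht n) * wd n = 2 * e * (wd n + ht n) * (a + wd n - a).
      by congr (_ * _); rewrite addrC addKr.
    apply: segint_le => //.
      move=> y; apply: cvgB; last exact: cvg_cst.
      by apply: cvgB; exact: cV.
    move=> x hx'; have [_ h1] := near _ _ hx' id; have [_ h2] := near _ _ hx' ic.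
    move: h1 h2; rewrite !ler_norml; lra.
  by move=> x; apply: cvgB; exact: cV.
apply: le_trans (corner_large n) _.
have Jn : `|J n (corner n)| <= 2 * e * (wd n + ht n) ^+ 2.
  rewrite /J /boundary -/a -/c.
  move: partU partV; set u := segint _ _ _; set v := segint _ _ _ => hu hv.
  have -> : u - v = (u - al * wd n * ht n) - (v - al * wd n * ht n) by ring.
  apply: le_trans (ler_normB _ _) _; apply: le_trans (lerD hu hv) _.
  by apply: eq_ler; ring.
apply: le_trans (ler_wpM2l _ Jn) _; first by rewrite exprn_ge0.
rewrite whL expr_div_n.
have -> : 4 ^+ n * (2 * e * (L ^+ 2 / (2 ^+ n) ^+ 2)) = 2 * e * L ^+ 2.
  have -> : 4 ^+ n = (2 ^+ n) ^+ 2 :> R.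
    by rewrite -exprM mulnC exprM; congr (_ ^+ n); rewrite expr2; ring.
  by field; rewrite expf_neq0.
have -> : 2 * e * L ^+ 2 = e' * (L ^+ 2 / (L ^+ 2 + 1)).
  by rewrite /e; field; rewrite lt0r_neq0// ltr_wpDl// sqr_ge0.
rewrite ler_piMr ?(ltW e'0)// ler_pdivrMr ?mul1r ?lerDl//.
by rewrite ltr_wpDl// sqr_ge0.
Qed.

End Bisection.
End Goursat.

Section CircleMean.
Context {R : realType}.
Local Notation C := R[i].
Implicit Types (F : C -> C) (w z p : C).

(** Used for the real and imaginary parts along horizontal and vertical lines. *)
Lemma cdiff_continuous_coord (h : C -> C) (part : C -> R) (g : R -> C) :
  (forall p, cdiff h p) -> (forall z p, `|part z - part p| <= modulus (z - p)) ->
  (forall x y, modulus (g x - g y) = `|x - y|) -> continuous (part \o h \o g).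
Proof.
move=> dh hpart hg y0; apply/cvgrPdist_lt => e e0.
have [d d0 hd] := cdiff_continuous (dh (g y0)) e0.
near=> y; rewrite /= distrC; apply: le_lt_trans (hpart _ _) _; apply: hd.
rewrite hg distrC; near: y.
by exists d.
Unshelve. all: by end_near. Qed.

(** In the logarithmic coordinate x + i y the circles about 0 are the vertical
    segments of length 2 pi, on which w e^(x + i y) is periodic: the horizontal
    sides of a rectangle cancel and the mean over a circle does not depend on
    its radius, which is then sent to 0. *)
Lemma circle_mean F w : (forall p, cdiff F p) ->
  segint (fun y => complex.Re (F (w * cexp (0 +i* y)))) (- pi) pi =
  2 * pi * complex.Re (F 0).
Proof.
move=> dF; pose h z := F (w * cexp z).
have dh p : cdiff h p.
  have -> : h = F \o ((fun z => w * z + 0) \o cexp).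
    by apply/funext => z; rewrite /h/= addr0.
  by apply: cdiff_comp => //; apply: cdiff_comp; [exact: cdiff_cexp|exact: cdiff_affine].
pose U x y := complex.Re (h (x +i* y)); pose V x y := complex.Im (h (x +i* y)).
have partR z p : `|complex.Re z - complex.Re p| <= modulus (z - p).
  by rewrite -raddfB; exact: Re_le_modulus.
have partI z p : `|complex.Im z - complex.Im p| <= modulus (z - p).
  by rewrite -raddfB; exact: Im_le_modulus.
have cU x : continuous (U x).
  have hg (y y' : R) : modulus ((x +i* y) - (x +i* y')) = `|y - y'|.
    by rewrite modulusE /abs2 /= subrr expr0n add0r sqrtr_sqr.
  exact: (@cdiff_continuous_coord h (@complex.Re R) _ dh partR hg).
have cV y : continuous (V^~ y).
  have hg (x x' : R) : modulus ((x +i* y) - (x' +i* y)) = `|x - x'|.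
    by rewrite modulusE /abs2 /= subrr expr0n addr0 sqrtr_sqr.
  exact: (@cdiff_continuous_coord h (@complex.Im R) (fun x => x +i* y) dh partI hg).
have dUV x0 y0 : exists al be : R, forall e : R, 0 < e ->
  exists2 d : R, 0 < d & forall x y, `|x - x0| < d -> `|y - y0| < d ->
  `|U x y - U x0 y0 - (al * (x - x0) - be * (y - y0))|
     <= e * (`|x - x0| + `|y - y0|) /\
  `|V x y - V x0 y0 - (be * (x - x0) + al * (y - y0))|
     <= e * (`|x - x0| + `|y - y0|).
  have [[al be] hA] := dh (x0 +i* y0); exists al, be => e e0.
  have [d d0 hd] := hA e e0; exists (d / 2); first by rewrite divr_gt0.
  move=> x y xd yd.
  have m : modulus ((x +i* y) - (x0 +i* y0)) <= `|x - x0| + `|y - y0|.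
    exact: modulus_le.
  have /hd h1 : modulus ((x +i* y) - (x0 +i* y0)) < d by lra.
  have {}h1 := le_trans h1 (ler_wpM2l (ltW e0) m).
  split; apply: le_trans h1.
    by apply: le_trans (Re_le_modulus _); rewrite !raddfB.
  by rewrite [be * _ + _]addrC; apply: le_trans (Im_le_modulus _); rewrite !raddfB.
have pi0 : 0 <= pi :> R := pi_ge0 R.
have mpi : - pi <= pi :> R by lra.
have same x : x <= 0 -> segint (U 0) (- pi) pi = segint (U x) (- pi) pi.
  move=> x0; have := goursat_rectangle cU cV dUV x0 mpi; rewrite /boundary.
  have -> : (fun x => V x pi - V x (- pi)) = fun=> 0.
    apply/funext => t; rewrite /V.
    have -> : h (t +i* (- pi)) = h (t +i* pi).
      by rewrite /h /cexp /= cosN sinN sinpi oppr0.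
    exact: subrr.
  rewrite (segint_cst 0 x0) mul0r subr0 (segintB _ _ (cU 0) (cU x)).
  by move=> /eqP; rewrite subr_eq0 => /eqP.
rewrite -[LHS]/(segint (U 0) (- pi) pi).
apply/eqP; rewrite -subr_eq0 -normr_le0; apply/ler_addgt0Pl => e e0; rewrite addr0.
pose e1 := e / (2 * pi + 1).
have k0 : 0 < 2 * pi + 1 :> R by rewrite ltr_wpDl// mulr_ge0.
have e10 : 0 < e1 by rewrite divr_gt0.
have [d d0 hd] := cdiff_continuous (dF 0) e10.
have mw0 := modulus_ge0 w.
(* e^x |w| < d, by e^(-x) >= 1 - x. *)
pose x := - (modulus w / d).
have x0 : x <= 0 by rewrite oppr_le0 divr_ge0// ltW.
rewrite (same x x0).
have -> : 2 * pi * complex.Re (F 0) = segint (fun=> complex.Re (F 0)) (- pi) pi.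
  by rewrite segint_cst//; ring.
rewrite -segintB//; last by move=> y; exact: cvg_cst.
apply: (@le_trans _ _ (e1 * (pi - - pi))); last first.
  have -> : pi - - pi = 2 * pi :> R by ring.
  by rewrite /e1 mulrAC ler_pdivrMr// ler_wpM2l ?(ltW e0)// lerDl.
apply: segint_le => // [y|y _]; first by apply: cvgB; [exact: cU|exact: cvg_cst].
rewrite -raddfB; apply: le_trans (Re_le_modulus _) (ltW _); apply: hd.
rewrite subr0 modulusM modulus_cexp/=.
have ex : expR x * (1 + modulus w / d) <= 1.
  rewrite /x expRN mulrC ler_pdivrMr ?expR_gt0// mul1r.
  exact: expR_ge1Dx.
have [->|w0] := eqVneq (modulus w) 0; first by rewrite mul0r.
have {}w0 : 0 < modulus w by rewrite lt_neqAle eq_sym w0.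
have ed : expR x * (d + modulus w) <= d.
  have -> : expR x * (d + modulus w) = d * (expR x * (1 + modulus w / d)).
    by field; exact: lt0r_neq0.
  by rewrite ler_piMr// ltW.
have := expR_gt0 x; nra.
Qed.

End CircleMean.

(** * Integration over the plane *)

Section PlaneIntegral.
Context {R : realType}.
Local Notation C := R[i].
Local Notation plane := (measurableTypeR R * measurableTypeR R)%type.
Local Notation mu := (@dL R).
Local Notation leb := (@lebesgue_measure R).
Implicit Types (u v : C -> C) (g h : C -> R) (z w : C).

Definition rmeas g := measurable_fun setT (on_plane g).
Definition cmeas u := rmeas (fun z => complex.Re (u z)) /\ rmeas (fun z => complex.Im (u z)).
Definition rintble g := mu.-integrable setT (EFin \o on_plane g).
Definition cintble u :=
  rintble (fun z => complex.Re (u z)) /\ rintble (fun z => complex.Im (u z)).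
Definition Rint g : R := Rintegral mu setT (on_plane g).

Lemma rmeas_cst (k : R) : rmeas (fun=> k).
Proof. exact: measurable_cst. Qed.

Lemma rmeasD g h : rmeas g -> rmeas h -> rmeas (fun z => g z + h z).
Proof. by move=> mg mh; exact: (measurable_funD mg mh). Qed.

Lemma rmeasB g h : rmeas g -> rmeas h -> rmeas (fun z => g z - h z).
Proof. by move=> mg mh; exact: (measurable_funB mg mh). Qed.

Lemma rmeasM g h : rmeas g -> rmeas h -> rmeas (fun z => g z * h z).
Proof. by move=> mg mh; exact: (measurable_funM mg mh). Qed.

Lemma rmeas_comp (f : R -> R) g : measurable_fun setT f -> rmeas g ->
  rmeas (fun z => f (g z)).
Proof. by move=> mf mg; exact: (measurableT_comp mf mg). Qed.

Lemma rmeasN g : rmeas g -> rmeas (fun z => - g z).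
Proof. by move=> mg; apply: (rmeas_comp (f := -%R)). Qed.

Lemma rmeas_expR g : rmeas g -> rmeas (fun z => expR (g z)).
Proof. by move=> mg; apply: (rmeas_comp (f := expR)). Qed.

Lemma cmeas_cst (k : C) : cmeas (fun=> k).
Proof. by split; exact: rmeas_cst. Qed.

Lemma cmeasD u v : cmeas u -> cmeas v -> cmeas (fun z => u z + v z).
Proof.
move=> [ur ui] [vr vi]; split.
  have -> : (fun z => complex.Re (u z + v z)) =
    (fun z => complex.Re (u z) + complex.Re (v z)) by apply/funext => z; rewrite raddfD.
  exact: rmeasD.
have -> : (fun z => complex.Im (u z + v z)) =
    (fun z => complex.Im (u z) + complex.Im (v z)) by apply/funext => z; rewrite raddfD.
exact: rmeasD.
Qed.

Lemma complex_ReM z w : complex.Re (z * w) =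
  complex.Re z * complex.Re w - complex.Im z * complex.Im w.
Proof. by case: z w => a b []. Qed.

Lemma complex_ImM z w : complex.Im (z * w) =
  complex.Re z * complex.Im w + complex.Im z * complex.Re w.
Proof. by case: z w => a b []. Qed.

Lemma cmeasM u v : cmeas u -> cmeas v -> cmeas (fun z => u z * v z).
Proof.
move=> [ur ui] [vr vi]; split.
  under eq_fun do rewrite complex_ReM.
  by apply: rmeasB; exact: rmeasM.
under eq_fun do rewrite complex_ImM.
by apply: rmeasD; exact: rmeasM.
Qed.

Lemma cmeas_real g : rmeas g -> cmeas (fun z => (g z)%:C).
Proof. by move=> mg; split => //; exact: rmeas_cst. Qed.

Lemma cmeasN u : cmeas u -> cmeas (fun z => - u z).
Proof.
move=> mu'; have := cmeasM (cmeas_cst (-1)) mu'.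
by under eq_fun do rewrite mulN1r.
Qed.

Lemma cmeasB u v : cmeas u -> cmeas v -> cmeas (fun z => u z - v z).
Proof. by move=> mu' mv; exact: (cmeasD mu' (cmeasN mv)). Qed.

Lemma cmeasJ u : cmeas u -> cmeas (fun z => (u z)^*).
Proof.
have ReJ z : complex.Re z^* = complex.Re z by case: z.
have ImJ z : complex.Im z^* = - complex.Im z by case: z.
move=> [ur ui]; split; first by under eq_fun do rewrite ReJ.
by under eq_fun do rewrite ImJ; exact: rmeasN.
Qed.

Lemma rmeas_Re : rmeas (fun z => complex.Re z).
Proof. exact: measurable_fst. Qed.

Lemma rmeas_Im : rmeas (fun z => complex.Im z).
Proof. exact: measurable_snd. Qed.

Lemma cmeas_id : cmeas (fun z => z).
Proof. by split; [exact: rmeas_Re|exact: rmeas_Im]. Qed.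

Lemma cmeasX u n : cmeas u -> cmeas (fun z => u z ^+ n).
Proof.
move=> mu'; elim: n => [|n IH]; first exact: cmeas_cst.
by under eq_fun do rewrite exprS; exact: cmeasM.
Qed.

Lemma cmeas_sum n (F : nat -> C -> C) : (forall i, cmeas (F i)) ->
  cmeas (fun z => \sum_(i < n) F i z).
Proof.
move=> mF; elim: n => [|n IH].
  by under eq_fun do rewrite big_ord0; exact: cmeas_cst.
by under eq_fun do rewrite big_ord_recr/=; exact: cmeasD.
Qed.

Lemma rmeas_abs2 u : cmeas u -> rmeas (fun z => abs2 (u z)).
Proof.
by move=> [ur ui]; rewrite /abs2; apply: rmeasD; under eq_fun do rewrite expr2; exact: rmeasM.
Qed.

Lemma rmeas_modulus u : cmeas u -> rmeas (fun z => modulus (u z)).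
Proof.
move=> mu'; under eq_fun do rewrite modulusE.
apply: rmeas_comp; last exact: rmeas_abs2.
by apply: continuous_measurable_fun; exact: sqrt_continuous.
Qed.

Lemma cmeas_cexp u : cmeas u -> cmeas (fun z => cexp (u z)).
Proof.
move=> [ur ui]; rewrite /cexp; apply: cmeasM.
  by apply: cmeas_real; exact: rmeas_expR.
split => /=; apply: rmeas_comp => //; apply: continuous_measurable_fun.
  exact: continuous_cos.
exact: continuous_sin.
Qed.

Lemma measurable_plane_comp d (T : measurableType d) (f : C -> T) (phi : C -> C) :
  measurable_fun setT (on_plane f) -> cmeas phi ->
  measurable_fun setT (on_plane (f \o phi)).
Proof.
move=> mf [pr pi']; pose F (p : plane) : plane :=
  (complex.Re (phi (p.1 +i* p.2)), complex.Im (phi (p.1 +i* p.2))).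
have mF : measurable_fun setT F by apply/measurable_fun_pairP; split.
have -> : on_plane (f \o phi) = on_plane f \o F.
  by apply/funext => p; rewrite /on_plane /F/=; case: (phi _).
exact: (measurableT_comp mf mF).
Qed.

Lemma rmeas_plane_comp g (phi : C -> C) : rmeas g -> cmeas phi ->
  rmeas (fun z => g (phi z)).
Proof. exact: measurable_plane_comp. Qed.

Lemma cmeas_plane_comp u (phi : C -> C) : cmeas u -> cmeas phi ->
  cmeas (fun z => u (phi z)).
Proof.
by move=> [ur ui] mphi; split;
  [exact: rmeas_plane_comp ur mphi|exact: rmeas_plane_comp ui mphi].
Qed.

(** ** Integrable functions *)

Lemma rintble_meas g : rintble g -> rmeas g.
Proof. by move=> /integrableP[/measurable_EFinP]. Qed.

Lemma cintble_meas u : cintble u -> cmeas u.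
Proof. by move=> [ur ui]; split; exact: rintble_meas. Qed.

Lemma rintble_le g h : rmeas g -> (forall z, `|g z| <= h z) -> rintble h -> rintble g.
Proof.
move=> mg gh; apply: le_integrable => //; first exact/measurable_EFinP.
move=> p _; rewrite /= lee_fin; apply: le_trans (gh _) _; exact: ler_norm.
Qed.

Lemma cintble_le u h : cmeas u -> (forall z, modulus (u z) <= h z) -> rintble h ->
  cintble u.
Proof.
move=> [ur ui] uh ih; split.
  by apply: rintble_le ih => // z; apply: le_trans (Re_le_modulus _) (uh z).
by apply: rintble_le ih => // z; apply: le_trans (Im_le_modulus _) (uh z).
Qed.

Lemma rintble_norm g : rintble g -> rintble (fun z => `|g z|).
Proof. exact: integrable_norm. Qed.

Lemma RintE g : rintble g -> (\int[mu]_p (on_plane g p)%:E)%E = (Rint g)%:E.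
Proof.
move=> ig; rewrite /Rint /Rintegral fineK//.
exact: (integrable_fin_num measurableT ig).
Qed.

Lemma rintbleD g h : rintble g -> rintble h -> rintble (fun z => g z + h z).
Proof. by move=> ig ih; exact: (integrableD measurableT ig ih). Qed.

Lemma rintbleZ (k : R) g : rintble g -> rintble (fun z => k * g z).
Proof. by move=> ig; exact: (integrableZl measurableT k ig). Qed.

Lemma rintbleB g h : rintble g -> rintble h -> rintble (fun z => g z - h z).
Proof. by move=> ig ih; exact: (integrableB measurableT ig ih). Qed.

Lemma cintbleD u v : cintble u -> cintble v -> cintble (fun z => u z + v z).
Proof.
move=> [ur ui] [vr vi]; split; under eq_fun do rewrite raddfD/=; exact: rintbleD.
Qed.

Lemma cintbleZ (k : C) u : cintble u -> cintble (fun z => k * u z).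
Proof.
move=> [ur ui]; split.
  by under eq_fun do rewrite complex_ReM; apply: rintbleB; exact: rintbleZ.
by under eq_fun do rewrite complex_ImM; apply: rintbleD; exact: rintbleZ.
Qed.

Lemma RintD g h : rintble g -> rintble h -> Rint (fun z => g z + h z) = Rint g + Rint h.
Proof. by move=> ig ih; exact: (RintegralD measurableT ig ih). Qed.

Lemma RintB g h : rintble g -> rintble h -> Rint (fun z => g z - h z) = Rint g - Rint h.
Proof. by move=> ig ih; exact: (RintegralB measurableT ig ih). Qed.

Lemma RintZ k g : rintble g -> Rint (fun z => k * g z) = k * Rint g.
Proof. by move=> ig; rewrite /Rint /on_plane -RintegralZl. Qed.

Lemma Rint_ge0 g : (forall z, 0 <= g z) -> 0 <= Rint g.
Proof. by move=> g0; apply: Rintegral_ge0 => p _; exact: g0. Qed.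

Lemma Rint_le g h : rintble g -> rintble h -> (forall z, g z <= h z) -> Rint g <= Rint h.
Proof. by move=> ig ih gh; apply: le_Rintegral => // p _; exact: gh. Qed.

Lemma CintegralE u : Cintegral u =
  Rint (fun z => complex.Re (u z)) +i* Rint (fun z => complex.Im (u z)).
Proof. by []. Qed.

Lemma CintegralD u v : cintble u -> cintble v ->
  Cintegral (fun z => u z + v z) = Cintegral u + Cintegral v.
Proof.
move=> [ur ui] [vr vi]; apply: complex_eq; rewrite !CintegralE/= -RintD//;
  by congr Rint; apply/funext => z; rewrite raddfD.
Qed.

Lemma CintegralZ (k : C) u : cintble u ->
  Cintegral (fun z => k * u z) = k * Cintegral u.
Proof.
move=> [ur ui]; apply: complex_eq; rewrite !CintegralE ?complex_ReM ?complex_ImM/=.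
  rewrite -!RintZ// -RintB//; [|exact: rintbleZ..].
  by congr Rint; apply/funext => z; rewrite complex_ReM.
rewrite -!RintZ// -RintD//; [|exact: rintbleZ..].
by congr Rint; apply/funext => z; rewrite complex_ImM.
Qed.

Lemma CintegralB u v : cintble u -> cintble v ->
  Cintegral (fun z => u z - v z) = Cintegral u - Cintegral v.
Proof.
move=> iu iv; have := CintegralD iu (cintbleZ (-1) iv).
by rewrite CintegralZ// mulN1r; under eq_fun do rewrite mulN1r.
Qed.

Lemma cintble0 : cintble (fun=> 0).
Proof. by split; exact: integrable0. Qed.

Lemma Cintegral0 : Cintegral (fun=> 0 : C) = 0.
Proof. by rewrite CintegralE /Rint /on_plane /Rintegral !integral0. Qed.

Lemma cintble_sum n (F : nat -> C -> C) : (forall i, (i < n)%N -> cintble (F i)) ->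
  cintble (fun z => \sum_(i < n) F i z).
Proof.
elim: n => [|n IH] iF.
  by under eq_fun do rewrite big_ord0; exact: cintble0.
under eq_fun do rewrite big_ord_recr/=; apply: cintbleD; last exact: iF.
by apply: IH => i ni; apply: iF; exact: ltnW.
Qed.

Lemma Cintegral_sum n (F : nat -> C -> C) : (forall i, (i < n)%N -> cintble (F i)) ->
  Cintegral (fun z => \sum_(i < n) F i z) = \sum_(i < n) Cintegral (F i).
Proof.
elim: n => [|n IH] iF.
  by rewrite big_ord0; under eq_fun do rewrite big_ord0; exact: Cintegral0.
have iF' i : (i < n)%N -> cintble (F i) by move=> ni; apply: iF; exact: ltnW.
under eq_fun do rewrite big_ord_recr/=.
by rewrite CintegralD ?IH ?big_ord_recr//; [exact: cintble_sum|exact: iF].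
Qed.

Lemma cvg_of_le (a e : nat -> R) (l : R) : (forall n, `|a n - l| <= e n) ->
  e @ \oo --> (0 : R) -> a @ \oo --> l.
Proof.
move=> ae e0; apply/cvgrPdist_lt => d d0; move/cvgrPdist_lt : e0 => /(_ d d0).
apply: filterS => n; rewrite sub0r normrN distrC => h.
by apply: le_lt_trans (ae n) _; apply: le_lt_trans (ler_norm _) h.
Qed.

(** Convergence is stated through the modulus, which keeps the limits in R. *)
Lemma Cintegral_dominated (U : nat -> C -> C) u h : (forall n, cmeas (U n)) -> cmeas u ->
  (forall z, (fun n => modulus (U n z - u z)) @ \oo --> (0 : R)) ->
  rintble h -> (forall n z, modulus (U n z) <= h z) ->
  cintble u /\ (fun n => modulus (Cintegral (U n) - Cintegral u)) @ \oo --> (0 : R).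
Proof.
move=> mU mu' Uu ih Uh.
have dom (part : C -> R) : (forall z w, part z - part w = part (z - w)) ->
    (forall z, `|part z| <= modulus z) ->
    (forall n, rmeas (fun z => part (U n z))) -> rmeas (fun z => part (u z)) ->
    rintble (fun z => part (u z)) /\
    (fun n => Rint (fun z => part (U n z))) @ \oo --> Rint (fun z => part (u z)).
  move=> pB ple mpU mpu.
  pose f_ n := EFin \o on_plane (fun z => part (U n z)).
  pose f := EFin \o on_plane (fun z => part (u z)).
  have mf_ n : measurable_fun setT (f_ n) by apply/measurable_EFinP; exact: mpU.
  have mf : measurable_fun setT f by apply/measurable_EFinP.
  have ff : {ae mu, forall p, setT p -> f_ ^~ p @ \oo --> f p}.
    apply: aeW => p _; apply: cvg_EFin; first by near=> n.
    apply: (cvg_of_le (e := fun n => modulus (U n (p.1 +i* p.2) - u (p.1 +i* p.2)))).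
      by move=> n; rewrite /= /on_plane pB; exact: ple.
    exact: Uu.
  have fh : {ae mu, forall p n, setT p -> (`|f_ n p| <= (EFin \o on_plane h) p)%E}.
    by apply: aeW => p n _; rewrite /= lee_fin; apply: le_trans (ple _) (Uh _ _).
  have [iu _ cv] := dominated_convergence measurableT mf_ mf ff ih fh.
  split; first exact: iu.
  rewrite /Rint /Rintegral; apply: fine_cvg; rewrite fineK; first exact: cv.
  exact: integrable_fin_num.
have ReB z w : complex.Re z - complex.Re w = complex.Re (z - w) by rewrite raddfB.
have ImB z w : complex.Im z - complex.Im w = complex.Im (z - w) by rewrite raddfB.
have [ir cr] := dom (@complex.Re R) ReB (@Re_le_modulus R) (fun n => (mU n).1) mu'.1.
have [ii ci] := dom (@complex.Im R) ImB (@Im_le_modulus R) (fun n => (mU n).2) mu'.2.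
split=> //.
pose e n := `|Rint (fun z => complex.Re (U n z)) - Rint (fun z => complex.Re (u z))| +
  `|Rint (fun z => complex.Im (U n z)) - Rint (fun z => complex.Im (u z))|.
apply: (cvg_of_le (e := e)).
  move=> n; rewrite subr0 ger0_norm ?modulus_ge0//.
  by apply: le_trans (modulus_le _) _; rewrite !raddfB.
have dist0 (a : nat -> R) l : a @ \oo --> l -> (fun n => `|a n - l|) @ \oo --> (0 : R).
  move=> al; have -> : (0 : R) = `|l - l| by rewrite subrr normr0.
  by apply: cvg_norm; apply: cvgB => //; exact: cvg_cst.
have -> : (0 : R) = 0 + 0 by rewrite addr0.
by apply: cvgD; apply: dist0.
Unshelve. all: by end_near. Qed.

(** ** Measure-preserving maps of the plane *)

Lemma ge0_integral_translation (a : R) (f : R -> \bar R) :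
  measurable_fun setT f -> (forall x, (0 <= f x)%E) ->
  (\int[leb]_x f (x + a)%R = \int[leb]_x f x)%E.
Proof.
move=> mf f0.
pose phi : measurableTypeR R -> measurableTypeR R := fun x => x + a.
have mphi : measurable_fun setT phi by exact: measurable_funD.
have := @ge0_integral_pushforward _ _ _ _ _ _ mphi leb setT f measurableT mf (fun x _ => f0 x).
rewrite preimage_setT => <-; apply: eq_measure_integral => A mA _ /=.
apply/esym; apply: lebesgue_measure_unique => //= _ [[c d]] _ <-.
rewrite /pushforward (_ : phi @^-1` _ = `]c - a, d - a]%classic); last first.
  by apply/seteqP; split => x /=; rewrite !in_itv/= /phi ltrBlDr lerBrDr.
rewrite !lebesgue_measure_itv/= !lte_fin ltrD2r.
by case: ifPn => // _; rewrite -!EFinD; congr EFin; ring.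
Qed.

Definition preserving (phi : C -> C) := cmeas phi /\
  forall f : C -> \bar R, measurable_fun setT (on_plane f) ->
  (forall z, (0 <= f z)%E) ->
  (\int[mu]_p on_plane (f \o phi) p = \int[mu]_p on_plane f p)%E.

Lemma preserving_comp phi psi : preserving phi -> preserving psi ->
  preserving (phi \o psi).
Proof.
move=> [mphi hphi] [mpsi hpsi]; split; first exact: cmeas_plane_comp.
move=> f mf f0; rewrite -(hphi f)// -(hpsi (f \o phi))//.
  exact: measurable_plane_comp.
by move=> z; exact: f0.
Qed.

(** A shear translates each vertical line, so Tonelli reduces it to the
    translation invariance of the line. *)
Lemma preserving_shear_v (g : R -> R) : measurable_fun setT g ->
  preserving (fun z => complex.Re z +i* (complex.Im z + g (complex.Re z))).
Proof.
move=> mg.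
have mphi : cmeas (fun z => complex.Re z +i* (complex.Im z + g (complex.Re z))).
  split=> /=; first exact: rmeas_Re.
  by apply: rmeasD; [exact: rmeas_Im|apply: rmeas_comp => //; exact: rmeas_Re].
split=> // f mf f0; rewrite /dL.
rewrite (fubini_tonelli1 (on_plane f)) => [|//|p]; last exact: f0.
rewrite fubini_tonelli1 => [||p]; [|exact: measurable_plane_comp|exact: f0].
apply: eq_integral => x _; rewrite /fubini_F.
apply: (ge0_integral_translation (g x) (f := fun y => f (x +i* y))) => //.
exact: (measurable_fun_pair2 (x : measurableTypeR R) mf).
Qed.

Lemma preserving_shear_h (g : R -> R) : measurable_fun setT g ->
  preserving (fun z => (complex.Re z + g (complex.Im z)) +i* complex.Im z).
Proof.
move=> mg.
have mphi : cmeas (fun z => (complex.Re z + g (complex.Im z)) +i* complex.Im z).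
  split=> /=; last exact: rmeas_Im.
  by apply: rmeasD; [exact: rmeas_Re|apply: rmeas_comp => //; exact: rmeas_Im].
split=> // f mf f0; rewrite /dL.
rewrite (fubini_tonelli2 (on_plane f)) => [|//|p]; last exact: f0.
rewrite fubini_tonelli2 => [||p]; [|exact: measurable_plane_comp|exact: f0].
apply: eq_integral => y _; rewrite /fubini_G.
apply: (ge0_integral_translation (g y) (f := fun x => f (x +i* y))) => //.
exact: (measurable_fun_pair1 (y : measurableTypeR R) mf).
Qed.

Lemma preserving_translation w : preserving (fun z => z + w).
Proof.
case: w => a b.
have h := preserving_comp (preserving_shear_v (measurable_cst (b : R)))
  (preserving_shear_h (measurable_cst (a : R))).
have -> : (fun z => z + (a +i* b)) =
  (fun z => complex.Re z +i* (complex.Im z + cst b (complex.Re z))) \o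
  (fun z => (complex.Re z + cst a (complex.Im z)) +i* complex.Im z) by apply/funext; case.
exact: h.
Qed.

(** A rotation is a product of three shears, except for the half turn, which is
    the square of a quarter turn. *)
Lemma preserving_rotation w : abs2 w = 1 -> preserving (fun z => w * z).
Proof.
have main (a b : R) : a ^+ 2 + b ^+ 2 = 1 -> a != -1 ->
    preserving (fun z => (a +i* b) * z).
  (* For w = e^(i th), t is tan (th / 2); it is infinite at the half turn. *)
  move=> ab a1; pose t := b / (1 + a).
  have a0 : 1 + a != 0 by rewrite addrC addr_eq0.
  have ml (k : R) : measurable_fun [set: R] (fun y => k * y) by exact: measurable_funM.
  have := preserving_comp (preserving_shear_h (ml (- t)))
   (preserving_comp (preserving_shear_v (ml b)) (preserving_shear_h (ml (- t)))).
  congr preserving; apply/funext => -[x y] /=.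
  have tb : t * b = 1 - a.
    have -> : t * b = b ^+ 2 / (1 + a) by rewrite /t; field.
    by rewrite -(addKr (a ^+ 2) (b ^+ 2)) ab; field.
  have ta : t * (1 + a) = b by rewrite /t divfK.
  apply: complex_eq => /=.
    have -> : x + - t * y + - t * (y + b * (x + - t * y)) =
      x - (t * b) * x - t * y * (1 + (1 - t * b)) by ring.
    rewrite tb -[in RHS]ta; ring.
  have -> : y + b * (x + - t * y) = y + b * x - (t * b) * y by ring.
  by rewrite tb; ring.
case: w => a b /= ab; have [a1|] := eqVneq a (-1); last exact: main.
have b0 : b = 0.
  by move: ab; rewrite /abs2 /= a1 sqrrN expr1n -[RHS]addr0 => /addrI/eqP;
    rewrite sqrf_eq0 => /eqP.
have q : preserving (fun z => (0 +i* 1) * z).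
  by apply: main; rewrite ?expr0n ?expr1n ?add0r// eq_sym oppr_eq0 oner_eq0.
have := preserving_comp q q; congr preserving; apply/funext => -[x y] /=.
by rewrite a1 b0; apply: complex_eq => /=; ring.
Qed.

Lemma rint_preserving phi g : preserving phi -> rintble g ->
  rintble (fun z => g (phi z)) /\ Rint (fun z => g (phi z)) = Rint g.
Proof.
move=> [mphi hphi] ig; have mg := rintble_meas ig; split.
  apply/integrableP; split; first by apply/measurable_EFinP; exact: rmeas_plane_comp.
  have /integrableP[_] := ig.
  rewrite -[X in (X < +oo)%E -> _](hphi (fun z => `|(g z)%:E|%E))//.
  by do 2 apply: measurableT_comp => //; exact/measurable_EFinP.
have mE : measurable_fun setT (EFin \o on_plane g) by exact/measurable_EFinP.
rewrite /Rint /Rintegral; congr fine; rewrite [LHS]integralE [RHS]integralE; congr (_ - _)%E.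
  under eq_integral do rewrite funeposE.
  under [RHS]eq_integral do rewrite funeposE.
  apply: (hphi (fun z => maxe (g z)%:E 0%E)) => [|z]; last by rewrite le_max lexx orbT.
  rewrite (_ : on_plane _ = ((EFin \o on_plane g)^\+)%E); first exact: measurable_funepos.
  by apply/funext => p; rewrite funeposE.
under eq_integral do rewrite funenegE.
under [RHS]eq_integral do rewrite funenegE.
apply: (hphi (fun z => maxe (- (g z)%:E)%E 0%E)) => [|z]; last by rewrite le_max lexx orbT.
rewrite (_ : on_plane _ = ((EFin \o on_plane g)^\-)%E); first exact: measurable_funeneg.
by apply/funext => p; rewrite funenegE.
Qed.

Lemma cint_preserving phi u : preserving phi -> cintble u ->
  cintble (fun z => u (phi z)) /\ Cintegral (fun z => u (phi z)) = Cintegral u.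
Proof.
move=> pphi [ur ui]; have [ir er] := rint_preserving pphi ur.
by have [ii ei] := rint_preserving pphi ui; split=> //; rewrite !CintegralE er ei.
Qed.

(** ** Gaussian weights *)

Lemma ge0_integral_gauss (a : R) : 0 < a ->
  (\int[leb]_x (expR (- a * x ^+ 2))%:E = (Num.sqrt (pi / a))%:E)%E.
Proof.
move=> a0; pose s : R := Num.sqrt ((2 * a)^-1).
have a20 : 0 < (2 * a)^-1 by rewrite invr_gt0 mulr_gt0.
have s0 : s != 0 by rewrite lt0r_neq0// sqrtr_gt0.
have ss : s ^+ 2 = (2 * a)^-1 by rewrite sqr_sqrtr// ltW.
have pk : normal_peak s = (Num.sqrt (pi / a))^-1.
  rewrite /normal_peak ss; congr (Num.sqrt _)^-1; rewrite -mulr_natl; field.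
  exact: lt0r_neq0.
have pk0 : Num.sqrt (pi / a) != 0.
  by rewrite lt0r_neq0// sqrtr_gt0 divr_gt0// pi_gt0.
have := integral_normal_pdf 0 s.
under eq_integral do rewrite normal_pdfE// EFinM.
rewrite ge0_integralZl//=; last 3 first.
- by apply/measurable_EFinP; exact: measurable_normal_fun.
- by move=> x _; rewrite lee_fin normal_fun_ge0.
- by rewrite lee_fin normal_peak_ge0.
under eq_integral => x _.
  have -> : normal_fun 0 s x = expR (- a * x ^+ 2).
    rewrite /normal_fun ss subr0; congr expR; rewrite -mulr_natl; field.
    exact: lt0r_neq0.
  over.
move=> h; have : ((Num.sqrt (pi / a))%:E * (normal_peak s)%:E *
   \int[leb]_x (expR (- a * x ^+ 2))%:E = (Num.sqrt (pi / a))%:E)%E.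
  by rewrite -muleA h mule1.
by rewrite -EFinM pk mulfV// mul1e.
Qed.

Definition gaussian (a : R) z : R := expR (- a * abs2 z).

Lemma rmeas_gaussian a : rmeas (gaussian a).
Proof.
apply: rmeas_expR; apply: rmeasM; first exact: rmeas_cst.
exact: rmeas_abs2 cmeas_id.
Qed.

Lemma ge0_integral_gaussian (a : R) : 0 < a ->
  (\int[mu]_p (on_plane (gaussian a) p)%:E = (pi / a)%:E)%E.
Proof.
move=> a0; rewrite /dL fubini_tonelli1; last 2 first.
- by apply/measurable_EFinP; exact: rmeas_gaussian.
- by move=> p; rewrite lee_fin expR_ge0.
have mg : measurable_fun setT (fun x : R => expR (- a * x ^+ 2)).
  apply: measurableT_comp => //; exact: measurable_funM.
transitivity (\int[leb]_x ((expR (- a * x ^+ 2))%:E * (Num.sqrt (pi / a))%:E)%E)%E.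
  apply: eq_integral => x _; rewrite /fubini_F -ge0_integral_gauss//.
  rewrite -ge0_integralZl//; last exact/measurable_EFinP.
  by apply: eq_integral => y _; rewrite -EFinM -expRD -mulrDr.
rewrite ge0_integralZr//; last exact/measurable_EFinP.
by rewrite ge0_integral_gauss// -EFinM -expr2 sqr_sqrtr// divr_ge0 ?pi_ge0// ltW.
Qed.

Lemma rintble_gaussian (a : R) : 0 < a -> rintble (gaussian a).
Proof.
move=> a0; apply/integrableP; split.
  by apply/measurable_EFinP; exact: rmeas_gaussian.
under eq_integral => p _ do rewrite gee0_abs ?lee_fin ?expR_ge0//.
by rewrite [ltLHS]ge0_integral_gaussian ?ltry.
Qed.

Lemma Rint_gaussian (a : R) : 0 < a -> Rint (gaussian a) = pi / a.
Proof. by move=> a0; rewrite /Rint /Rintegral ge0_integral_gaussian. Qed.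

(** Any growth of exponential type is absorbed by half of the Gaussian. *)
Lemma rintble_gaussian_exp (a b K : R) : 0 < a ->
  rintble (fun z => K * expR (- a * abs2 z + b * modulus z)).
Proof.
move=> a0; apply: rintbleZ.
apply: (@rintble_le _ (fun z => expR (b ^+ 2 / (2 * a)) * gaussian (a / 2) z)).
- apply: rmeas_expR; apply: rmeasD; apply: rmeasM; try exact: rmeas_cst.
    exact: rmeas_abs2 cmeas_id.
  exact: rmeas_modulus cmeas_id.
- move=> z; rewrite ger0_norm ?expR_ge0// /gaussian -expRD ler_expR -modulus_sqr.
  rewrite -subr_ge0.
  have -> : b ^+ 2 / (2 * a) + - (a / 2) * modulus z ^+ 2 -
     (- a * modulus z ^+ 2 + b * modulus z) = (b - a * modulus z) ^+ 2 / (2 * a).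
    by field; exact: lt0r_neq0.
  by rewrite divr_ge0 ?sqr_ge0// mulr_ge0// ltW.
- by apply: rintbleZ; apply: rintble_gaussian; rewrite divr_gt0.
Qed.

End PlaneIntegral.

(** * Gaussian means of entire functions *)

Section GaussianMean.
Context {R : realType}.
Local Notation C := R[i].
Local Notation plane := (measurableTypeR R * measurableTypeR R)%type.
Local Notation leb := (@lebesgue_measure R).
Implicit Types (F u : C -> C) (w z p : C).

Lemma dL_sigma_finite : sigma_finite setT (leb \x leb)%E.
Proof.
have /sigma_finiteP[F [TF ndF Foo]] := sigma_finiteT leb.
exists (fun n => F n `*` F n).
  rewrite -setXTT TF predeqE => -[x y]; split.
    move=> [/= [n _ Fnx] [k _ Fky]]; exists (maxn n k) => //; split.
      by move: x Fnx; exact/subsetPset/ndF/leq_maxl.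
    by move: y Fky; exact/subsetPset/ndF/leq_maxr.
  by move=> [n _ []/= ? ?]; split; exists n.
move=> k; have [? ?] := Foo k.
split; first exact: measurableX.
by rewrite product_measure1E// lte_mul_pinfty// ge0_fin_numE.
Qed.
(** Fubini for signed integrands asks for a sigma-finite measure. *)
Definition sigma_finite_dL : {sigma_finite_measure set plane -> \bar R} := HB.pack (leb \x leb)%E (Measure_isSigmaFinite.Build _ _ _ ((leb \x leb)%E) dL_sigma_finite).

Definition cis (t : R) : C := cexp (0 +i* t).

Lemma cisE t : cis t = cos t +i* sin t.
Proof. by rewrite /cis /cexp /= expR0; apply: complex_eq => /=; ring. Qed.

Lemma abs2_cis t : abs2 (cis t) = 1.
Proof. by rewrite cisE /abs2 /= cos2Dsin2. Qed.

Lemma circle_continuous F w : (forall p, cdiff F p) ->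
  continuous (fun t : R => complex.Re (F (w * cis t))).
Proof.
move=> dF; have hg (y y' : R) : modulus ((0 +i* y) - (0 +i* y')) = `|y - y'|.
  by rewrite modulusE /abs2 /= subrr expr0n add0r sqrtr_sqr.
have partR z p : `|complex.Re z - complex.Re p| <= modulus (z - p).
  by rewrite -raddfB; exact: Re_le_modulus.
have dh p : cdiff (fun z => F (w * cexp z)) p.
  have -> : (fun z => F (w * cexp z)) = F \o ((fun z => w * z + 0) \o cexp).
    by apply/funext => z; rewrite /= addr0.
  by apply: cdiff_comp => //; apply: cdiff_comp; [exact: cdiff_cexp|exact: cdiff_affine].
exact: (@cdiff_continuous_coord R _ (@complex.Re R) (fun y => 0 +i* y) dh partR hg).
Qed.

Lemma gaussian_cis a t z : gaussian a (cis t * z) = gaussian a z.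
Proof. by rewrite /gaussian abs2M abs2_cis mul1r. Qed.

Let D := `[- pi, pi]%classic : set R.

Let lebD : (leb D = (2 * pi)%:E)%E.
Proof.
rewrite /D lebesgue_measure_itv/= lte_fin.
have p0 : 0 < pi :> R := pi_gt0 R.
by rewrite ifT ?EFinN -?EFinD; [congr EFin; ring|lra].
Qed.

(** The Gaussian integral is invariant under rotations, so it equals its average
    over them; after exchanging the two integrals the inner one is the mean of F
    over a circle. *)
Lemma Rint_gaussian_mean (a : R) F : 0 < a -> (forall p, cdiff F p) ->
  rintble (fun z => gaussian a z * complex.Re (F z)) ->
  Rint (fun z => gaussian a z * complex.Re (F z)) = pi / a * complex.Re (F 0).
Proof.
move=> a0 dF iG.
have p0 : 0 < pi :> R := pi_gt0 R.
pose G (t : R) z := gaussian a z * complex.Re (F (cis t * z)).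
have GE t : (fun z => G t z) = (fun z => gaussian a (cis t * z) * complex.Re (F (cis t * z))).
  by apply/funext => z; rewrite gaussian_cis.
have iGt t : rintble (G t) /\ Rint (G t) = Rint (fun z => gaussian a z * complex.Re (F z)).
  rewrite -[G t]/(fun z => G t z) GE.
  exact: rint_preserving (preserving_rotation (abs2_cis t)) iG.
have iGn t : Rint (fun z => `|G t z|) = Rint (fun z => `|gaussian a z * complex.Re (F z)|).
  have := (rint_preserving (preserving_rotation (abs2_cis t)) (rintble_norm iG)).2.
  by move=> <-; congr Rint; apply/funext => z; rewrite /= gaussian_cis.
pose k (q : measurableTypeR R * plane) : \bar R :=
  (\1_D q.1 * on_plane (G q.1) q.2)%:E.
have mF : rmeas (fun z => complex.Re (F z)).
  have -> : (fun z => complex.Re (F z)) =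
      (fun z => (gaussian a z)^-1 * (gaussian a z * complex.Re (F z))).
    by apply/funext => z; rewrite mulrA mulVf ?mul1r// gt_eqF// expR_gt0.
  apply: rmeasM; last exact: rintble_meas.
  have -> : (fun z => (gaussian a z)^-1) = (fun z => expR (a * abs2 z)).
    by apply/funext => z; rewrite /gaussian -expRN mulNr opprK.
  apply: rmeas_expR; apply: rmeasM; [exact: rmeas_cst|exact: rmeas_abs2 cmeas_id].
have mk : measurable_fun setT k.
  apply/measurable_EFinP; apply: measurable_funM.
    have mI : measurable_fun [set: measurableTypeR R] (\1_D : measurableTypeR R -> R).
      by apply: measurable_indic; exact: measurable_itv.
    exact: (measurableT_comp mI measurable_fst).
  apply: measurable_funM.
    exact: (measurableT_comp (rmeas_gaussian a) measurable_snd).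
  pose f (q : measurableTypeR R * plane) : plane :=
    (cos q.1 * q.2.1 - sin q.1 * q.2.2, cos q.1 * q.2.2 + sin q.1 * q.2.1).
  have m1 : measurable_fun setT (fun q : measurableTypeR R * plane => q.1) by exact: measurable_fst.
  have m2 : measurable_fun setT (fun q : measurableTypeR R * plane => q.2.1).
    exact: (measurableT_comp measurable_fst measurable_snd).
  have m3 : measurable_fun setT (fun q : measurableTypeR R * plane => q.2.2).
    exact: (measurableT_comp measurable_snd measurable_snd).
  have mc : measurable_fun setT (fun q : measurableTypeR R * plane => cos q.1).
    by apply: (measurableT_comp _ m1); apply: continuous_measurable_fun; exact: continuous_cos.
  have ms : measurable_fun setT (fun q : measurableTypeR R * plane => sin q.1).
    by apply: (measurableT_comp _ m1); apply: continuous_measurable_fun; exact: continuous_sin.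
  have mf : measurable_fun setT f.
    apply/measurable_fun_pairP; split.
      exact: (measurable_funB (measurable_funM mc m2) (measurable_funM ms m3)).
    exact: (measurable_funD (measurable_funM mc m3) (measurable_funM ms m2)).
  have := measurableT_comp mF mf; congr measurable_fun; apply/funext => q.
  by rewrite /on_plane /f/= cisE.
have indD (f : R -> R) : (\int[leb]_t (\1_D t * f t)%:E = \int[leb]_(t in D) (f t)%:E)%E.
  rewrite [RHS]integral_mkcond; apply: eq_integral => t _.
  by rewrite patchE indicE; case: ifP => _; rewrite ?mul1r ?mul0r.
have intD (c : R) : (\int[leb]_t (\1_D t * c)%:E = (2 * pi * c)%:E)%E.
  rewrite indD; have := @integral_cst _ _ _ leb D (measurable_itv _) c%:E.
  by rewrite /= => ->; rewrite [X in (_ * X)%E]lebD -EFinM mulrC.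
have fin : (\int[leb]_t \int[sigma_finite_dL]_p `|k (t, p)| < +oo)%E.
  rewrite (eq_integral (fun t : measurableTypeR R => (\1_D t * Rint (fun z => `|gaussian a z * complex.Re (F z)|))%:E)).
    by rewrite intD ltry.
  move=> t _; rewrite -(iGn t).
  have iGt' := rintble_norm (iGt t).1.
  rewrite -RintZ// -RintE; last exact: rintbleZ.
  apply: eq_integral => p _; rewrite /k /on_plane /= normrM; congr (_ * _)%:E.
  by rewrite ger0_norm// indicE; case: (_ \in _).
have ik := proj2 (@integrable12ltyP _ _ _ _ R leb sigma_finite_dL k mk) fin.
have := @Fubini _ _ _ _ _ leb sigma_finite_dL k ik.
rewrite (eq_integral (fun t : measurableTypeR R => (\1_D t * Rint (fun z => gaussian a z * complex.Re (F z)))%:E)); last first.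
  move=> t _; rewrite -(iGt t).2 -RintZ ?(iGt t).1// -RintE; last first.
    exact: rintbleZ (iGt t).1.
  by apply: eq_integral => p _.
rewrite intD.
rewrite [RHS](eq_integral (fun p : plane => (on_plane (fun z => 2 * pi * complex.Re (F 0) * gaussian a z) p)%:E)); last first.
  move=> p _; rewrite /k /= indD /on_plane /=; set z := _ +i* _.
  have cF : continuous (fun t : R => complex.Re (F (cis t * z))).
    have -> : (fun t : R => complex.Re (F (cis t * z))) =
       (fun t => complex.Re (F (z * cis t))) by apply/funext => t; rewrite mulrC.
    exact: circle_continuous.
  have iF := segint_integrable (- pi) pi cF.
  have hs : (\int[leb]_(t in D) (complex.Re (F (cis t * z)))%:E =
      (2 * pi * complex.Re (F 0))%:E)%E.
    rewrite -(circle_mean z dF) /segint /Rintegral fineK.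
      by apply: eq_integral => t _; rewrite mulrC.
    have := @integrable_fin_num _ _ _ leb D (measurable_itv _) _ iF.
    by congr (_ \is a fin_num); apply: eq_integral => t _; rewrite /= mulrC.
  rewrite /G; under eq_integral do rewrite EFinM.
  rewrite (@integralZl _ _ _ leb D (measurable_itv _) _ iF).
  by rewrite [X in (_ * X)%E]hs -EFinM mulrC.
move=> h; move: h; rewrite RintE; last by apply: rintbleZ; exact: rintble_gaussian.
rewrite RintZ ?Rint_gaussian//; last exact: rintble_gaussian.
move=> [h]; have h2 : 2 * pi != 0 :> R by rewrite mulf_neq0 ?lt0r_neq0.
by apply: (mulfI h2); rewrite h; ring.
Qed.

End GaussianMean.

(** * The reproducing formula and orthogonality of monomials *)

Section Reproducing.
Context {R : realType}.
Local Notation C := R[i].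
Implicit Types (f F u : C -> C) (w z p : C) (a b : R).

Lemma cmeas_gaussian a : cmeas (fun w : C => (gaussian a w)%:C).
Proof. by apply: cmeas_real; exact: rmeas_gaussian. Qed.

Lemma modulus_gaussianM a w (x : C) : modulus ((gaussian a w)%:C * x) = gaussian a w * modulus x.
Proof. by rewrite modulusM modulus_real ger0_norm ?expR_ge0. Qed.

Lemma gaussianD a b w : gaussian (a + b) w = gaussian a w * gaussian b w.
Proof. by rewrite /gaussian -expRD; congr expR; ring. Qed.

Lemma abs2N (z : C) : abs2 (- z) = abs2 z.
Proof. by case: z => x y; rewrite /abs2 /=; ring. Qed.

Lemma gaussian_mean a F : 0 < a -> (forall p, cdiff F p) ->
  cintble (fun w => (gaussian a w)%:C * F w) ->
  Cintegral (fun w => (gaussian a w)%:C * F w) = (pi / a)%:C * F 0.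
Proof.
move=> a0 dF [iR iI].
have ER : (fun w => complex.Re ((gaussian a w)%:C * F w)) =
  (fun w => gaussian a w * complex.Re (F w)) by apply/funext => w; rewrite ReZ.
have dG p : cdiff (fun w => (0 -i* 1) * F w) p.
  apply: cdiff_mul => //; have := @cdiff_affine R 0 (0 -i* 1) p.
  by congr cdiff; apply/funext => z; rewrite mul0r add0r.
have EI : (fun w => complex.Im ((gaussian a w)%:C * F w)) =
    (fun w => gaussian a w * complex.Re ((0 -i* 1) * F w)).
  by apply/funext => w; rewrite ImZ complex_ReM /=; ring.
rewrite CintegralE ER EI !Rint_gaussian_mean//; last 2 first.
- by rewrite -EI.
- by rewrite -ER.
by apply: complex_eq; rewrite ?ReZ ?ImZ ?complex_ReM/=; ring.
Qed.

(** The reproducing formula is the mean value property for the entire function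
    [w |-> f (z + w) * exp (- a * conj z * w)], recentred at [z]. *)
Lemma reproducing a f z : 0 < a -> (forall p, cdiff f p) ->
  cintble (fun w => cexp (a%:C * (w^* * z)) * ((gaussian a w)%:C * f w)) ->
  Cintegral (fun w => cexp (a%:C * (w^* * z)) * ((gaussian a w)%:C * f w)) =
    (pi / a)%:C * f z.
Proof.
move=> a0 df iI; set I := fun w => _ in iI *.
have [iJ eJ] := cint_preserving (preserving_translation z) iI.
pose F w := f (w + z) * cexp (- (a%:C * z^*) * w + 0).
have IJ : (fun w => I (w + z)) = (fun w => (gaussian a w)%:C * F w).
  apply/funext => w.
  have key : cexp (a%:C * ((w + z)^* * z)) * (gaussian a (w + z))%:C =
      (gaussian a w)%:C * cexp (- (a%:C * z^*) * w + 0).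
    rewrite -!cexp_real -!cexpD; congr cexp.
    case: w z {I F iI iJ eJ} => wx wy [zx zy]; rewrite /abs2.
    by apply: complex_eq => /=; ring.
  by rewrite /I /F mulrA key -mulrA [f _ * _]mulrC.
have dF p : cdiff F p.
  apply: cdiff_mul.
    have -> : (fun w => f (w + z)) = f \o (fun w => 1 * w + z).
      by apply/funext => w; rewrite /= mul1r.
    by apply: cdiff_comp => //; exact: cdiff_affine.
  by apply: (@cdiff_comp R cexp (fun w => - (a%:C * z^*) * w + 0)); [exact: cdiff_affine|exact: cdiff_cexp].
rewrite -eJ IJ gaussian_mean// -?IJ// /F add0r mulr0 addr0.
by rewrite [cexp _](_ : _ = 1) ?mulr1// -[0]/(0%:C) cexp_real expR0.
Qed.

Lemma le_half_sqr (x y : R) : x * y <= (x ^+ 2 + y ^+ 2) / 2.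
Proof. have := sqr_ge0 (x - y); rewrite sqrrB; lra. Qed.

(** By 2 x y <= x^2 + y^2 the exponential is charged to the Gaussian and f to its
    weighted square. *)
Lemma rintble_exp_weight a b (K : R) f : 0 < a -> 0 <= K -> cmeas f ->
  rintble (fun w => gaussian a w * abs2 (f w)) ->
  rintble (fun w => K * (expR (b * modulus w) * (gaussian a w * modulus (f w)))).
Proof.
move=> a0 K0 mf i2; apply: rintbleZ.
apply: (@rintble_le _ _ (fun w => 2^-1 * (1 * expR (- a * abs2 w + (2 * b) * modulus w)) +
   2^-1 * (gaussian a w * abs2 (f w)))); last first.
- by apply: rintbleD; apply: rintbleZ => //; exact: rintble_gaussian_exp.
- move=> w; have g0 : 0 <= gaussian a w := expR_ge0 _.
  rewrite ger0_norm; last by rewrite !mulr_ge0 ?expR_ge0 ?modulus_ge0.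
  rewrite mul1r expRD -/(gaussian a w) -modulus_sqr.
  have := le_half_sqr (expR (b * modulus w)) (modulus (f w)).
  have -> : expR (b * modulus w) ^+ 2 = expR (2 * b * modulus w).
    by rewrite expr2 -expRD; congr expR; ring.
  move=> /(ler_wpM2l g0); set x := expR _; set y := expR _; set g := gaussian _ _.
  set v := modulus _; rewrite [x * (g * v)]mulrCA => h; apply: le_trans h _.
  by apply: eq_ler; field.
- apply: rmeasM.
    by apply: rmeas_expR; apply: rmeasM; [exact: rmeas_cst|exact: rmeas_modulus cmeas_id].
  by apply: rmeasM; [exact: rmeas_gaussian|exact: rmeas_modulus].
Qed.

Lemma cintble_exp_weight u a b (K : R) : 0 < a -> cmeas u ->
  (forall w, modulus (u w) <= K * expR (- a * abs2 w + b * modulus w)) -> cintble u.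
Proof. by move=> a0 mu h; exact: cintble_le mu h (rintble_gaussian_exp _ _ a0). Qed.

Lemma sum_exp_coeff_le N (x : R) : 0 <= x -> \sum_(n < N) x ^+ n / n`!%:R <= expR x.
Proof.
move=> x0; apply: (@le_trans _ _ (series (exp_coeff x) N)).
  by rewrite /series/= big_mkord; apply: ler_sum => n _; rewrite /exp_coeff.
apply: nondecreasing_cvgn_le; last exact: is_cvg_series_exp_coeff.
by apply: nondecreasing_series => n _ _; exact: exp_coeff_ge0.
Qed.

Lemma pow_le_expR n (x : R) : 0 <= x -> x ^+ n <= n`!%:R * expR x.
Proof.
move=> x0; have f0 : 0 < n`!%:R :> R by rewrite ltr0n fact_gt0.
rewrite -ler_pdivrMl// mulrC; apply: le_trans (sum_exp_coeff_le n.+1 x0).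
rewrite big_ord_recr/= lerDr sumr_ge0// => i _.
by rewrite divr_ge0 ?exprn_ge0.
Qed.

Lemma cintble_pow_weight u a n (K : R) : 0 < a -> 0 <= K -> cmeas u ->
  (forall w, modulus (u w) <= K * (modulus w ^+ n * gaussian a w)) -> cintble u.
Proof.
move=> a0 K0 mu h; apply: (@cintble_exp_weight _ a 1 (K * n`!%:R)) => // w.
apply: le_trans (h w) _; rewrite -mulrA ler_wpM2l// expRD -/(gaussian a w).
by rewrite mul1r mulrCA mulrC ler_wpM2l ?expR_ge0 ?pow_le_expR ?modulus_ge0.
Qed.

Lemma rintble_pow_weight a n : 0 < a -> rintble (fun w => gaussian a w * modulus w ^+ n).
Proof.
move=> a0; apply: (rintble_le _ _ (rintble_gaussian_exp 1 n`!%:R a0)).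
- apply: rmeasM; first exact: rmeas_gaussian.
  have := rmeas_modulus (cmeasX n (@cmeas_id R)); congr rmeas.
  by apply/funext => w; rewrite modulusX.
- move=> w; rewrite ger0_norm ?mulr_ge0 ?expR_ge0 ?exprn_ge0 ?modulus_ge0// expRD.
  by rewrite -/(gaussian a w) mul1r mulrCA ler_wpM2l ?expR_ge0 ?pow_le_expR ?modulus_ge0.
Qed.

(** Monomials of different degrees are exchanged by a rotation whose effect on
    their product is a change of sign. *)
Lemma monomial_orthogonal a (m n : nat) : 0 < a -> m != n ->
  Cintegral (fun w => (w^*) ^+ m * ((gaussian a w)%:C * w ^+ n)) = 0.
Proof.
move=> a0 mn; set I := fun w => _.
have iI : cintble I.
  apply: (@cintble_pow_weight _ a (m + n) 1) => // [|w].
    apply: cmeasM; first exact: cmeasX (cmeasJ cmeas_id).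
    by apply: cmeasM; [exact: cmeas_gaussian|exact: cmeasX cmeas_id].
  by rewrite /I modulusM modulus_gaussianM !modulusX modulusJ exprD mul1r -mulrA [_ ^+ n * _]mulrC.
(* The rotation by t multiplies the integrand by e^(i (n - m) t) = -1. *)
pose t : R := pi / (n%:R - m%:R).
have nm : n%:R - m%:R != 0 :> R by rewrite subr_eq0 eqr_nat eq_sym.
have cisX k : cis t ^+ k = cis (k%:R * t).
  elim: k => [|k IH]; first by rewrite expr0 mul0r cisE cos0 sin0.
  rewrite exprS IH /cis -cexpD; congr cexp.
  by apply: complex_eq => /=; rewrite -?natr1; ring.
have cisJ s : (cis s)^* = cis (- s).
  by rewrite !cisE cosN sinN.
have [_] := cint_preserving (preserving_rotation (abs2_cis t)) iI.
have -> : (fun w => I (cis t * w)) = (fun w => (-1) * I w).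
  apply/funext => w; rewrite /I gaussian_cis rmorphM [(_ * _) ^+ m]exprMn [(cis t * w) ^+ n]exprMn.
  have -> : (cis t)^* ^+ m = (cis t ^+ m)^* by rewrite rmorphXn.
  rewrite !cisX cisJ.
  have key : cis (- (m%:R * t)) * cis (n%:R * t) = -1.
    rewrite /cis -cexpD; have -> : 0 +i* - (m%:R * t) + (0 +i* (n%:R * t)) = 0 +i* pi.
      by apply: complex_eq => /=; rewrite ?addr0// /t; field.
    by rewrite -/(cis pi) cisE cospi sinpi; apply: complex_eq => /=; rewrite ?oppr0.
  rewrite -key; move: (cis _) (cis _) (_ ^+ m) => x y v; ring.
rewrite CintegralZ// mulN1r => h.
have : 2%:R * Cintegral I = 0 by rewrite mulr_natl mulr2n -{1}h addNr.
by move/eqP; rewrite mulf_eq0 pnatr_eq0/= => /eqP.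
Qed.

End Reproducing.

(** * Taylor expansion under the integral sign *)

Section Expansion.
Context {R : realType}.
Local Notation C := R[i].
Implicit Types (f F u : C -> C) (w z p : C) (a b : R) (c : nat -> C).

Lemma cvg_const_eventually (e : nat -> R) (L : R) n0 :
  (forall n, (n0 < n)%N -> e n = L) -> e @ \oo --> (0 : R) -> L = 0.
Proof.
move=> eL e0; apply: (cvg_unique _ _ e0) => //; apply: (@cvg_trans _ ((cst L : nat -> R) @ \oo)).
  by apply: near_eq_cvg; near=> n; rewrite /cst eL//; near: n; exact: nbhs_infty_gt.
exact: cvg_cst.
Unshelve. all: by end_near. Qed.

Lemma modulusB_eq0 z w : modulus (z - w) = 0 -> z = w.
Proof. by move/modulus_eq0/eqP; rewrite subr_eq0 => /eqP. Qed.

Lemma cmeas_pow n : cmeas (fun w : C => w ^+ n).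
Proof. exact: cmeasX cmeas_id. Qed.

Lemma cmeas_conj_pow n : cmeas (fun w : C => w^* ^+ n).
Proof. exact: cmeasX (cmeasJ cmeas_id). Qed.

(** The partial sums of the exponential are dominated by e^(|w| |z|). *)
Lemma kernel_series F : cmeas F ->
  (forall b, rintble (fun w => expR (b * modulus w) * modulus (F w))) ->
  (forall n, cintble (fun w => w^* ^+ n * F w)) /\ forall z,
  (fun N => modulus (\sum_(n < N) (n`!%:R^-1)%:C * Cintegral (fun w => w^* ^+ n * F w) * z ^+ n -
     Cintegral (fun w => cexp (w^* * z) * F w))) @ \oo --> (0 : R).
Proof.
move=> mF iF.
have iM n : cintble (fun w => w^* ^+ n * F w).
  apply: cintble_le (rintbleZ n`!%:R (iF 1)); first exact: cmeasM (cmeas_conj_pow n) mF.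
  move=> w; rewrite modulusM modulusX modulusJ mul1r mulrA ler_wpM2r ?modulus_ge0//.
  exact: pow_le_expR (modulus_ge0 _).
split=> // z.
have mz : cmeas (fun w => w^* * z) by apply: cmeasM; [exact: cmeasJ cmeas_id|exact: cmeas_cst].
pose U N w := exp_sum N (w^* * z) * F w.
have UE N : U N = (fun w => \sum_(n < N) (n`!%:R^-1)%:C * z ^+ n * (w^* ^+ n * F w)).
  apply/funext => w; rewrite /U /exp_sum mulr_suml; apply: eq_bigr => n _.
  by rewrite exprMn; ring.
have iU N : cintble (U N).
  by rewrite UE; apply: (cintble_sum (F := fun n w => (n`!%:R^-1)%:C * z ^+ n * (w^* ^+ n * F w))) => n _; exact: cintbleZ.
have := @Cintegral_dominated R U (fun w => cexp (w^* * z) * F w)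
  (fun w => expR (modulus z * modulus w) * modulus (F w)).
case.
- by move=> N; exact: cintble_meas.
- by apply: cmeasM => //; exact: cmeas_cexp.
- move=> w; rewrite -[X in _ --> X](mul0r (modulus (F w))).
  under eq_fun do rewrite /U -mulrBl modulusM modulusB.
  by apply: cvgMr_tmp; exact: exp_sum_cvg.
- exact: iF.
- move=> N w; rewrite modulusM ler_wpM2r ?modulus_ge0//.
  apply: le_trans (modulus_exp_sum _ _) _.
  by rewrite modulusM modulusJ mulrC.
move=> _; apply: cvg_trans; apply: near_eq_cvg; apply: nearW => N; congr (modulus (_ - _)).
rewrite UE (Cintegral_sum (F := fun n w => (n`!%:R^-1)%:C * z ^+ n * (w^* ^+ n * F w))); last first.
  by move=> n _; exact: cintbleZ.
by apply: eq_bigr => n _; rewrite CintegralZ//; ring.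
Qed.

Lemma cintble_monomial a m n : 0 < a ->
  cintble (fun w => w^* ^+ m * ((gaussian a w)%:C * w ^+ n)).
Proof.
move=> a0; apply: (@cintble_pow_weight _ _ a (m + n) 1) => // [|w].
  by apply: cmeasM; [exact: cmeas_conj_pow|apply: cmeasM; [exact: cmeas_gaussian|exact: cmeas_pow]].
by rewrite modulusM modulus_gaussianM !modulusX modulusJ exprD mul1r -mulrA [_ ^+ n * _]mulrC.
Qed.

Lemma cdiff_pow n (p : C) : cdiff (fun z => z ^+ n) p.
Proof.
elim: n => [|n IH].
  have := @cdiff_affine R 0 1 p; congr cdiff.
  by apply/funext => z; rewrite mul0r add0r expr0.
have -> : (fun z : C => z ^+ n.+1) = (fun z => (1 * z + 0) * z ^+ n).
  by apply/funext => z; rewrite mul1r addr0 exprS.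
by apply: cdiff_mul => //; exact: cdiff_affine.
Qed.

(** The norm of a monomial comes from reproducing it at a point and expanding
    the kernel there: orthogonality leaves a single term. *)
Lemma monomial_moment a m n : 0 < a ->
  Cintegral (fun w => w^* ^+ m * ((gaussian a w)%:C * w ^+ n)) =
  if n == m then (pi * n`!%:R / a ^+ n.+1)%:C else 0.
Proof.
move=> a0; case: eqVneq => [->|nm]; last by apply: monomial_orthogonal => //; rewrite eq_sym.
pose F w := (gaussian a w)%:C * w ^+ m : C.
have mF : cmeas F by apply: cmeasM; [exact: cmeas_gaussian|exact: cmeas_pow].
have i2 : rintble (fun w => gaussian a w * abs2 (w ^+ m)).
  have := @rintble_pow_weight R a (m + m) a0; congr rintble; apply/funext => w.
  by rewrite -modulus_sqr modulusX exprD expr2.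
have iF b : rintble (fun w => expR (b * modulus w) * modulus (F w)).
  have := @rintble_exp_weight R a b 1 _ a0 ler01 (cmeas_pow m) i2; congr rintble.
  by apply/funext => w; rewrite mul1r /F modulus_gaussianM.
have [iM hs] := kernel_series mF iF.
have rep : Cintegral (fun w => cexp (w^* * a%:C) * F w) = (pi / a)%:C.
  have E : (fun w => cexp (w^* * a%:C) * F w) =
      (fun w => cexp (a%:C * (w^* * 1)) * ((gaussian a w)%:C * w ^+ m)).
    by apply/funext => w; rewrite mulr1 [w^* * _]mulrC.
  rewrite E (reproducing (f := fun w => w ^+ m)) ?expr1n ?mulr1//.
    by move=> p; exact: cdiff_pow.
  rewrite -E; apply: (cintble_le _ _ (iF a)).
    by apply: cmeasM => //; apply: cmeas_cexp; apply: cmeasM; [exact: cmeasJ cmeas_id|exact: cmeas_cst].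
  move=> w; rewrite modulusM ler_wpM2r ?modulus_ge0// modulus_cexp ler_expR.
  apply: le_trans (ler_norm _) _; apply: le_trans (Re_le_modulus _) _.
  by rewrite modulusM modulusJ modulus_real gtr0_norm// mulrC.
have := hs a%:C; rewrite rep => /(cvg_const_eventually (n0 := m)).
set I := Cintegral (fun w => w^* ^+ m * _).
move=> /(_ (modulus ((m`!%:R^-1)%:C * I * a%:C ^+ m - (pi / a)%:C))) h.
have {h} /modulusB_eq0 h : modulus ((m`!%:R^-1)%:C * I * a%:C ^+ m - (pi / a)%:C) = 0.
  apply: h => N mN; rewrite (bigD1 (Ordinal mN))//= big1 ?addr0// => j jm.
  rewrite monomial_orthogonal ?mulr0 ?mul0r//.
have f0 : m`!%:R != 0 :> R by rewrite pnatr_eq0 -lt0n fact_gt0.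
have a0' : a != 0 by rewrite gt_eqF.
have -> : I = (m`!%:R / a ^+ m)%:C * ((m`!%:R^-1)%:C * I * a%:C ^+ m).
  transitivity ((m`!%:R / a ^+ m * m`!%:R^-1 * a ^+ m)%:C * I).
    rewrite [X in X%:C](_ : _ = 1) ?mul1r//.
    by field; rewrite f0 expf_neq0.
  by rewrite -rmorphXn/= !rmorphM/=; ring.
by rewrite h -rmorphM/=; congr (_%:C); rewrite exprS; field; rewrite a0' expf_neq0.
Qed.

End Expansion.

(** * Normalised monomials *)

Section Monomials.
Context {R : realType}.
Local Notation C := R[i].
Implicit Types (f F u g : C -> C) (w z p : C) (a b : R) (c : nat -> C).

Definition mono_norm n : R := Num.sqrt (pi * n`!%:R).

(** Multiplied by e^(-|z|^2/2), these form the orthonormal basis of the space. *)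
Definition mono n z : C := (mono_norm n)^-1%:C * z ^+ n.

Definition fcoef f n : C := Cintegral (fun w => (mono n w)^* * ((gaussian 1 w)%:C * f w)).

Definition psum c N z : C := \sum_(n < N) c n * mono n z.

Lemma mono_norm_gt0 n : 0 < mono_norm n.
Proof. by rewrite sqrtr_gt0 mulr_gt0 ?pi_gt0// ltr0n fact_gt0. Qed.

Lemma mono_norm_neq0 n : mono_norm n != 0.
Proof. by rewrite gt_eqF ?mono_norm_gt0. Qed.

Lemma mono_norm_sqr n : mono_norm n ^+ 2 = pi * n`!%:R.
Proof. by rewrite sqr_sqrtr// mulr_ge0 ?pi_ge0. Qed.

Lemma conjcX w n : (w ^+ n)^* = w^* ^+ n.
Proof. by rewrite rmorphXn. Qed.

Lemma conjcR (r : R) : (r%:C)^* = r%:C :> C.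
Proof. by apply: complex_eq => /=; rewrite ?oppr0. Qed.

Lemma conjM z w : (z * w)^* = z^* * w^*.
Proof. by rewrite rmorphM. Qed.

Lemma conjc_sum N (F : 'I_N -> C) : (\sum_(n < N) F n)^* = \sum_(n < N) (F n)^*.
Proof. by rewrite rmorph_sum. Qed.

Lemma abs2C z : (abs2 z)%:C = z^* * z :> C.
Proof. by case: z => x y; rewrite /abs2; apply: complex_eq => /=; ring. Qed.

Lemma mono_conj n w : (mono n w)^* = (mono_norm n)^-1%:C * w^* ^+ n.
Proof. by rewrite /mono conjM conjcX conjcR. Qed.

Lemma modulus_mono n z : modulus (mono n z) = (mono_norm n)^-1 * modulus z ^+ n.
Proof. by rewrite modulusM modulus_real modulusX ger0_norm// invr_ge0 ltW ?mono_norm_gt0. Qed.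

Lemma cmeas_mono n : cmeas (mono n).
Proof. by apply: cmeasM; [exact: cmeas_cst|exact: cmeas_pow]. Qed.

Lemma cmeas_psum c N : cmeas (psum c N).
Proof.
apply: (@cmeas_sum R N (fun n z => c n * mono n z)) => n.
by apply: cmeasM; [exact: cmeas_cst|exact: cmeas_mono].
Qed.

Lemma abs2_mono n z : abs2 (mono n z) = (pi * n`!%:R)^-1 * abs2 z ^+ n.
Proof.
rewrite -!modulus_sqr modulus_mono exprMn exprVn mono_norm_sqr.
by rewrite -!exprM mulnC.
Qed.

Lemma abs2_psum c N (M : R) z : \sum_(n < N) abs2 (c n) <= M ->
  abs2 (psum c N z) <= M / pi * expR (abs2 z).
Proof.
move=> cM.
apply: (@le_trans _ _ ((\sum_(n < N) abs2 (c n)) * \sum_(n < N) abs2 (mono n z))).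
  under eq_bigr do rewrite -modulus_sqr.
  under [X in _ <= _ * X]eq_bigr do rewrite -modulus_sqr.
  rewrite -modulus_sqr; apply: le_trans (sum_cauchy_schwarz N (fun n => modulus (c n)) (fun n => modulus (mono n z))).
  rewrite lerXn2r ?nnegrE ?modulus_ge0//.
    by apply: sumr_ge0 => n _; rewrite mulr_ge0 ?modulus_ge0.
  apply: le_trans (modulus_sum _ (fun n => c n * mono n z)) _.
  by apply: ler_sum => n _; rewrite modulusM.
have p0 : 0 < pi :> R := pi_gt0 R.
rewrite -mulrA; apply: ler_pM => //; try by apply: sumr_ge0 => i _; exact: abs2_ge0.
apply: (@le_trans _ _ (pi^-1 * \sum_(n < N) abs2 z ^+ n / n`!%:R)).
  rewrite mulr_sumr; apply: ler_sum => n _; rewrite abs2_mono.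
  by apply: eq_ler; rewrite invfM; ring.
apply: ler_wpM2l; first by rewrite invr_ge0 ltW.
exact: sum_exp_coeff_le (abs2_ge0 z).
Qed.

Lemma mono_moment a m n : 0 < a ->
  cintble (fun w => (mono m w)^* * ((gaussian a w)%:C * w ^+ n)) /\
  Cintegral (fun w => (mono m w)^* * ((gaussian a w)%:C * w ^+ n)) =
  if n == m then (mono_norm m / a ^+ m.+1)%:C else 0.
Proof.
move=> a0.
have E : (fun w => (mono m w)^* * ((gaussian a w)%:C * w ^+ n)) =
    (fun w => (mono_norm m)^-1%:C * (w^* ^+ m * ((gaussian a w)%:C * w ^+ n))).
  by apply/funext => w; rewrite mono_conj -mulrA.
have i1 := cintble_monomial m n a0.
rewrite E; split; first exact: cintbleZ.
rewrite CintegralZ// monomial_moment//; case: eqVneq => [->|]; last by rewrite mulr0.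
rewrite -rmorphM/=; congr (_%:C); rewrite -mono_norm_sqr.
by field; rewrite mono_norm_neq0 expf_neq0// gt_eqF.
Qed.

(** The weight [|z|^(2k)] only rescales the orthogonality relations, by the
    number of ordered choices of k elements among n + k. *)
Definition rising n k : R := (n + k)`!%:R / n`!%:R.

Lemma psum_moment c N k :
  rintble (fun w => gaussian 1 w * (modulus w ^+ k.*2 * abs2 (psum c N w))) /\
  Rint (fun w => gaussian 1 w * (modulus w ^+ k.*2 * abs2 (psum c N w))) =
    \sum_(n < N) rising n k * abs2 (c n).
Proof.
pose T (i j : nat) w := (c i)^* * (c j) * (mono_norm i)^-1%:C * (mono_norm j)^-1%:C *
   (w^* ^+ (i + k) * ((gaussian 1 w)%:C * w ^+ (j + k))) : C.
have iT i j : cintble (T i j) by apply: cintbleZ; exact: cintble_monomial.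
have iS i : cintble (fun w => \sum_(j < N) T i j w) by apply: cintble_sum.
have E : (fun w => (gaussian 1 w * (modulus w ^+ k.*2 * abs2 (psum c N w)))%:C) =
    (fun w => \sum_(i < N) \sum_(j < N) T i j w).
  apply/funext => w.
  have -> : modulus w ^+ k.*2 = abs2 w ^+ k by rewrite -modulus_sqr -exprM mul2n.
  rewrite !rmorphM rmorphXn/= !abs2C {1}/psum conjc_sum !mulr_suml !mulr_sumr.
  apply: eq_bigr => i _; rewrite /psum mulr_sumr !mulr_sumr; apply: eq_bigr => j _.
  by rewrite /T conjM mono_conj /mono !exprD exprMn; ring.
have iE : cintble (fun w => (gaussian 1 w * (modulus w ^+ k.*2 * abs2 (psum c N w)))%:C).
  by rewrite E; exact: (cintble_sum (F := fun i w => \sum_(j < N) T i j w)).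
split; first exact: iE.1.
transitivity (complex.Re (Cintegral (fun w => (gaussian 1 w * (modulus w ^+ k.*2 * abs2 (psum c N w)))%:C))).
  by rewrite CintegralE.
rewrite E (Cintegral_sum (F := fun i w => \sum_(j < N) T i j w))//.
rewrite raddf_sum; apply: eq_bigr => i _; rewrite (Cintegral_sum (F := T i))//.
rewrite (bigD1 i)//= big1 ?addr0 => [|j ji].
  rewrite /T CintegralZ ?monomial_moment//; last exact: cintble_monomial.
  rewrite eqxx expr1n divr1 -!mulrA -!rmorphM/= mulrA.
  rewrite -abs2C.
  rewrite -rmorphM/= /rising.
  have h := mono_norm_sqr i; have n0 := mono_norm_neq0 i.
  have f0 : i`!%:R != 0 :> R by rewrite pnatr_eq0 -lt0n fact_gt0.
  have -> : pi = mono_norm i ^+ 2 / i`!%:R :> R by rewrite h mulfK.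
  by field; rewrite f0 n0.
rewrite /T CintegralZ ?monomial_moment//; last exact: cintble_monomial.
by rewrite eqn_add2r (_ : (j == i :> nat) = false) ?mulr0//; apply/negbTE.
Qed.

End Monomials.

(** * Coefficients, Bessel inequality, expansion *)

Section FockCoefficients.
Context {R : realType}.
Local Notation C := R[i].
Implicit Types (f F u g : C -> C) (w z p : C) (a b : R) (c : nat -> C).

(** Any growth e^(b |z|^2) with b < a is dominated by the weight e^(-a |z|^2), so
    moments pass to the limit. *)
Lemma weighted_limit a b (K : R) m (P : nat -> C -> C) g : b < a -> 0 <= K ->
  (forall N, cmeas (P N)) -> cmeas g ->
  (forall N w, modulus (P N w) <= K * expR (b * abs2 w)) ->
  (forall w, (fun N => modulus (P N w - g w)) @ \oo --> (0 : R)) ->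
  cintble (fun w => (mono m w)^* * ((gaussian a w)%:C * g w)) /\
  (fun N => modulus (Cintegral (fun w => (mono m w)^* * ((gaussian a w)%:C * P N w)) -
     Cintegral (fun w => (mono m w)^* * ((gaussian a w)%:C * g w)))) @ \oo --> (0 : R).
Proof.
move=> ba K0 mP mg PK Pg.
have ab : 0 < a - b by rewrite subr_gt0.
have mm g' : cmeas g' -> cmeas (fun w => (mono m w)^* * ((gaussian a w)%:C * g' w)).
  move=> mg'; apply: cmeasM; first exact/cmeasJ/cmeas_mono.
  by apply: cmeasM => //; exact: cmeas_gaussian.
apply: (@Cintegral_dominated R (fun N w => (mono m w)^* * ((gaussian a w)%:C * P N w)) _ (fun w => (mono_norm m)^-1 * K * (gaussian (a - b) w * modulus w ^+ m))).
- by move=> N; exact: mm.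
- exact: mm.
- move=> z.
  have -> : (fun N => modulus ((mono m z)^* * ((gaussian a z)%:C * P N z) -
      (mono m z)^* * ((gaussian a z)%:C * g z))) =
      (fun N => modulus (mono m z)^* * gaussian a z * modulus (P N z - g z)).
    by apply/funext => N; rewrite -mulrBr -mulrBr modulusM modulus_gaussianM mulrA.
  rewrite -[X in _ --> X](mulr0 (modulus (mono m z)^* * gaussian a z)).
  by apply: cvgMl_tmp; exact: Pg.
- by apply: rintbleZ; exact: rintble_pow_weight.
- move=> N w; rewrite modulusM modulusJ modulus_mono modulus_gaussianM gaussianD.
  rewrite [gaussian (- b) _]/gaussian opprK.
  set x := gaussian a w; set y := expR _; set v := modulus w ^+ m; set n := (mono_norm m)^-1.
  rewrite (_ : n * K * (x * y * v) = n * v * (x * (K * y))); last by ring.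
  apply: ler_wpM2l; last by apply: ler_wpM2l; [exact: expR_ge0|exact: PK].
  by rewrite mulr_ge0 ?exprn_ge0 ?modulus_ge0// invr_ge0 ltW ?mono_norm_gt0.
Qed.

Lemma Cintegral_bigsum (I : Type) (r : seq I) (F : I -> C -> C) : (forall i, cintble (F i)) ->
  cintble (fun w => \sum_(i <- r) F i w) /\
  Cintegral (fun w => \sum_(i <- r) F i w) = \sum_(i <- r) Cintegral (F i).
Proof.
move=> iF; elim: r => [|i r [IH1 IH2]].
  rewrite (_ : (fun w => _) = (fun=> 0)); last by apply/funext => w; rewrite big_nil.
  by rewrite big_nil Cintegral0; split=> //; exact: cintble0.
rewrite (_ : (fun w => _) = (fun w => F i w + \sum_(j <- r) F j w)); last first.
  by apply/funext => w; rewrite big_cons.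
by rewrite big_cons -IH2 -CintegralD//; split=> //; exact: cintbleD.
Qed.

Lemma mono_moment_sum a m (I : Type) (r : seq I) (d : I -> C) (e : I -> nat) : 0 < a ->
  Cintegral (fun w => (mono m w)^* * ((gaussian a w)%:C * \sum_(i <- r) d i * w ^+ e i)) =
  (mono_norm m / a ^+ m.+1)%:C * \sum_(i <- r | e i == m) d i.
Proof.
move=> a0.
pose F i w := d i * ((mono m w)^* * ((gaussian a w)%:C * w ^+ e i)) : C.
have iF i : cintble (F i) by apply: cintbleZ; exact: (mono_moment m (e i) a0).1.
have -> : (fun w => (mono m w)^* * ((gaussian a w)%:C * \sum_(i <- r) d i * w ^+ e i)) =
    (fun w => \sum_(i <- r) F i w).
  by apply/funext => w; rewrite !mulr_sumr; apply: eq_bigr => i _; rewrite /F; ring.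
rewrite (Cintegral_bigsum r iF).2 mulr_sumr [RHS]big_mkcond/=; apply: eq_bigr => i _.
have [i1 e1] := mono_moment m (e i) a0.
rewrite /F CintegralZ// e1; case: ifP => _; last by rewrite mulr0.
by rewrite mulrC.
Qed.

Lemma psum_monomials c N z :
  psum c N z = \sum_(n <- index_enum 'I_N) (c n * (mono_norm n)^-1%:C) * z ^+ n.
Proof. by rewrite /psum; apply: eq_bigr => n _; rewrite /mono mulrA. Qed.

Lemma sum_ord_pick N m (d : nat -> C) : (m < N)%N ->
  \sum_(n <- index_enum 'I_N | n == m :> nat) d n = d m.
Proof.
move=> mN; rewrite (bigD1 (Ordinal mN))//= big1 ?addr0// => j /andP[/eqP jm] /eqP.
by move=> h; exfalso; apply: h; apply/val_inj.
Qed.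

(** The partial sums have the moments prescribed by orthogonality, and domination
    carries these to the sum. *)
Lemma series_coefficient b (K : R) c g m : b < 1 -> 0 <= K -> cmeas g ->
  (forall N w, modulus (psum c N w) <= K * expR (b * abs2 w)) ->
  (forall w, (fun N => modulus (psum c N w - g w)) @ \oo --> (0 : R)) ->
  fcoef g m = c m.
Proof.
move=> b1 K0 mg cK cg.
have [_] := weighted_limit m b1 K0 (cmeas_psum c) mg cK cg.
move/(cvg_const_eventually (n0 := m)) => /(_ (modulus (c m - fcoef g m))) h.
apply/esym/modulusB_eq0/h => N mN; congr (modulus (_ - _)).
under [X in Cintegral X]funext => w do rewrite psum_monomials.
rewrite mono_moment_sum// (@sum_ord_pick N m (fun n => c n * (mono_norm n)^-1%:C))//.
rewrite expr1n divr1 mulrCA -rmorphM/= divff ?mulr1// mono_norm_neq0//.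
Qed.

Lemma cintble_mono_weight f m : cmeas f -> rintble (fun w => gaussian 1 w * abs2 (f w)) ->
  cintble (fun w => (mono m w)^* * ((gaussian 1 w)%:C * f w)).
Proof.
move=> mf i2.
have mm : cmeas (fun w => (mono m w)^* * ((gaussian 1 w)%:C * f w)).
  apply: cmeasM; first exact/cmeasJ/cmeas_mono.
  by apply: cmeasM => //; exact: cmeas_gaussian.
have K0 : 0 <= (mono_norm m)^-1 * m`!%:R :> R.
  by rewrite mulr_ge0// invr_ge0 ltW ?mono_norm_gt0.
apply: (cintble_le mm _ (rintble_exp_weight 1 ltr01 K0 mf i2)) => w.
rewrite modulusM modulusJ modulus_mono modulus_gaussianM [leRHS]mulrA.
apply: ler_wpM2r; first by rewrite mulr_ge0 ?expR_ge0 ?modulus_ge0.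
rewrite -mulrA mul1r; apply: ler_wpM2l; first by rewrite invr_ge0 ltW ?mono_norm_gt0.
exact: pow_le_expR (modulus_ge0 _).
Qed.

Lemma Rint_Re u : Rint (fun w => complex.Re (u w)) = complex.Re (Cintegral u).
Proof. by rewrite CintegralE. Qed.

Lemma abs2B z w : abs2 (z - w) = abs2 z - 2 * complex.Re (w^* * z) + abs2 w.
Proof. by case: z w => x y [x' y']; rewrite /abs2 /=; ring. Qed.

(** Expansion of the squared norm of f minus its partial sum. *)
Lemma bessel f N : cmeas f -> rintble (fun w => gaussian 1 w * abs2 (f w)) ->
  \sum_(n < N) abs2 (fcoef f n) <= Rint (fun w => gaussian 1 w * abs2 (f w)).
Proof.
move=> mf i2; set c := fcoef f.
have [ip ep] := psum_moment c N 0.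
pose Q w := (psum c N w)^* * ((gaussian 1 w)%:C * f w).
have QE : Q = (fun w => \sum_(n <- index_enum 'I_N) (c n)^* * ((mono n w)^* * ((gaussian 1 w)%:C * f w))).
  apply/funext => w; rewrite /Q /psum conjc_sum mulr_suml; apply: eq_bigr => n _.
  by rewrite conjM -mulrA.
have iT (n : 'I_N) : cintble (fun w => (c n)^* * ((mono n w)^* * ((gaussian 1 w)%:C * f w))).
  by apply: cintbleZ; exact: cintble_mono_weight.
have [iQ eQ] := Cintegral_bigsum (index_enum 'I_N) iT; rewrite -QE in iQ eQ.
have rQ : Rint (fun w => complex.Re (Q w)) = \sum_(n < N) abs2 (c n).
  rewrite Rint_Re eQ raddf_sum; apply: eq_bigr => n _; rewrite CintegralZ; last first.
    exact: cintble_mono_weight.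
  by rewrite -/(fcoef f n) -/(c n) -abs2C.
pose D w := gaussian 1 w * abs2 (f w) + (gaussian 1 w * (modulus w ^+ 0 * abs2 (psum c N w)) - 2 * complex.Re (Q w)).
have D0 w : 0 <= D w.
  have -> : D w = gaussian 1 w * abs2 (f w - psum c N w).
    rewrite /D abs2B expr0 (_ : Q w = (gaussian 1 w)%:C * ((psum c N w)^* * f w)).
      by rewrite ReZ; ring.
    by rewrite /Q mulrCA.
  by rewrite mulr_ge0 ?expR_ge0 ?abs2_ge0.
have := Rint_ge0 D0; rewrite RintD//; last first.
  by apply: rintbleB => //; apply: rintbleZ; exact: iQ.1.
rewrite RintB//; last by apply: rintbleZ; exact: iQ.1.
rewrite RintZ ?rQ; last exact: iQ.1.
rewrite ep; under eq_bigr do rewrite /rising addn0 divff ?mul1r ?pnatr_eq0 -?lt0n ?fact_gt0//.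
lra.
Qed.

Lemma kernel_expansion F z (L : C) : cmeas F ->
  (forall b, rintble (fun w => expR (b * modulus w) * modulus (F w))) ->
  Cintegral (fun w => cexp (w^* * z) * F w) = pi%:C * L ->
  (fun N => modulus (psum (fun n => Cintegral (fun w => (mono n w)^* * F w)) N z - L))
    @ \oo --> (0 : R).
Proof.
move=> mF iF rep; have [iM hs] := kernel_series mF iF.
have p0 : pi != 0 :> R by rewrite gt_eqF ?pi_gt0.
have := hs z; rewrite rep => h.
rewrite -[X in _ --> X](mulr0 pi^-1).
have -> : (fun N => modulus (psum (fun n => Cintegral (fun w => (mono n w)^* * F w)) N z - L)) = (fun N => pi^-1 *
   modulus (\sum_(n < N) (n`!%:R^-1)%:C * Cintegral (fun w => w^* ^+ n * F w) * z ^+ n - pi%:C * L)).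
  apply/funext => N; have -> : pi^-1 = modulus (pi^-1)%:C :> R.
    by rewrite modulus_real ger0_norm// invr_ge0 pi_ge0.
  rewrite -modulusM mulrBr mulrA -rmorphM/= mulVf// mul1r; congr (modulus (_ - _)).
  rewrite mulr_sumr; apply: eq_bigr => n _.
  have -> : Cintegral (fun w => (mono n w)^* * F w) =
      (mono_norm n)^-1%:C * Cintegral (fun w => w^* ^+ n * F w).
    rewrite -CintegralZ//; congr Cintegral; apply/funext => w.
    by rewrite mono_conj -mulrA.
  rewrite /mono.
  have -> : (pi^-1)%:C * ((n`!%:R^-1)%:C * Cintegral (fun w => w^* ^+ n * F w) * z ^+ n) =
     ((pi * n`!%:R)^-1)%:C * Cintegral (fun w => w^* ^+ n * F w) * z ^+ n.
    by rewrite invfM rmorphM/=; ring.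
  by rewrite -mono_norm_sqr expr2 invfM rmorphM/=; ring.
by apply: cvgMl_tmp.
Qed.

Lemma cintble_kernel F z : cmeas F ->
  rintble (fun w => expR (modulus z * modulus w) * modulus (F w)) ->
  cintble (fun w => cexp (w^* * z) * F w).
Proof.
move=> mF; apply: cintble_le.
  by apply: cmeasM => //; apply: cmeas_cexp; apply: cmeasM; [exact: cmeasJ cmeas_id|exact: cmeas_cst].
move=> w; rewrite modulusM ler_wpM2r ?modulus_ge0// modulus_cexp ler_expR.
apply: le_trans (ler_norm _) _; apply: le_trans (Re_le_modulus _) _.
by rewrite modulusM modulusJ mulrC.
Qed.

Lemma fock_expansion f z : (forall p, cdiff f p) -> cmeas f ->
  rintble (fun w => gaussian 1 w * abs2 (f w)) ->
  (fun N => modulus (psum (fcoef f) N z - f z)) @ \oo --> (0 : R).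
Proof.
move=> df mf i2; pose F w := (gaussian 1 w)%:C * f w : C.
have mF : cmeas F by apply: cmeasM => //; exact: cmeas_gaussian.
have iF b : rintble (fun w => expR (b * modulus w) * modulus (F w)).
  have := @rintble_exp_weight R 1 b 1 f ltr01 ler01 mf i2; congr rintble.
  by apply/funext => w; rewrite mul1r /F modulus_gaussianM.
apply: (kernel_expansion mF iF).
have E : (fun w => cexp (w^* * z) * F w) =
    (fun w => cexp (1%:C * (w^* * z)) * ((gaussian 1 w)%:C * f w)).
  by apply/funext => w; rewrite mul1r.
by rewrite E (reproducing (f := f))// ?divr1// -E; exact: cintble_kernel.
Qed.

End FockCoefficients.

(** * The cubic term in coefficients *)

Section CubicTerm.
Context {R : realType}.
Local Notation C := R[i].
Implicit Types (f F u g : C -> C) (w z p : C) (a b : R) (c : nat -> C).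

Lemma modulus_lim_le (P : nat -> C) l (B : R) : (forall N, modulus (P N) <= B) ->
  (fun N => modulus (P N - l)) @ \oo --> (0 : R) -> modulus l <= B.
Proof.
move=> PB Pl; apply/ler_addgt0Pr => e e0.
move/cvgrPdist_lt : Pl => /(_ e e0) [N _ /(_ N (leqnn N))] /=.
rewrite sub0r normrN ger0_norm ?modulus_ge0// => h.
rewrite (_ : l = P N - (P N - l)); last by rewrite opprB addrCA subrr addr0.
by apply: le_trans (modulusD _ _) _; rewrite modulusN lerD// ltW.
Qed.

Lemma modulus_cvgM (P Q : nat -> C) (g h : C) (B : R) : (forall N, modulus (P N) <= B) ->
  (fun N => modulus (P N - g)) @ \oo --> (0 : R) ->
  (fun N => modulus (Q N - h)) @ \oo --> (0 : R) ->
  (fun N => modulus (P N * Q N - g * h)) @ \oo --> (0 : R).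
Proof.
move=> PB Pg Qh; apply: (@squeeze_cvgr _ _ _ _ (fun=> 0)
  (fun N => B * modulus (Q N - h) + modulus (P N - g) * modulus h)).
- near=> N; rewrite modulus_ge0/=.
  rewrite (_ : P N * Q N - g * h = P N * (Q N - h) + (P N - g) * h); last by ring.
  apply: le_trans (modulusD _ _) _; rewrite !modulusM lerD2r ler_wpM2r ?modulus_ge0//.
- exact: cvg_cst.
- rewrite -[X in _ --> X](addr0 (0 : R)); apply: cvgD.
    by rewrite -[X in _ --> X](mulr0 B); apply: cvgMl_tmp.
  by rewrite -[X in _ --> X](mul0r (modulus h)); apply: cvgMr_tmp.
Unshelve. all: by end_near. Qed.

(** Cauchy-Schwarz against the reproducing kernel sum |phi_n|^2 = 1 / pi. *)
Lemma modulus_psum_le c (M : R) N z : \sum_(n < N) abs2 (c n) <= M ->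
  modulus (psum c N z) <= Num.sqrt (M / pi) * expR (2^-1 * abs2 z).
Proof.
move=> cM; have M0 : 0 <= M by apply: le_trans cM; apply: sumr_ge0 => i _; exact: abs2_ge0.
rewrite -(@ler_pXn2r _ 2)// ?nnegrE ?modulus_ge0 ?mulr_ge0 ?sqrtr_ge0 ?expR_ge0//.
rewrite modulus_sqr exprMn sqr_sqrtr ?divr_ge0 ?pi_ge0// expr2 -expRD.
rewrite (_ : 2^-1 * abs2 z + 2^-1 * abs2 z = abs2 z); last by field.
exact: abs2_psum.
Qed.

(** The functions f such that e^(-|z|^2/2) f belongs to the space. *)
Definition fock_fun f := [/\ forall p, cdiff f p, cmeas f &
  rintble (fun w => gaussian 1 w * abs2 (f w))].

Lemma fock_bounded f : fock_fun f -> exists2 K : R, 0 <= K &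
  (forall N z, modulus (psum (fcoef f) N z) <= K * expR (2^-1 * abs2 z)) /\
  (forall z, modulus (f z) <= K * expR (2^-1 * abs2 z)).
Proof.
move=> [df mf i2]; set M := Rint (fun w => gaussian 1 w * abs2 (f w)).
exists (Num.sqrt (M / pi)); first exact: sqrtr_ge0.
have h N z : modulus (psum (fcoef f) N z) <= Num.sqrt (M / pi) * expR (2^-1 * abs2 z).
  by apply: modulus_psum_le; exact: bessel.
by split=> // z; apply: (modulus_lim_le (fun N => h N z)); exact: fock_expansion.
Qed.

(** A product of two normalised monomials is a monomial of degree S whose constant
    is, up to sqrt (pi / 2^S), the square root of a binomial weight. *)
Lemma sqrt_binw S i : (i <= S)%N -> Num.sqrt (binw S i) =
  Num.sqrt pi * mono_norm S / (mono_norm i * mono_norm (S - i)%N * Num.sqrt (2 ^+ S)) :> R.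
Proof.
move=> iS; have p0 : 0 < pi :> R := pi_gt0 R.
have q0 : 0 < 2 ^+ S :> R by rewrite exprn_gt0.
have fac (n : nat) : n`!%:R != 0 :> R by rewrite pnatr_eq0 -lt0n fact_gt0.
set X := RHS; have X0 : 0 <= X.
  by rewrite /X divr_ge0 ?mulr_ge0 ?sqrtr_ge0.
rewrite -(ger0_norm X0) -sqrtr_sqr; congr Num.sqrt; rewrite /X expr_div_n !exprMn !mono_norm_sqr.
rewrite !sqr_sqrtr ?ltW// /binw -(bin_fact iS) !natrM.
move: (fac i) (fac (S - i)%N) (lt0r_neq0 p0) (lt0r_neq0 q0).
move: (i`!%:R : R) (_`!%:R : R) (2 ^+ S : R) (pi : R) => x y q p x0 y0 pn qn.
by field; rewrite x0 y0 pn qn.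
Qed.

Lemma amp1E c S : amp1 c S = (Num.sqrt pi * mono_norm S / Num.sqrt (2 ^+ S))%:C *
  \sum_(i < S.+1) c i * c (S - i)%N * ((mono_norm i)^-1 * (mono_norm (S - i)%N)^-1)%:C.
Proof.
rewrite /amp1 /amp mulr_sumr; apply: eq_bigr => i _.
rewrite sqrt_binw -1?ltnS// mul1r invfM invfM [in RHS]mulrCA -[in RHS]rmorphM/= mulrC; congr (_ * _%:C).
by ring.
Qed.

(** The square of u lives in the space with weight e^(-2|z|^2), whose monomials of
    degree S have squared norm pi S! / 2^(S+1): this is where the powers of 2 of
    the binomial weights come from. *)
Lemma square_moment f S : fock_fun f ->
  cintble (fun w => (mono S w)^* * ((gaussian 2 w)%:C * f w ^+ 2)) /\
  Cintegral (fun w => (mono S w)^* * ((gaussian 2 w)%:C * f w ^+ 2)) =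
  ((2 * Num.sqrt pi * Num.sqrt (2 ^+ S))^-1)%:C * amp1 (fcoef f) S.
Proof.
move=> ff; have [df mf i2] := ff; have [K K0 [PK fK]] := fock_bounded ff.
have E (x : R) z : x <= K * expR (2^-1 * abs2 z) -> 0 <= x -> x ^+ 2 <= K ^+ 2 * expR (1 * abs2 z).
  move=> xK x0; apply: le_trans (_ : (K * expR (2^-1 * abs2 z)) ^+ 2 <= _).
    by rewrite lerXn2r ?nnegrE ?(le_trans x0).
  rewrite exprMn; apply: eq_ler; congr (_ * _).
  by rewrite expr2 -expRD; congr expR; field.
set c := fcoef f.
have b12 : 1 < 2 :> R by rewrite ltr1n.
have [||||ci] := @weighted_limit R 2 1 (K ^+ 2) S (fun N w => psum c N w ^+ 2) (fun w => f w ^+ 2) b12 (sqr_ge0 K).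
- by move=> N; apply: cmeasX; exact: cmeas_psum.
- exact: cmeasX.
- by move=> N w; rewrite modulusX; apply: E => //; exact: modulus_ge0.
- move=> w; under eq_fun do rewrite !expr2.
  by apply: (modulus_cvgM (fun N => PK N w)); exact: fock_expansion.
pose L := ((2 * Num.sqrt pi * Num.sqrt (2 ^+ S))^-1)%:C * amp1 c S.
rewrite -/L => /(cvg_const_eventually (n0 := S)) h; split=> //.
apply/esym/modulusB_eq0/h => N SN; congr (modulus (_ - _)).
(* For N > S all the pairs i + j = S occur in the square of the partial sum. *)
pose d (ij : 'I_N * 'I_N) := c ij.1 * c ij.2 * ((mono_norm ij.1)^-1 * (mono_norm ij.2)^-1)%:C.
pose e (ij : 'I_N * 'I_N) := (ij.1 + ij.2)%N.
have -> : (fun w => (mono S w)^* * ((gaussian 2 w)%:C * psum c N w ^+ 2)) =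
    (fun w => (mono S w)^* * ((gaussian 2 w)%:C * \sum_(ij <- index_enum _) d ij * w ^+ e ij)).
  apply/funext => w; congr (_ * (_ * _)).
  rewrite expr2 {1}/psum mulr_suml.
  rewrite -(pair_bigA _ (fun i j => d (i, j) * w ^+ e (i, j)))/=; apply: eq_bigr => i _.
  rewrite /psum mulr_sumr; apply: eq_bigr => j _.
  by rewrite /d /e /mono exprD rmorphM/=; ring.
rewrite mono_moment_sum// /L amp1E.
have -> : \sum_(ij <- index_enum _ | e ij == S) d ij =
    \sum_(i < S.+1) c i * c (S - i)%N * ((mono_norm i)^-1 * (mono_norm (S - i)%N)^-1)%:C.
  transitivity (\sum_(i < N) \sum_(j < N | (i + j)%N == S) d (i, j)).
    by rewrite pair_big_dep.
  rewrite (big_ord_widen N (fun i => c i * c (S - i)%N * ((mono_norm i)^-1 * (mono_norm (S - i)%N)^-1)%:C))// big_mkcond [RHS]big_mkcond/=.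
  apply: eq_bigr => i _; rewrite ltnS; case: leqP => iS.
    have SiN : (S - i < N)%N by apply: leq_ltn_trans (leq_subr _ _) SN.
    rewrite (bigD1 (Ordinal SiN))/= ?subnKC// big1 ?addr0// => j /andP[/eqP jS /eqP jn].
    by exfalso; apply: jn; apply/val_inj; rewrite /= -jS addKn.
  by rewrite big1// => j /eqP jS; move: iS; rewrite -jS ltnNge leq_addr.
rewrite mulrA -rmorphM/=; congr (_%:C * _).
have p0 : 0 < pi :> R := pi_gt0 R.
have q0 : 0 < 2 ^+ S :> R by rewrite exprn_gt0.
have sq0 : Num.sqrt (2 ^+ S) != 0 :> R by rewrite gt_eqF ?sqrtr_gt0.
have sp0 : Num.sqrt pi != 0 :> R by rewrite gt_eqF ?sqrtr_gt0.
rewrite exprS -{1}(sqr_sqrtr (ltW q0)).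
by field; rewrite sq0 sp0.
Qed.

(** The pairing of f^2 with a product of two basis monomials depends on their
    degrees n, m only through n + m and the constant of the product. *)
Lemma pair_moment f n m : fock_fun f ->
  cintble (fun w => (mono n w)^* * ((gaussian 2 w)%:C * ((mono m w)^* * f w ^+ 2))) /\
  Cintegral (fun w => (mono n w)^* * ((gaussian 2 w)%:C * ((mono m w)^* * f w ^+ 2))) =
  ((2 * pi)^-1)%:C * (Num.sqrt (binw (n + m) n))%:C * amp1 (fcoef f) (n + m).
Proof.
move=> ff.
pose r := mono_norm (n + m) / (mono_norm n * mono_norm m) : R.
have -> : (fun w => (mono n w)^* * ((gaussian 2 w)%:C * ((mono m w)^* * f w ^+ 2))) =
    (fun w => r%:C * ((mono (n + m) w)^* * ((gaussian 2 w)%:C * f w ^+ 2))).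
  apply/funext => w; rewrite !mono_conj exprD.
  have -> : r%:C = ((mono_norm n)^-1)%:C * ((mono_norm m)^-1)%:C * (mono_norm (n + m))%:C.
    by rewrite /r -!rmorphM/=; congr (_%:C); rewrite invfM mulrC.
  have h : (mono_norm (n + m))%:C * ((mono_norm (n + m))^-1)%:C = 1 :> C.
    by rewrite -rmorphM/= divff// mono_norm_neq0.
  rewrite -[LHS]mul1r -h; ring.
have [ci me] := square_moment (n + m) ff; split; first exact: cintbleZ.
rewrite CintegralZ// me mulrA -!rmorphM/=; congr (_%:C * _).
rewrite sqrt_binw ?leq_addr// addKn /r.
have p0 : 0 < pi :> R := pi_gt0 R.
have q0 : 0 < 2 ^+ (n + m) :> R by rewrite exprn_gt0.
have sq0 : Num.sqrt (2 ^+ (n + m)) != 0 :> R by rewrite gt_eqF ?sqrtr_gt0.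
have sp0 : Num.sqrt pi != 0 :> R by rewrite gt_eqF ?sqrtr_gt0.
have {2}-> : pi = Num.sqrt pi ^+ 2 :> R by rewrite sqr_sqrtr// ltW.
by field; rewrite sq0 sp0 !mono_norm_neq0.
Qed.

End CubicTerm.

Section CubicRate.
Context {R : realType}.
Local Notation C := R[i].
Implicit Types (f F u g : C -> C) (w z p : C) (a b : R) (c : nat -> C).

(** For u = e^(-|z|^2/2) f, this is |u|^2 u divided by e^(-|z|^2/2). *)
Definition cubic f w : C := (gaussian 1 w)%:C * ((f w)^* * f w ^+ 2).

Lemma cubicE f w : (f w)^* * f w ^+ 2 = (abs2 (f w))%:C * f w.
Proof. by rewrite expr2 abs2C mulrA. Qed.

Lemma cmeas_cubic f : cmeas f -> cmeas (cubic f).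
Proof.
move=> mf; apply: cmeasM; first exact: cmeas_gaussian.
by apply: cmeasM; [exact: cmeasJ|exact: cmeasX].
Qed.

Lemma expR_half_pow (K : R) z n : (K * expR (2^-1 * abs2 z)) ^+ n =
  K ^+ n * expR (n%:R / 2 * abs2 z).
Proof. by rewrite exprMn -expRM_natl; congr (_ * expR _); rewrite -mulr_natl mulrA. Qed.

Lemma cubic_L2 f : fock_fun f -> rintble (fun w => gaussian 1 w * abs2 (cubic f w)).
Proof.
move=> ff; have [df mf i2] := ff; have [K K0 [PK fK]] := fock_bounded ff.
apply: (rintble_le _ _ (rintbleZ (K ^+ 4) i2)).
  by apply: rmeasM; [exact: rmeas_gaussian|apply: rmeas_abs2; exact: cmeas_cubic].
move=> w; rewrite ger0_norm ?mulr_ge0 ?expR_ge0 ?abs2_ge0// mulrCA.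
apply: ler_wpM2l; first exact: expR_ge0.
rewrite /cubic cubicE !abs2M !abs2_real mulrA; apply: ler_wpM2r; first exact: abs2_ge0.
apply: (@le_trans _ _ (gaussian 1 w ^+ 2 * (K ^+ 4 * expR (4%:R / 2 * abs2 w)))).
  apply: ler_wpM2l; first exact: sqr_ge0.
  rewrite -expR_half_pow -modulus_sqr -exprM.
  by rewrite lerXn2r ?nnegrE ?modulus_ge0 ?mulr_ge0 ?expR_ge0.
rewrite mulrCA /gaussian expr2 -!expRD.
rewrite (_ : -1 * abs2 w + -1 * abs2 w + 4%:R / 2 * abs2 w = 0) ?expR0 ?mulr1//.
by field.
Qed.

Lemma cubic_kernel_integrable f b : fock_fun f ->
  rintble (fun w => expR (b * modulus w) * modulus ((gaussian 1 w)%:C * cubic f w)).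
Proof.
move=> ff; have [df mf i2] := ff.
have := @rintble_exp_weight R 1 b 1 _ ltr01 ler01 (cmeas_cubic mf) (cubic_L2 ff).
by congr rintble; apply/funext => w; rewrite mul1r modulus_gaussianM.
Qed.

(** Here conj f is expanded inside the integral of conj f f^2, so that only
    moments of f^2 remain; both f and its partial sums are O(e^(|z|^2/2)), and the
    cubic expression is dominated by e^(3|z|^2/2) against the weight e^(-2|z|^2). *)
Lemma cubic_series f n : fock_fun f ->
  (fun N => modulus (\sum_(m < N) (fcoef f m)^* *
     (((2 * pi)^-1)%:C * (Num.sqrt (binw (n + m) n))%:C * amp1 (fcoef f) (n + m)) -
     fcoef (cubic f) n)) @ \oo --> (0 : R).
Proof.
move=> ff; have [df mf i2] := ff; have [K K0 [PK fK]] := fock_bounded ff.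
set c := fcoef f.
have b32 : 3 / 2 < 2 :> R by lra.
have K3 : 0 <= K ^+ 3 by rewrite exprn_ge0.
have mP g : cmeas g -> cmeas (fun w => (g w)^* * f w ^+ 2).
  by move=> mg; apply: cmeasM; [exact: cmeasJ|exact: cmeasX].
have [||||_] := @weighted_limit R 2 (3 / 2) (K ^+ 3) n
  (fun N w => (psum c N w)^* * f w ^+ 2) (fun w => (f w)^* * f w ^+ 2) b32 K3.
- by move=> N; apply: mP; exact: cmeas_psum.
- exact: mP.
- move=> N w; rewrite modulusM modulusJ modulusX -expR_half_pow [leRHS]exprS.
  by rewrite ler_pM ?exprn_ge0 ?modulus_ge0// lerXn2r ?nnegrE ?modulus_ge0 ?mulr_ge0 ?expR_ge0.
- move=> w; apply: (modulus_cvgM (B := K * expR (2^-1 * abs2 w))).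
  + by move=> N; rewrite modulusJ.
  + have -> : (fun N => modulus ((psum c N w)^* - (f w)^*)) = (fun N => modulus (psum c N w - f w)).
      by apply/funext => N; rewrite -[RHS]modulusJ rmorphB.
    exact: fock_expansion.
  + by under eq_fun do rewrite subrr modulus0; exact: cvg_cst.
have -> : fcoef (cubic f) n =
    Cintegral (fun w => (mono n w)^* * ((gaussian 2 w)%:C * ((f w)^* * f w ^+ 2))).
  congr Cintegral; apply/funext => w; congr (_ * _).
  by rewrite /cubic mulrA -rmorphM/= -gaussianD.
move=> hh; apply: cvg_trans hh; apply: near_eq_cvg; apply: nearW => N; congr (modulus (_ - _)).
pose T (m : 'I_N) w := (c m)^* * ((mono n w)^* * ((gaussian 2 w)%:C * ((mono m w)^* * f w ^+ 2))) : C.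
have iT0 m := (pair_moment n m ff).1.
have iT m : cintble (T m) by exact: cintbleZ.
have -> : (fun w => (mono n w)^* * ((gaussian 2 w)%:C * ((psum c N w)^* * f w ^+ 2))) =
    (fun w => \sum_(m <- index_enum 'I_N) T m w).
  apply/funext => w; rewrite /psum conjc_sum mulr_suml !mulr_sumr.
  by apply: eq_bigr => m _; rewrite /T conjM; ring.
rewrite (Cintegral_bigsum _ iT).2; apply: eq_bigr => m _.
by rewrite /T CintegralZ// (pair_moment n m ff).2.
Qed.

Lemma Im_cvg (P : nat -> C) (l : C) : (fun N => modulus (P N - l)) @ \oo --> (0 : R) ->
  (fun N => complex.Im (P N)) @ \oo --> complex.Im l.
Proof.
by apply: cvg_of_le => N; rewrite -raddfB; exact: Im_le_modulus.
Qed.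

Lemma rate_term_shift c n m (r : R) :
  complex.Im ((c n)^* * ((c m)^* * (r%:C * (Num.sqrt (binw (n + m) n))%:C * amp1 c (n + m)))) =
  r * rate_term c n (n + m).
Proof.
rewrite /rate_term leq_addr addKn -ImZ; congr complex.Im.
by rewrite !conjM conjcR; ring.
Qed.

(** The sum over the partner m of mode n is a sum over the degree S = n + m. *)
Lemma rate_sum_shift c n N (r : R) :
  complex.Im ((c n)^* * \sum_(m < N) (c m)^* *
    (r%:C * (Num.sqrt (binw (n + m) n))%:C * amp1 c (n + m))) =
  r * \sum_(S < N + n) rate_term c n S.
Proof.
rewrite addnC big_split_ord/= [X in _ * (X + _)]big1 ?add0r => [|i _]; last first.
  by rewrite /rate_term leqNgt ltn_ord.
rewrite mulr_sumr raddf_sum mulr_sumr; apply: eq_bigr => m _.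
exact: rate_term_shift.
Qed.

Lemma cubic_rate f n : fock_fun f ->
  (fun L => (2 * pi)^-1 * \sum_(S < L) rate_term (fcoef f) n S) @ \oo -->
    complex.Im ((fcoef f n)^* * fcoef (cubic f) n).
Proof.
move=> ff; set c := fcoef f; set d := fcoef (cubic f) n.
pose X N := \sum_(m < N) (c m)^* *
     (((2 * pi)^-1)%:C * (Num.sqrt (binw (n + m) n))%:C * amp1 c (n + m)).
have Xd : (fun N => modulus ((c n)^* * X N - (c n)^* * d)) @ \oo --> (0 : R).
  rewrite -[X in _ --> X](mulr0 (modulus (c n)^*)).
  have -> : (fun N => modulus ((c n)^* * X N - (c n)^* * d)) =
    (fun N => modulus (c n)^* * modulus (X N - d)).
    by apply/funext => N; rewrite -mulrBr modulusM.
  by apply: cvgMl_tmp; exact: cubic_series.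
pose u L := (2 * pi)^-1 * \sum_(S < L) rate_term c n S : R.
have E : (fun N => complex.Im ((c n)^* * X N)) = (fun N => u (N + n)%N).
  by apply/funext => N; exact: rate_sum_shift.
by have := Im_cvg Xd; rewrite E (cvg_shiftn n u).
Qed.

(** The projection is the integral of e^(conj(w) z) against the cubic term. Its
    expansion in z has the moments of the cubic term as coefficients, and these
    are square summable by the Bessel inequality, so the series is dominated and
    its coefficients are those of its sum. *)
Lemma cubic_projection f v n : fock_fun f -> fock_fun v ->
  (forall z, Cintegral (fun w => cexp (w^* * z) * ((gaussian 1 w)%:C * cubic f w)) = pi%:C * v z) ->
  fcoef v n = fcoef (cubic f) n.
Proof.
move=> ff fv hv; have [df mf i2] := ff; have [dv mv iv2] := fv.
have mF : cmeas (fun w => (gaussian 1 w)%:C * cubic f w).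
  by apply: cmeasM; [exact: cmeas_gaussian|exact: cmeas_cubic].
have hN N := bessel N (cmeas_cubic mf) (cubic_L2 ff).
apply: (@series_coefficient R 2^-1 (Num.sqrt (Rint (fun w => gaussian 1 w * abs2 (cubic f w)) / pi)) (fcoef (cubic f))) => //.
- by rewrite invf_lt1 ?ltr1n.
- by move=> N w; exact: modulus_psum_le.
- by move=> w; apply: (kernel_expansion mF (fun b => cubic_kernel_integrable b ff)); exact: hv.
Qed.

End CubicRate.

(** * Weighted norms and coefficients *)

Section WeightedNorm.
Context {R : realType}.
Local Notation C := R[i].
Local Notation plane := (measurableTypeR R * measurableTypeR R)%type.
Local Notation mu := (@dL R).
Implicit Types (f F u g : C -> C) (w z p : C) (a b : R) (c : nat -> C).

Lemma fatou_bound (h : nat -> C -> R) (H : C -> R) (B : R) :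
  (forall N, rintble (h N)) -> (forall N z, 0 <= h N z) -> (forall N, Rint (h N) <= B) ->
  (forall z, (fun N => h N z) @ \oo --> H z) ->
  (\int[mu]_p (on_plane H p)%:E <= B%:E)%E.
Proof.
move=> ih h0 hB hH.
have mh N : measurable_fun setT (fun p : plane => (on_plane (h N) p)%:E).
  by apply/measurable_EFinP; exact: rintble_meas.
have h0' N (p : plane) : setT p -> (0 <= (on_plane (h N) p)%:E)%E by move=> _; rewrite lee_fin; exact: h0.
have := fatou mu measurableT mh h0'.
rewrite (eq_integral (fun p : plane => (on_plane H p)%:E)); last first.
  move=> p _; have hc : (fun N => (on_plane (h N) p)%:E) @ \oo --> (on_plane H p)%:E.
    by apply: cvg_EFin; [exact: nearW|exact: hH].
  have cv : cvgn (fun N => (on_plane (h N) p)%:E) by apply/cvg_ex; eexists; exact: hc.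
  by rewrite (is_cvg_limn_einfE cv); apply/cvg_lim.
move=> /le_trans; apply; rewrite limn_einf_lim; apply: lime_le; first exact: is_cvg_einfs.
apply: nearW => n; apply: (@le_trans _ _ (Rint (h n))%:E); last by rewrite lee_fin.
rewrite -RintE//; apply: ereal_inf_lbound; exists n => //=.
Qed.

Lemma risingS n k : rising n k.+1 = rising n k * (n + k.+1)%:R :> R.
Proof. by rewrite /rising addnS factS natrM; ring. Qed.

Lemma rising_ge n k : n%:R ^+ k <= rising n k :> R.
Proof.
elim: k => [|k IH].
  by rewrite expr0 /rising addn0 divff// pnatr_eq0 -lt0n fact_gt0.
rewrite risingS exprSr ler_pM ?exprn_ge0//.
by rewrite ler_nat leq_addr.
Qed.

Lemma rising_ge0 n k : 0 <= rising n k :> R.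
Proof. by apply: le_trans (rising_ge n k); rewrite exprn_ge0. Qed.

Lemma rising_le n k : rising n k <= k.+1%:R ^+ k * (1 + n%:R ^+ k) :> R.
Proof.
have h : rising n k <= (n + k)%:R ^+ k :> R.
  suff h j : (j <= k)%N -> rising n j <= (n + k)%:R ^+ j :> R by exact: h.
  elim: j => [_|j IH jk].
    by rewrite expr0 /rising addn0 divff// pnatr_eq0 -lt0n fact_gt0.
  rewrite risingS exprSr ler_pM ?rising_ge0 ?IH 1?ltnW//.
  by rewrite ler_nat leq_add2l.
apply: le_trans h _; case: n => [|n].
  rewrite add0n; apply: (@le_trans _ _ (k.+1%:R ^+ k)).
    by rewrite lerXn2r ?nnegrE// ler_nat.
  by rewrite ler_peMr ?exprn_ge0// lerDl exprn_ge0.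
apply: (@le_trans _ _ ((k.+1%:R * n.+1%:R) ^+ k)).
  rewrite lerXn2r ?nnegrE ?mulr_ge0// -natrM ler_nat.
  by rewrite mulSn leq_add2l leq_pmulr.
by rewrite exprMn ler_wpM2l ?exprn_ge0// lerDr.
Qed.

Lemma modulus_quarter z : modulus z <= 1 + 4^-1 * abs2 z.
Proof.
rewrite -subr_ge0 -modulus_sqr.
rewrite (_ : 1 + 4^-1 * modulus z ^+ 2 - modulus z = (modulus z / 2 - 1) ^+ 2); last by field.
exact: sqr_ge0.
Qed.

(** Multiplication by z^k shifts the basis, up to the ratio of the norms. *)
Lemma fcoef_shift f k n : fock_fun f ->
  fcoef (fun w => w ^+ k * f w) (n + k) = (mono_norm (n + k) / mono_norm n)%:C * fcoef f n.
Proof.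
move=> ff; have [df mf i2] := ff; have [K K0 [PK fK]] := fock_bounded ff.
set c := fcoef f.
have b34 : 3 / 4 < 1 :> R by lra.
pose K' := k`!%:R * expR 1 * K.
have K'0 : 0 <= K' by rewrite /K' !mulr_ge0 ?expR_ge0.
have mP g : cmeas g -> cmeas (fun w => w ^+ k * g w).
  by move=> mg; apply: cmeasM => //; exact: cmeas_pow.
have [||||_] := @weighted_limit R 1 (3 / 4) K' (n + k) (fun N w => w ^+ k * psum c N w)
  (fun w => w ^+ k * f w) b34 K'0.
- by move=> N; apply: mP; exact: cmeas_psum.
- exact: mP.
- move=> N w; rewrite modulusM modulusX.
  apply: (@le_trans _ _ (k`!%:R * expR (1 + 4^-1 * abs2 w) * (K * expR (2^-1 * abs2 w)))).
    rewrite ler_pM ?exprn_ge0 ?modulus_ge0//.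
    apply: le_trans (pow_le_expR k (modulus_ge0 w)) _.
    by rewrite ler_wpM2l// ler_expR; exact: modulus_quarter.
  rewrite (_ : 3 / 4 * abs2 w = 4^-1 * abs2 w + 2^-1 * abs2 w); last by field.
  by apply: eq_ler; rewrite /K' !expRD; ring.
- move=> w; rewrite -[X in _ --> X](mulr0 (modulus (w ^+ k))).
  have -> : (fun N => modulus (w ^+ k * psum c N w - w ^+ k * f w)) =
      (fun N => modulus (w ^+ k) * modulus (psum c N w - f w)).
    by apply/funext => N; rewrite -mulrBr modulusM.
  by apply: cvgMl_tmp; exact: fock_expansion.
pose L := (mono_norm (n + k) / mono_norm n)%:C * c n.
move/(cvg_const_eventually (n0 := n)) => /(_ (modulus (L - fcoef (fun w => w ^+ k * f w) (n + k)))) h.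
apply/esym/modulusB_eq0/h => N nN; congr (modulus (_ - _)).
have -> : (fun w => (mono (n + k) w)^* * ((gaussian 1 w)%:C * (w ^+ k * psum c N w))) =
  (fun w => (mono (n + k) w)^* * ((gaussian 1 w)%:C *
     \sum_(j <- index_enum 'I_N) (c j * (mono_norm j)^-1%:C) * w ^+ (j + k))).
  apply/funext => w; congr (_ * (_ * _)); rewrite psum_monomials mulr_sumr.
  by apply: eq_bigr => j _; rewrite exprD; ring.
rewrite mono_moment_sum// expr1n divr1.
under eq_bigl do rewrite eqn_add2r.
rewrite (@sum_ord_pick R N n (fun n => c n * (mono_norm n)^-1%:C))//.
by rewrite /L rmorphM/=; ring.
Qed.

(** Bessel's inequality for z^k f, whose coefficients are shifted by k. *)
Lemma weighted_bessel f k N : fock_fun f ->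
  rintble (fun w => gaussian 1 w * abs2 (w ^+ k * f w)) ->
  \sum_(n < N) rising n k * abs2 (fcoef f n) <=
    Rint (fun w => gaussian 1 w * abs2 (w ^+ k * f w)).
Proof.
move=> ff ik; have [df mf i2] := ff.
have mk : cmeas (fun w => w ^+ k * f w) by apply: cmeasM => //; exact: cmeas_pow.
apply: le_trans (bessel (k + N) mk ik).
rewrite big_split_ord/= -[leLHS]add0r lerD//.
  by apply: sumr_ge0 => i _; exact: abs2_ge0.
apply: ler_sum => n _; rewrite [(k + n)%N]addnC fcoef_shift// abs2M abs2_real.
rewrite ler_wpM2r ?abs2_ge0// expr_div_n !mono_norm_sqr /rising.
have p0 : pi != 0 :> R by rewrite gt_eqF ?pi_gt0.
apply: eq_ler.
have f0 : n`!%:R != 0 :> R by rewrite pnatr_eq0 -lt0n fact_gt0.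
by rewrite invfM mulrACA divff// mul1r.
Qed.

Lemma abs2_psum_cvg f z : fock_fun f ->
  (fun N => abs2 (psum (fcoef f) N z)) @ \oo --> abs2 (f z).
Proof.
move=> ff; have [df mf i2] := ff; have [K K0 [PK fK]] := fock_bounded ff.
have h := fock_expansion z df mf i2.
have hJ : (fun N => modulus ((psum (fcoef f) N z)^* - (f z)^*)) @ \oo --> (0 : R).
  have -> : (fun N => modulus ((psum (fcoef f) N z)^* - (f z)^*)) =
      (fun N => modulus (psum (fcoef f) N z - f z)).
    by apply/funext => N; rewrite -[RHS]modulusJ rmorphB.
  exact: h.
have hP : forall N, modulus ((psum (fcoef f) N z)^*) <= K * expR (2^-1 * abs2 z).
  by move=> N; rewrite modulusJ.
have hM := modulus_cvgM hP hJ h.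
apply: cvg_of_le hM => N; rewrite -!abs2C -rmorphB/= modulus_real//.
Qed.

End WeightedNorm.

(** * Conclusion *)

Section Conclusion.
Context {R : realType}.
Local Notation C := R[i].
Local Notation plane := (measurableTypeR R * measurableTypeR R)%type.
Local Notation mu := (@dL R).
Implicit Types (f F g u v : C -> C) (w z p : C) (a b : R) (c : nat -> C).

Lemma poweR_modulus2 u (p : plane) :
  ((`| on_plane (fun z => (modulus (u z))%:E) p | `^ 2) = (on_plane (fun z => abs2 (u z)) p)%:E)%E.
Proof.
rewrite /on_plane gee0_abs ?lee_fin ?modulus_ge0// poweR_EFin; congr EFin.
by rewrite powR_mulrn ?modulus_ge0// modulus_sqr.
Qed.

Lemma L2normE u : (L2norm u = (\int[mu]_p (on_plane (fun z => abs2 (u z)) p)%:E) `^ 2^-1)%E.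
Proof.
rewrite /L2norm unlock; congr (_ `^ _)%E.
by apply: eq_integral => p _; exact: poweR_modulus2.
Qed.

Lemma abs2_integral_ge0 u : (0 <= \int[mu]_p (on_plane (fun z => abs2 (u z)) p)%:E)%E.
Proof. by apply: integral_ge0 => p _; rewrite lee_fin abs2_ge0. Qed.

Lemma L2norm_le u (B : R) : 0 <= B ->
  (\int[mu]_p (on_plane (fun z => abs2 (u z)) p)%:E <= B%:E)%E ->
  (L2norm u <= (B `^ 2^-1)%:E)%E.
Proof.
move=> B0 h; rewrite L2normE -poweR_EFin; apply: gt0_ler_poweR => //.
- by rewrite in_itv/= abs2_integral_ge0 leey.
- by rewrite in_itv/= lee_fin B0 leey.
Qed.

Lemma L2norm_sqrt u : rintble (fun z => abs2 (u z)) ->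
  L2norm u = (Num.sqrt (Rint (fun z => abs2 (u z))))%:E.
Proof.
move=> iu; rewrite L2normE RintE// poweR_EFin powR12_sqrt//.
by apply: Rint_ge0 => z; exact: abs2_ge0.
Qed.

Lemma in_L2_integrable u : in_L2 u -> cmeas u /\ rintble (fun z => abs2 (u z)).
Proof.
move=> [mR mI fin]; have mu' : cmeas u by split.
split=> //; apply/integrableP; split.
  by apply/measurable_EFinP; exact: rmeas_abs2.
under eq_integral => p _ do rewrite gee0_abs ?lee_fin ?abs2_ge0//.
by move: fin; rewrite L2normE; apply: lty_poweRy; rewrite invr_eq0 pnatr_eq0.
Qed.

(** For u = e^(-|z|^2/2) f this recovers f. *)
Definition factor u z : C := (expR (2^-1 * abs2 z))%:C * u z.

Lemma gaussE z : gauss z = (gaussian 2^-1 z)%:C :> C.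
Proof. by rewrite /gauss /gaussian modulus_sqr; congr (expR _)%:C; rewrite mulrC mulNr. Qed.

Lemma factorK u z : (gaussian 2^-1 z)%:C * factor u z = u z.
Proof.
rewrite /factor mulrA -rmorphM/= /gaussian -expRD.
by rewrite (_ : _ + _ = 0) ?expR0 ?mul1r//; ring.
Qed.

Lemma abs2_factor u z : gaussian 1 z * abs2 (factor u z) = abs2 (u z).
Proof.
rewrite -[in RHS](factorK u z) abs2M abs2_real; congr (_ * _).
by rewrite expr2 -gaussianD; congr gaussian; field.
Qed.

Lemma cmeas_factor u : cmeas u -> cmeas (factor u).
Proof.
move=> mu'; apply: cmeasM => //; apply: cmeas_real; apply: rmeas_expR.
by apply: rmeasM; [exact: rmeas_cst|exact: rmeas_abs2 cmeas_id].
Qed.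

Lemma fock_fun_factor u : bargmann_fock u -> fock_fun (factor u).
Proof.
move=> [[f ef uf] /in_L2_integrable[mu' iu]]; split.
- have -> : factor u = f; last by move=> p; exact: derivable_cdiff (ef p).
  apply/funext => z; rewrite /factor uf gaussE mulrA -rmorphM/= /gaussian -expRD.
  by rewrite (_ : _ + _ = 0) ?expR0 ?mul1r//; ring.
- exact: cmeas_factor.
- by move: iu; congr rintble; apply/funext => z; rewrite abs2_factor.
Qed.

Lemma bargmann_fock_L2 u : bargmann_fock u -> cmeas u /\ rintble (fun z => abs2 (u z)).
Proof. by move=> [_ /in_L2_integrable]. Qed.

Lemma rintble_abs2B u v : cmeas u -> cmeas v ->
  rintble (fun z => abs2 (u z)) -> rintble (fun z => abs2 (v z)) ->
  rintble (fun z => abs2 (u z - v z)).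
Proof.
move=> mu' mv iu iv; apply: (rintble_le _ _ (rintbleZ 2 (rintbleD iu iv))).
  by apply: rmeas_abs2; exact: cmeasB.
move=> z; rewrite ger0_norm ?abs2_ge0//.
by have := abs2D_le (u z) (- v z); rewrite abs2N.
Qed.

Lemma fcoefB f g n : cmeas f -> cmeas g ->
  rintble (fun w => gaussian 1 w * abs2 (f w)) -> rintble (fun w => gaussian 1 w * abs2 (g w)) ->
  fcoef (fun w => f w - g w) n = fcoef f n - fcoef g n.
Proof.
move=> mf mg hf hg; rewrite /fcoef -CintegralB; try exact: cintble_mono_weight.
by congr Cintegral; apply/funext => w; rewrite !mulrBr.
Qed.

Lemma fcoefZ (k : C) f n : cmeas f -> rintble (fun w => gaussian 1 w * abs2 (f w)) ->
  fcoef (fun w => k * f w) n = k * fcoef f n.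
Proof.
move=> mf hf; rewrite /fcoef -CintegralZ; last exact: cintble_mono_weight.
by congr Cintegral; apply/funext => w; ring.
Qed.

(** Bessel's inequality for the difference quotient minus its limit. *)
Lemma abs2_coef_diff (r : R) u v g N : bargmann_fock u -> bargmann_fock v -> bargmann_fock g ->
  ((\sum_(n < N) abs2 (r%:C * (fcoef (factor u) n - fcoef (factor v) n) - fcoef (factor g) n))%:E <=
   (L2norm (fun z => (r%:C * (u z - v z) - g z)%R) `^ 2))%E.
Proof.
move=> bu bv bg; have [[[mu' iu] [mv iv]] [mg ig]] :=
  (bargmann_fock_L2 bu, bargmann_fock_L2 bv, bargmann_fock_L2 bg).
have [_ mfu ifu] := fock_fun_factor bu; have [_ mfv ifv] := fock_fun_factor bv.
have [_ mfg ifg] := fock_fun_factor bg.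
pose D z := r%:C * (u z - v z) - g z : C.
have iuv := rintble_abs2B mu' mv iu iv.
have mr : cmeas (fun z => r%:C * (u z - v z)).
  by apply: cmeasM; [exact: cmeas_cst|exact: cmeasB].
have ir : rintble (fun z => abs2 (r%:C * (u z - v z))).
  have := rintbleZ (r ^+ 2) iuv; congr rintble; apply/funext => z.
  by rewrite abs2M abs2_real.
have iD : rintble (fun z => abs2 (D z)) by exact: rintble_abs2B.
have mD : cmeas D by exact: cmeasB.
have toF x : cmeas x -> rintble (fun z => abs2 (x z)) ->
    rintble (fun w => gaussian 1 w * abs2 (factor x w)).
  by move=> _; congr rintble; apply/funext => z; rewrite abs2_factor.
rewrite L2norm_sqrt// poweR_EFin lee_fin powR_mulrn ?sqrtr_ge0// sqr_sqrtr; last first.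
  by apply: Rint_ge0 => z; exact: abs2_ge0.
have := bessel N (cmeas_factor mD) (toF _ mD iD).
rewrite [X in _ <= Rint X](_ : _ = fun z => abs2 (D z)); last first.
  by apply/funext => z; rewrite abs2_factor.
apply: le_trans; apply: eq_ler; apply: eq_bigr => n _.
congr abs2.
have -> : factor D = (fun z => r%:C * (factor u z - factor v z) - factor g z).
  by apply/funext => z; rewrite /factor /D; ring.
have muv := cmeasB mu' mv.
have E : (fun z => factor u z - factor v z) = factor (fun z => u z - v z).
  by apply/funext => z; rewrite /factor; ring.
have Er : (fun z => r%:C * (factor u z - factor v z)) = factor (fun z => r%:C * (u z - v z)).
  by apply/funext => z; rewrite /factor; ring.
rewrite fcoefB//; last 2 first.
- by rewrite Er; exact: cmeas_factor.
- by rewrite (_ : (fun w => _) = fun w => gaussian 1 w * abs2 (factor (fun z => r%:C * (u z - v z)) w)) ?toF// -Er.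
rewrite fcoefZ; last 2 first.
- by rewrite E; exact: cmeas_factor.
- by rewrite (_ : (fun w => _) = fun w => gaussian 1 w * abs2 (factor (fun z => u z - v z) w)) ?toF// -E.
by rewrite fcoefB.
Qed.

Lemma mass_factor u : bargmann_fock u ->
  exists M : R, forall N, \sum_(n < N) abs2 (fcoef (factor u) n) <= M.
Proof.
move=> /fock_fun_factor[_ mf i2]; eexists => N; exact: (bessel N mf i2).
Qed.

Lemma coef_derivative (U : R -> C -> C) t v (e : R) : 0 < e ->
  (forall s, bargmann_fock (U s)) -> bargmann_fock v -> fock_derive U t v ->
  exists2 d : R, 0 < d & forall h : R, 0 < `|h| < d -> forall N,
    \sum_(n < N) abs2 ((h^-1)%:C * (fcoef (factor (U (t + h))) n - fcoef (factor (U t)) n) -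
      fcoef (factor v) n) <= e.
Proof.
move=> e0 bU bv dU.
have s0 : 0 < Num.sqrt e by rewrite sqrtr_gt0.
have := dU _ (@nbhs_open_ereal_lt R 0 (fun=> Num.sqrt e) s0).
rewrite /= => /nbhs_ballP[d /= d0 hd]; exists d => // h /andP[h0 hlt] N.
have {hd} : (L2norm (fun z => ((h^-1)%:C * (U (t + h) z - U t z) - v z)%R) < (Num.sqrt e)%:E)%E.
  apply: hd; last by rewrite -normr_gt0.
  by rewrite /ball/= sub0r normrN.
move=> hlt2; rewrite -lee_fin; apply: le_trans (abs2_coef_diff _ _ (bU _) (bU _) bv) _.
have -> : e%:E = ((Num.sqrt e)%:E `^ 2)%E.
  by rewrite poweR_EFin powR_mulrn ?sqrtr_ge0// sqr_sqrtr// ltW.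
apply: gt0_ler_poweR => //; last exact: ltW.
- by rewrite in_itv/= leey andbT Lnorm_ge0.
- by rewrite in_itv/= leey andbT lee_fin ltW.
Qed.

(** The Gaussian factors of the kernel and of |u|^2 u combine into e^(-2|w|^2), and
    the factor in z cancels. *)
Lemma coef_equation u v n : bargmann_fock u -> bargmann_fock v ->
  (forall z, 'i%C * v z = fock_proj (fun w => (modulus (u w) ^+ 2)%:C * u w) z) ->
  'i%C * fcoef (factor v) n = fcoef (cubic (factor u)) n.
Proof.
move=> bu bv eqn; have fu := fock_fun_factor bu; have fv := fock_fun_factor bv.
have [dv mv iv] := fv.
rewrite -fcoefZ//; apply: cubic_projection => //.
  split.
  - move=> p; apply: cdiff_mul => //; have := @cdiff_affine R 0 'i%C p.
    by congr cdiff; apply/funext => z; rewrite mul0r add0r.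
  - by apply: cmeasM => //; exact: cmeas_cst.
  - move: iv; congr rintble; apply/funext => w; rewrite abs2M.
    by rewrite [abs2 'i%C](_ : _ = 1) ?mul1r// /abs2 /= expr0n add0r expr1n.
move=> z; have := eqn z; rewrite /fock_proj gaussE -[v z]factorK.
set X := Cintegral _; set Y := Cintegral _.
have -> : X = Y.
  rewrite /X /Y; congr Cintegral; apply/funext => w.
  have -> : cexp (w^* * z - (modulus w ^+ 2 / 2)%:C) = cexp (w^* * z) * (gaussian 2^-1 w)%:C.
    rewrite cexpD -rmorphN/= cexp_real modulus_sqr /gaussian.
    by congr (_ * (expR _)%:C); rewrite mulrC mulNr.
  rewrite /cubic cubicE modulus_sqr -(abs2_factor u w) -[u w]factorK.
  have -> : gaussian 1 w = gaussian 2^-1 w * gaussian 2^-1 w.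
    by rewrite -gaussianD; congr gaussian; field.
  by rewrite !rmorphM/=; ring.
have g0 : (gaussian 2^-1 z)%:C != 0 :> C by rewrite eq_complex/= eqxx andbT gt_eqF ?expR_gt0.
have pC : pi%:C * (pi^-1)%:C = 1 :> C.
  by rewrite -rmorphM/= divff// gt_eqF ?pi_gt0.
move=> h; apply: (mulfI g0).
transitivity (pi%:C * ((pi^-1)%:C * (gaussian 2^-1 z)%:C * Y)).
  by rewrite !mulrA pC mul1r.
by rewrite -h; ring.
Qed.

(** Partial sums satisfy the bound by orthogonality, using
    (1 + x)^k <= 2^k (1 + x^k), and the lemma of Fatou removes the truncation. *)
Lemma bracket_upper f k (B0 Bk : R) : fock_fun f ->
  (forall N, \sum_(n < N) rising n 0 * abs2 (fcoef f n) <= B0) ->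
  (forall N, \sum_(n < N) rising n k * abs2 (fcoef f n) <= Bk) ->
  (\int[mu]_p (on_plane (fun w => (1 + abs2 w) ^+ k * (gaussian 1 w * abs2 (f w)))%R p)%:E
    <= (2 ^+ k * (B0 + Bk))%:E)%E.
Proof.
move=> ff hB0 hBk; set c := fcoef f.
pose A j N w := gaussian 1 w * (modulus w ^+ j.*2 * abs2 (psum c N w)) : R.
pose T N w := 2 ^+ k * (A 0 N w + A k N w) : R.
pose h N w := (1 + abs2 w) ^+ k * (gaussian 1 w * abs2 (psum c N w)) : R.
have iT N : rintble (T N).
  by apply: rintbleZ; apply: rintbleD; [exact: (psum_moment _ N 0).1|exact: (psum_moment _ N k).1].
have h0 N w : 0 <= h N w.
  by rewrite /h !mulr_ge0 ?exprn_ge0 ?expR_ge0 ?abs2_ge0// addr_ge0 ?abs2_ge0.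
have hT N w : h N w <= T N w.
  have -> : T N w = 2 ^+ k * (1 + abs2 w ^+ k) * (gaussian 1 w * abs2 (psum c N w)).
    rewrite /T /A expr0 (_ : modulus w ^+ k.*2 = abs2 w ^+ k); first by ring.
    by rewrite -modulus_sqr -exprM mul2n.
  apply: ler_wpM2r; first by rewrite mulr_ge0 ?expR_ge0 ?abs2_ge0.
  have x0 := abs2_ge0 w; move: (abs2 w) x0 => x x0.
  have [x1|x1] := leP x 1.
    apply: (@le_trans _ _ (2 ^+ k)).
      rewrite lerXn2r ?nnegrE ?addr_ge0//; lra.
    by rewrite ler_peMr ?exprn_ge0// lerDl exprn_ge0.
  apply: (@le_trans _ _ ((2 * x) ^+ k)).
    by rewrite lerXn2r ?nnegrE ?addr_ge0 ?mulr_ge0//; lra.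
  by rewrite exprMn ler_wpM2l ?exprn_ge0// lerDr.
have ih N : rintble (h N).
  apply: (rintble_le _ _ (iT N)); last by move=> w; rewrite ger0_norm.
  apply: rmeasM; last by apply: rmeasM; [exact: rmeas_gaussian|apply: rmeas_abs2; exact: cmeas_psum].
  apply: (@rmeas_comp R (fun x => x ^+ k)); first exact: exprn_measurable.
  by apply: rmeasD; [exact: rmeas_cst|exact: rmeas_abs2 cmeas_id].
apply: (fatou_bound ih h0) => [N|z].
  apply: le_trans (Rint_le (ih N) (iT N) (hT N)) _.
  have i0 := (psum_moment c N 0).1; have ik := (psum_moment c N k).1.
  rewrite RintZ ?RintD//; last exact: rintbleD.
  rewrite (psum_moment _ N 0).2 (psum_moment _ N k).2.
  by rewrite ler_wpM2l ?exprn_ge0// lerD.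
by apply: cvgMl_tmp; apply: cvgMl_tmp; exact: abs2_psum_cvg.
Qed.

Lemma abs2_bracket u k z : abs2 ((bracket z ^+ k)%:C * u z) = (1 + abs2 z) ^+ k * abs2 (u z).
Proof.
rewrite abs2M abs2_real -exprM mulnC exprM /bracket sqr_sqrtr ?modulus_sqr//.
by rewrite addr_ge0 ?abs2_ge0 ?ler01.
Qed.

(** Here n^k <= (n + k)! / n!, the squared norm of z^k phi_n. *)
Lemma initial_moment u k : bargmann_fock u -> in_L2 (fun z => (bracket z ^+ k)%:C * u z) ->
  exists E0 : R, forall J, \sum_(n < J) n%:R ^+ k * abs2 (fcoef (factor u) n) <= E0.
Proof.
move=> bu /in_L2_integrable[_ iw]; have fu := fock_fun_factor bu; have [_ mu' _] := fu.
have ik : rintble (fun w => gaussian 1 w * abs2 (w ^+ k * factor u w)).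
  apply: (rintble_le _ _ iw).
    apply: rmeasM; first exact: rmeas_gaussian.
    by apply: rmeas_abs2; apply: cmeasM => //; exact: cmeas_pow.
  move=> w; rewrite ger0_norm ?mulr_ge0 ?expR_ge0 ?abs2_ge0//.
  rewrite abs2_bracket abs2M mulrCA abs2_factor ler_wpM2r ?abs2_ge0//.
  have -> : abs2 (w ^+ k) = abs2 w ^+ k by rewrite -!modulus_sqr modulusX -!exprM mulnC.
  have w0 := abs2_ge0 w; have w1 : 0 <= 1 + abs2 w by rewrite addr_ge0 ?ler01.
  by rewrite lerXn2r ?nnegrE// lerDr.
eexists => J; apply: le_trans (weighted_bessel J fu ik).
by apply: ler_sum => n _; rewrite ler_wpM2r ?abs2_ge0 ?rising_ge.
Qed.

End Conclusion.

Theorem theorem1p2 (R : realType) (k : nat) (hk : (1 <= k)%N)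
  (u0 : R[i] -> R[i]) (hu0 : bargmann_fock u0)
  (hku0 : in_L2 (fun z => (bracket z ^+ k)%:C * u0 z))
  (u : R -> R[i] -> R[i]) (hu : fock_solution u0 u) :
  exists Ck : R, forall t : R,
    (L2norm (fun z => ((bracket z ^+ k)%:C * u t z)%R)
       <= (Ck * (1 + `|t|) `^ ((k%:R - 1) / 2))%:E)%E.
Proof.
case: k hk hku0 => // k _ hku0.
have [[d [d0 bd _]] eqn u00] := hu.
have bu t : bargmann_fock (u t) by rewrite -d0; exact: bd.
have [v hv] := choice eqn.
have bv t : bargmann_fock (v t) by case: (hv t).
pose c t n := fcoef (factor (u t)) n; pose g t n := fcoef (factor (v t)) n.
have p0 : 0 < (2 * pi)^-1 :> R by rewrite invr_gt0 mulr_gt0 ?pi_gt0.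
have mc t : exists M : R, forall N, \sum_(n < N) abs2 (c t n) <= M by exact: mass_factor.
have mg t : exists M : R, forall N, \sum_(n < N) abs2 (g t n) <= M by exact: mass_factor.
have dc t (e : R) : 0 < e -> exists2 d : R, 0 < d & forall h : R, 0 < `|h| < d -> forall N,
    \sum_(n < N) abs2 ((h^-1)%:C * (c (t + h) n - c t n) - g t n) <= e.
  by move=> e0; apply: coef_derivative => //; case: (hv t).
have eqg t n : (fun L => (2 * pi)^-1 * \sum_(S < L) rate_term (c t) n S) @ \oo -->
    complex.Re ((c t n)^* * g t n).
  have := @cubic_rate R _ n (fock_fun_factor (bu t)).
  rewrite -(@coef_equation R (u t) (v t))//; last by case: (hv t).
  rewrite -/(c t) -/(g t n); have -> // : complex.Im ((c t n)^* * ('i%C * g t n)) =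
    complex.Re ((c t n)^* * g t n).
  by case: (c t n) (g t n) => x y [x' y'] /=; ring.
have [M M0 hM] := mass_conserved p0 mc mg dc eqg.
have start : exists E0 : R, forall J, \sum_(n < J) n%:R ^+ k.+1 * abs2 (c 0 n) <= E0.
  by rewrite /c u00; exact: initial_moment.
have [Ck Ck0 hCk] := moment_growth p0 mc mg dc eqg start.
pose A := 2 ^+ k.+1 * (M + k.+2%:R ^+ k.+1 * (M + Ck)) : R.
have A0 : 0 <= A 
  by rewrite /A mulr_ge0 ?exprn_ge0// addr_ge0// mulr_ge0 ?exprn_ge0// addr_ge0.
exists (A `^ 2^-1) => t; set X := 1 + `|t|.
have X1 : 1 <= X by rewrite lerDl.
have X0 : 0 <= X by apply: le_trans X1.
have -> : A `^ 2^-1 * X `^ ((k.+1%:R - 1) / 2) = (A * X ^+ k) `^ 2^-1.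
  rewrite powRM ?exprn_ge0//; congr (_ * _).
  by rewrite -natr1 addrK powRrM powR_mulrn.
apply: L2norm_le; first by rewrite mulr_ge0 ?exprn_ge0.
have -> : (fun z => abs2 ((bracket z ^+ k.+1)%:C * u t z)) =
    (fun w => (1 + abs2 w) ^+ k.+1 * (gaussian 1 w * abs2 (factor (u t) w))).
  by apply/funext => z; rewrite abs2_bracket abs2_factor.
apply: le_trans (@bracket_upper R _ k.+1 M (k.+2%:R ^+ k.+1 * (M + Ck * X ^+ k)) (fock_fun_factor (bu t)) _ _) _.
- move=> N; apply: le_trans (hM t N); apply: ler_sum => n _.
  by rewrite /rising addn0 divff ?mul1r// pnatr_eq0 -lt0n fact_gt0.
- move=> N; apply: (@le_trans _ _ (k.+2%:R ^+ k.+1 * (\sum_(n < N) (abs2 (c t n) + n%:R ^+ k.+1 * abs2 (c t n))))).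
    rewrite mulr_sumr; apply: ler_sum => n _; rewrite -[X in X + _]mul1r -mulrDl mulrA.
    by rewrite ler_wpM2r ?abs2_ge0 ?rising_le.
  by rewrite ler_wpM2l ?exprn_ge0// big_split/=; exact: lerD (hM t N) (hCk t N).
rewrite lee_fin /A -mulrA ler_wpM2l ?exprn_ge0//.
have Xk : 1 <= X ^+ k by exact: exprn_ege1.
rewrite mulrDl lerD ?ler_peMr//.
rewrite -mulrA ler_wpM2l ?exprn_ge0// mulrDl lerD2r ler_peMr//.
Qed.
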